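(* Let $k\ge 1$ be an integer. Let $f:(\mathbb{R}^2,\mathbf{0})\to(\mathbb{R}^3,\mathbf{0})$ be a map-germ $\mathcal{A}$-equivalent to the cuspidal edge and let $F:(\mathbb{R}^3,\mathbf{0})\to(\mathbb{R}^3,\mathbf{0})$ be a map-germ $\mathcal{A}$-equivalent to the fold. Assume the following three conditions: (A) the limiting tangent plane $LT$ of $f$ at $\mathbf{0}$ does not contain the kernel $\ker dF_{\mathbf{0}}$; (B) $LT$ is transverse to $S(F)$ at $\mathbf{0}$; (C) the singular curve $\hat\gamma=f(S(f))$ has a $k$-point contact with $S(F)$ at $\mathbf{0}$. Then the composition $F\circ f$ at $\mathbf{0}$ is $\mathcal{A}$-equivalent to the cuspidal $S_{k-1}^{\pm}$ singularity (for some choice of the sign). If $k$ is even, the sign $\pm$ is determined by the following rule. Since $k$ is the order of contact between $\hat\gamma$ and $S(F)$, $\hat\gamma$ is locally located on a half space bounded by $S(F)\subset\mathbb{R}^3$. If the image $\operatorname{Im}(f)$ is also locally located only on the same side as $\hat\gamma$, then $F\circ f$ is $\mathcal{A}$-equivalent to the cuspidal $S_{k-1}^{+}$ singularity. Otherwise, $F\circ f$ is $\mathcal{A}$-equivalent to the cuspidal $S_{k-1}^{-}$ singularity.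
   Context: All maps are of class $C^\infty$. Two map-germs $f_1,f_2:(\mathbb{R}^m,\mathbf{0})\to(\mathbb{R}^3,\mathbf{0})$ are $\mathcal{A}$-equivalent if there exist germs of $C^\infty$-diffeomorphisms $d_s$ of $(\mathbb{R}^m,\mathbf{0})$ and $d_t$ of $(\mathbb{R}^3,\mathbf{0})$ such that $d_t\circ f_1=f_2\circ d_s$. The cuspidal edge is the map-germ $(u,v)\mapsto(u,v^2,v^3)$ at the origin. The fold is the map-germ $(x,y,z)\mapsto(x,y,z^2)$ at the origin. For $j=0,1,2,\dots$, the cuspidal $S_j^{\pm}$ singularity is the map-germ $(x,y)\mapsto\big(x,y^2,y^3(x^{j+1}\pm y^2)\big)$ at the origin; if $j$ is even, the cuspidal $S_j^+$ and $S_j^-$ singularities are $\mathcal{A}$-equivalent. $S(f)$ and $S(F)$ denote the sets of singular points (points where the differential does not have maximal rank); for $f:(\mathbb{R}^2,\mathbf{0})\to(\mathbb{R}^3,\mathbf{0})$ a map-germ $\mathcal{A}$-equivalent to the cuspidal edge, $S(f)$ is a regular curve in $\mathbb{R}^2$, and for $F:(\mathbb{R}^3,\mathbf{0})\to(\mathbb{R}^3,\mathbf{0})$ a map-germ $\mathcal{A}$-equivalent to the fold, $S(F)$ is a smooth surface in $\mathbb{R}^3$ through $\mathbf{0}$. A map-germ $f$ that is $\mathcal{A}$-equivalent to the cuspidal edge is a frontal: there is a never-vanishing smooth vector field $\nu$ of $\mathbb{R}^3$ along $f$ with $\langle df(X_p),\nu(p)\rangle=0$ for all $p$ near $\mathbf{0}$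 and all $X_p\in T_p\mathbb{R}^2$. The limiting tangent plane of $f$ at $p$ is the plane perpendicular to $\nu(p)$. A curve $\hat\gamma$ (regularly parametrized as $\hat\gamma(t)=f(\gamma(t))$, with $\gamma$ a regular parametrization of $S(f)$, $\gamma(0)=\mathbf{0}$) has $k$-point contact with the surface $S(F)$ at $\mathbf{0}$ if, for a function $h$ with $S(F)=\{h=0\}$ near $\mathbf{0}$ and $dh(\mathbf{0})\ne 0$, the function $h\circ\hat\gamma$ satisfies $(h\circ\hat\gamma)^{(i)}(0)=0$ for $0\le i\le k-1$ and $(h\circ\hat\gamma)^{(k)}(0)\neq 0$. The (local) half spaces bounded by $S(F)$ are $\{h\ge 0\}$ and $\{h\le 0\}$ near $\mathbf{0}$. *)

(* Defs.v *)
From HB Require Import structures.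
From mathcomp Require Import all_boot all_order all_algebra.
From mathcomp Require Import all_classical all_reals all_analysis.

Set Implicit Arguments.
Unset Strict Implicit.
Unset Printing Implicit Defensive.

Import Order.TTheory GRing.Theory Num.Theory.
Import numFieldNormedType.Exports.

Local Open Scope classical_set_scope.
Local Open Scope ring_scope.

(** A germ at 0 is represented by a total function, of which only the
    restriction to some neighbourhood of 0 is constrained or used. *)

Section Smooth.
Context {R : realType} {V W : normedModType R}.

(** [f] is C^k on the open set [U]. Only used for finite-dimensional [V], where
    [x |-> 'd f x] is C^k as soon as all [x |-> 'd f x v] are. *)
Fixpoint Ck_on (k : nat) (U : set V) (f : V -> W) : Prop :=
  match k with
  | 0 => forall x, U x -> {for x, continuous f}
  | k'.+1 => (forall x, U x -> differentiable f x) /\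
             (forall v : V, Ck_on k' U (fun x => 'd f x v))
  end.

Definition smooth_germ (f : V -> W) : Prop :=
  exists U : set V, [/\ open U, U 0 & forall k, Ck_on k U f].

Definition map_germ (f : V -> W) : Prop := smooth_germ f /\ f 0 = 0.

End Smooth.

Section Equivalence.
Context {R : realType}.

Definition diffeo_germ (V : normedModType R) (d : V -> V) : Prop :=
  map_germ d /\
  exists e : V -> V,
    [/\ map_germ e, \forall x \near (0 : V), e (d x) = x
                  & \forall y \near (0 : V), d (e y) = y].

Definition A_equiv (V W : normedModType R) (f1 f2 : V -> W) : Prop :=
  exists (ds : V -> V) (dt : W -> W),
    [/\ diffeo_germ ds, diffeo_germ dt
      & \forall x \near (0 : V), dt (f1 x) = f2 (ds x)].

End Equivalence.

Section Models.
Context {R : realType}.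

Definition vec3 (a b c : R) : 'rV[R]_3 := \row_i tnth [tuple a; b; c] i.

Definition cuspidal_edge (p : 'rV[R]_2) : 'rV[R]_3 :=
  let u := p 0 0 in let v := p 0 1 in vec3 u (v ^+ 2) (v ^+ 3).

Definition fold_map (q : 'rV[R]_3) : 'rV[R]_3 :=
  let x := q 0 0 in let y := q 0 1 in let z := q 0 2%:R in
  vec3 x y (z ^+ 2).

(** S_j^+ is [cuspidal_S j false] and S_j^- is [cuspidal_S j true]. *)
Definition cuspidal_S (j : nat) (minus : bool) (p : 'rV[R]_2) : 'rV[R]_3 :=
  let x := p 0 0 in let y := p 0 1 in
  vec3 x (y ^+ 2) (y ^+ 3 * (x ^+ j.+1 + (-1) ^+ minus * y ^+ 2)).

End Models.

Section Geometry.
Context {R : realType}.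

Definition dot (n : nat) (u v : 'rV[R]_n) : R := \sum_i u 0 i * v 0 i.

Definition sing_set (m n : nat) (f : 'rV[R]_m -> 'rV[R]_n) :
    set 'rV[R]_m :=
  [set p | (\rank ('J f p) < minn m n)%N].

Definition normal_field (f nu : 'rV[R]_2 -> 'rV[R]_3) : Prop :=
  smooth_germ nu /\
  \forall p \near (0 : 'rV[R]_2),
    nu p != 0 /\ forall X, dot ('d f p X) (nu p) = 0.

(** Limiting tangent plane at [p], as a linear subspace, when [nu] is a normal
    field of the frontal. *)
Definition tangent_plane (nu : 'rV[R]_2 -> 'rV[R]_3) (p : 'rV[R]_2) :
    set 'rV[R]_3 :=
  [set w | dot w (nu p) = 0].

Definition kernel_d (m n : nat) (F : 'rV[R]_m -> 'rV[R]_n) (p : 'rV[R]_m) :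
    set 'rV[R]_m :=
  [set w | 'd F p w = 0].

(** [gamma] parametrizes the germ at 0 of [S] regularly, with [gamma 0 = 0]:
    the image of every small interval around 0 is a neighbourhood of 0 in
    [S]. *)
Definition regular_param (m : nat) (S : set 'rV[R]_m) (gamma : R^o -> 'rV[R]_m)
    : Prop :=
  [/\ map_germ gamma,
      \forall t \near (0 : R^o), 'D_1 gamma t != 0,
      \forall t \near (0 : R^o), S (gamma t)
    & forall I : set R^o, nbhs 0 I ->
        \forall p \near (0 : 'rV[R]_m), S p -> (gamma @` I) p].

Definition local_equation (n : nat) (S : set 'rV[R]_n) (h : 'rV[R]_n -> R^o) :
    Prop :=
  [/\ smooth_germ h,
      \forall q \near (0 : 'rV[R]_n), S q <-> h q = 0
    & exists w, 'd h 0 w != 0].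

(** Tangent space at 0 of the hypersurface with local equation [h]. *)
Definition tangent_space (n : nat) (h : 'rV[R]_n -> R^o) : set 'rV[R]_n :=
  [set w | 'd h 0 w = 0].

Definition transverse (n : nat) (P Q : set 'rV[R]_n) : Prop :=
  forall w, exists a b, [/\ P a, Q b & w = a + b].

(** The curve [c] has k-point contact at [c 0] with the hypersurface of local
    equation [h]. *)
Definition point_contact (n k : nat) (c : R^o -> 'rV[R]_n)
    (h : 'rV[R]_n -> R^o) : Prop :=
  (forall i, (i < k)%N -> derive1n i (h \o c) 0 = 0) /\ derive1n k (h \o c) 0 != 0.

(** The half space [h >= 0] if [s] is false, [h <= 0] if [s] is true. *)
Definition half_space (n : nat) (h : 'rV[R]_n -> R^o) (s : bool) :
    set 'rV[R]_n :=
  [set q | 0 <= (-1) ^+ s * h q].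

Definition locally_in (V : normedModType R) (n : nat) (f : V -> 'rV[R]_n)
    (H : set 'rV[R]_n) : Prop :=
  \forall x \near (0 : V), H (f x).

End Geometry.

(* Main.v *)
(** Write [t] for the second source coordinate. Conjugating by the two given
    A-equivalences, [F \o f] is the fold composed with [Phi] composed with the
    cuspidal edge, where [Phi] is a diffeomorphism; (A) says that, to first order,
    the first two components of [Phi] are coordinates on the limiting tangent plane,
    and (B) that the third component of [Phi] is not critical there. By Whitney's
    theorem every germ is [a + t * b] with [a] and [b] functions of [(x, t^2)], so
    that coordinate changes bring the first two components of [F \o f] to [(x,
    t^2)]; the third one is then the square of a height [p (x, t^2) + t^3 * b (x,
    t^2)] with [b 0 != 0], and modulo functions of [(x, t^2)] this square is [2 *
    t^3 * (p * b) (x, t^2)]. Up to units, the height is the equation of [S(F)]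
    evaluated on [f], so (C) gives [p (x, y) = x^k * n (x, y) + y * m (x, y)] with
    [n 0 != 0], and [m 0 != 0] by (B) if [k > 1]. Rescaling [x] yields the cuspidal
    [S_(k-1)] singularity with the sign of [n 0 * m 0]; for even [k], [Im f] stays
    on the side of [x^k * n] exactly when [m 0] and [n 0] have the same sign.

    Whitney's theorem follows from Seeley's extension operator applied to [u |-> phi
    (sqrt u)]: for [u < 0] one takes [sum_k a_k * phi (sqrt (- 8^k * u))], all the
    moments [sum_k a_k * (- 8^k)^m] being 1. *)
Require Import Defs.
From HB Require Import structures.
From mathcomp Require Import all_boot all_order all_algebra.
From mathcomp Require Import all_classical all_reals all_analysis.
From mathcomp Require Import measurable_realfun perm ring lra.
Import Order.TTheory GRing.Theory Num.Theory.
Import numFieldNormedType.Exports.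
Local Open Scope classical_set_scope.
Local Open Scope ring_scope.

Set Implicit Arguments.
Unset Strict Implicit.
Unset Printing Implicit Defensive.

(** * Differentials and germs of smooth maps *)

Section Diff.
Context {R : realType} {V W : normedModType R}.

(** An even function composed with the square root is smooth up to [u = 0] only, whereas germs in
    [(x, u)] must be smooth on both sides. Seeley's extension is compatible with differentiation in
    [u]: for even [phi], the quotient of the [t]-derivative by [2 t] is smooth, even, and equal to
    the derivative in [u]; extending it with the weights [- 8^k * a_k], whose moments are again all
    1, gives the derivative of the extension of [phi]. First-order differentiability, proved for all
    such weights at once, therefore yields every order by induction. The series evaluates [phi]
    arbitrarily far from the origin; hence the cutoffs, which are divided out at the end.

    Contact of order one is a case apart: [p] then has a nonzero derivative along the singular curve
    while [m 0] may vanish, so that [p - y], and not a multiple of [x], becomes the new source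
    coordinate, and the normal form is [S_0] with the plus sign. *)

Lemma is_diff_eps (f : V -> W) (x : V) (L : {linear V -> W}) :
  continuous L ->
  (forall e, 0 < e ->
     \forall h \near (0 : V), `|f (h + x) - f x - L h| <= e * `|h|) ->
  is_diff x f L.
Proof.
move=> Lc H.
have E : f \o shift x = cst (f x) + L +o_ 0 id.
  apply/eqaddoP => e e0; near=> h.
  rewrite /= !fctE /= opprD addrA; near: h; exact: H.
have D := diff_unique Lc E.
apply: DiffDef => //; apply/diff_locallyP; rewrite D; split => //.
Unshelve. all: by end_near. Qed.

Lemma diff_eps (f : V -> W) (x : V) : differentiable f x ->
  forall e, 0 < e ->
     \forall h \near (0 : V), `|f (h + x) - f x - 'd f x h| <= e * `|h|.
Proof.
move=> /diff_locallyP[_ /eqaddoP H] e e0; have := H e e0.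
apply: filterS => h; by rewrite /= !fctE /= opprD addrA.
Qed.

Lemma is_diff_near (f g : V -> W) (x : V) :
  (\forall y \near x, f y = g y) -> differentiable f x ->
  is_diff x g ('d f x).
Proof.
move=> fg df; have fgx : f x = g x by apply: nbhs_singleton fg.
apply: is_diff_eps; first exact: diff_continuous.
move=> e e0; have := diff_eps df e0.
have : \forall h \near (0 : V), f (h + x) = g (h + x).
  move: fg; rewrite (near_shift 0) /=; apply: filterS => h /=.
  by rewrite subr0.
by apply: filterS2 => h -> ; rewrite fgx.
Qed.

Lemma differentiable_near (f g : V -> W) (x : V) :
  (\forall y \near x, f y = g y) -> differentiable f x -> differentiable g x.
Proof. by move=> fg /(is_diff_near fg)[]. Qed.

Lemma diff_near (f g : V -> W) (x : V) :
  (\forall y \near x, f y = g y) -> differentiable f x -> 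
  'd g x = 'd f x :> (V -> W).
Proof. by move=> fg /(is_diff_near fg)[]. Qed.

End Diff.

Lemma near_forall (T : topologicalType) (I : finType) (x : T) (P : I -> T -> Prop) :
  (forall i, \forall y \near x, P i y) -> \forall y \near x, forall i, P i y.
Proof. exact: filter_forall. Qed.

Section RowLin.
Context {R : realType} {W : normedModType R} {n : nat}.

(** Differentials assembled from partial derivatives take this form. *)
Definition rowlin (c : 'I_n -> W) (v : 'rV[R]_n) : W := \sum_j v 0 j *: c j.

Lemma rowlin_is_linear c : linear (rowlin c).
Proof.
move=> a u v; rewrite /rowlin scaler_sumr -big_split /=; apply: eq_bigr => j _.
by rewrite !mxE scalerDl scalerA.
Qed.

HB.instance Definition _ c :=
  GRing.isLinear.Build R 'rV[R]_n W *:%R (rowlin c) (rowlin_is_linear c).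

Lemma coord_le_norm (v : 'rV[R]_n) j : `|v 0 j| <= `|v|.
Proof.
rewrite [leRHS]/Num.norm /= mx_normrE.
exact: (le_bigmax _ (fun ij => `|v ij.1 ij.2|) (0, j)).
Qed.

Lemma norm_rV_le (v : 'rV[R]_n) e : 0 <= e -> (forall j, `|v 0 j| <= e) -> `|v| <= e.
Proof.
move=> e0 H; rewrite [leLHS]/Num.norm /= mx_normrE; apply/bigmax_leP; split => //.
by move=> [i j] _ /=; rewrite ord1.
Qed.

Lemma rowlin_bound c v : `|rowlin c v| <= (\sum_j `|c j|) * `|v|.
Proof.
rewrite /rowlin mulr_suml (le_trans (ler_norm_sum _ _ _))//; apply: ler_sum => j _.
by rewrite normrZ mulrC ler_wpM2l// coord_le_norm.
Qed.

Lemma rowlin_continuous c : continuous (rowlin c).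
Proof.
apply: bounded_linear_continuous; apply/linear_boundedP; near=> r => x.
rewrite (le_trans (rowlin_bound _ _))// ler_wpM2r//; near: r.
Unshelve. all: by end_near. Qed.

Lemma row_delta (v : 'rV[R]_n) : v = \sum_j v 0 j *: delta_mx 0 j.
Proof. exact: row_sum_delta. Qed.

Lemma linear_rowlin (L : {linear 'rV[R]_n -> W}) v :
  L v = rowlin (fun j => L (delta_mx 0 j)) v.
Proof.
rewrite {1}[v]row_delta linear_sum /rowlin; apply: eq_bigr => j _.
by rewrite linearZ.
Qed.

Lemma linear_rV_continuous (L : {linear 'rV[R]_n -> W}) : continuous L.
Proof.
rewrite (_ : (L : _ -> _) = rowlin (fun j => L (delta_mx 0 j))).
  exact: rowlin_continuous.
by apply/funext => v; rewrite linear_rowlin.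
Qed.

End RowLin.

(** * Closure properties of maps of class C^k on an open set *)

Section CkOn.
Context {R : realType}.
Implicit Types V W : normedModType R.

Lemma open_nearP V (U : set V) x : open U -> U x -> \forall y \near x, U y.
Proof. by move=> oU Ux; apply: open_nbhs_nbhs. Qed.

Lemma Ck_on_eq V W k (U : set V) (f g : V -> W) : open U ->
  (forall x, U x -> f x = g x) -> Ck_on k U f -> Ck_on k U g.
Proof.
move=> oU; elim: k f g => [|k IH] f g fg /=.
  move=> H x Ux; have fgn : \forall y \near x, f y = g y.
    by near=> y; apply: fg; near: y; exact: open_nearP.
  have := H x Ux; rewrite /prop_for /continuous_at -fg//.
  move=> fc; apply: cvg_trans fc; apply: near_eq_cvg.
  by apply: filterS fgn => y ->.
have fgn x : U x -> \forall y \near x, f y = g y.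
  by move=> Ux; near=> y; apply: fg; near: y; exact: open_nearP.
move=> [df H]; split => [x Ux|v].
  exact: differentiable_near (fgn _ Ux) (df _ Ux).
apply: IH (H v) => x Ux; by rewrite (diff_near (fgn _ Ux) (df _ Ux)).
Unshelve. all: by end_near. Qed.

Lemma Ck_onS V W k (U U' : set V) (f : V -> W) : U' `<=` U ->
  Ck_on k U f -> Ck_on k U' f.
Proof.
move=> UU'; elim: k f => [|k IH] f /=; first by move=> H x /UU'; apply: H.
by move=> [df H]; split => [x /UU'|v]; [exact: df|exact: IH].
Qed.

Lemma Ck_on_pred V W k (U : set V) (f : V -> W) : Ck_on k.+1 U f -> Ck_on k U f.
Proof.
elim: k f => [|k IH] f [df H].
  by move=> x Ux; apply: differentiable_continuous; exact: df.
by split => // v; apply: IH.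
Qed.

Lemma Ck_on_cst V W k (U : set V) (a : W) : Ck_on k U (fun=> a).
Proof.
elim: k a => [|k IH] a /=; first by move=> x _; exact: cst_continuous.
split=> [x _|v]; first exact: differentiable_cst.
by under eq_fun do rewrite (diff_cst a); exact: IH.
Qed.

Lemma Ck_onD V W k (U : set V) (f g : V -> W) : open U ->
  Ck_on k U f -> Ck_on k U g -> Ck_on k U (fun x => f x + g x).
Proof.
move=> oU; elim: k f g => [|k IH] f g /=.
  by move=> H H' x Ux; apply: continuousD; [exact: H|exact: H'].
move=> [df H] [dg H']; split=> [x Ux|v].
  by apply: (@differentiableD _ _ _ f g); [exact: df|exact: dg].
apply: (Ck_on_eq oU _ (IH _ _ (H v) (H' v))) => x Ux.
by rewrite (@diffD _ _ _ f g)//; [exact: df|exact: dg].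
Qed.

Lemma Ck_on_sum V W k (U : set V) (I : Type) (r : seq I) (P : pred I) (f : I -> V -> W) : open U ->
  (forall i, P i -> Ck_on k U (f i)) -> Ck_on k U (fun x => \sum_(i <- r | P i) f i x).
Proof.
move=> oU H; elim: r => [|i r IH].
  rewrite (_ : (fun x => _) = (fun=> 0 : W)); [exact: Ck_on_cst|by apply/funext => x; rewrite big_nil].
rewrite (_ : (fun x => _) = fun x => if P i then f i x + \sum_(j <- r | P j) f j x else \sum_(j <- r | P j) f j x); last first.
  by apply/funext => x; rewrite big_cons; case: (P i).
by have [Pi|Pi] := boolP (P i); rewrite ?(negbTE Pi)//; apply: Ck_onD => //; exact: H.
Qed.

Lemma Ck_onM V k (U : set V) (f g : V -> R^o) : open U ->
  Ck_on k U f -> Ck_on k U g -> Ck_on k U (fun x => f x * g x : R^o).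
Proof.
move=> oU; elim: k f g => [|k IH] f g.
  by move=> H H' x Ux; apply: continuousM; [exact: H|exact: H'].
move=> /[dup] Cf [df H] /[dup] Cg [dg H']; split=> [x Ux|v].
  by apply: (@differentiableM _ _ f g); [exact: df|exact: dg].
have E x : U x -> f x * 'd g x v + g x * 'd f x v = 'd (fun x => f x * g x) x v.
  by move=> Ux; rewrite (@diffM _ _ f g)//; [exact: df|exact: dg].
apply: (Ck_on_eq oU E).
apply: Ck_onD => //.
  apply: (IH f (fun x => 'd g x v)); [exact: Ck_on_pred|exact: H'].
apply: (IH g (fun x => 'd f x v)); [exact: Ck_on_pred|exact: H].
Qed.

Lemma Ck_on_prod V k (U : set V) (I : Type) (r : seq I) (P : pred I) (f : I -> V -> R) : open U ->
  (forall i, P i -> Ck_on k U (f i : V -> R^o)) ->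
  Ck_on k U ((fun x => \prod_(i <- r | P i) f i x) : V -> R^o).
Proof.
move=> oU H; elim: r => [|i r IH].
  rewrite (_ : (fun x => _) = (fun=> 1)); first exact: (@Ck_on_cst _ R^o).
  by apply/funext => x; rewrite big_nil.
have [Pi|Pi] := boolP (P i).
  rewrite (_ : (fun x => _) = fun x => f i x * \prod_(j <- r | P j) f j x).
    by apply: (@Ck_onM _ k U (f i)) => //; exact: H.
  by apply/funext => x; rewrite big_cons Pi.
rewrite (_ : (fun x => _) = fun x => \prod_(j <- r | P j) f j x)//.
by apply/funext => x; rewrite big_cons (negbTE Pi).
Qed.

Lemma Ck_onN V k (U : set V) (f : V -> R^o) : open U ->
  Ck_on k U f -> Ck_on k U (fun x => - f x : R^o).
Proof.
move=> oU H; under eq_fun do rewrite -mulN1r.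
by apply: Ck_onM => //; exact: Ck_on_cst.
Qed.

Lemma Ck_on_linear n W k (U : set 'rV[R]_n) (L : {linear 'rV[R]_n -> W}) :
  Ck_on k U L.
Proof.
have Lc := @linear_rV_continuous _ _ _ L.
case: k => [|k]; first by move=> x _; exact: Lc.
split=> [x _|v]; first exact: linear_differentiable.
under eq_fun do rewrite diff_lin//; exact: Ck_on_cst.
Qed.

Lemma coord_is_linear n (j : 'I_n) : linear (fun v : 'rV[R]_n => v 0 j : R^o).
Proof. by move=> a u v; rewrite !mxE. Qed.

Definition coordl n (j : 'I_n) : {linear 'rV[R]_n -> R^o} :=
  HB.pack (fun v : 'rV[R]_n => v 0 j : R^o)
    (GRing.isLinear.Build R 'rV[R]_n R^o *:%R (fun v : 'rV[R]_n => v 0 j)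
       (coord_is_linear j)).

Lemma is_diff_coord V n (f : V -> 'rV[R]_n) x j : differentiable f x ->
  is_diff x (fun x => f x 0 j : R^o) (fun v => 'd f x v 0 j : R^o).
Proof.
move=> df; have cc := @linear_rV_continuous _ _ _ (@coordl n j).
have dc y : differentiable (@coordl n j) y by exact: linear_differentiable.
have := differentiable_comp df (dc (f x)).
split=> //.
have := diff_comp df (dc (f x)).
by rewrite (diff_lin (f x) cc) => E; apply/funext => v; rewrite -[RHS]/((coordl j \o 'd f x) v) -E.
Qed.

Lemma Ck_on_coord V n k (U : set V) (f : V -> 'rV[R]_n) j : open U ->
  Ck_on k U f -> Ck_on k U (fun x => f x 0 j : R^o).
Proof.
move=> oU; elim: k f => [|k IH] f.
  move=> H x Ux; apply: (@continuous_comp _ _ _ f (fun v : 'rV_n => v 0 j : R^o)).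
    exact: H.
  exact: coord_continuous.
move=> [df H]; split=> [x Ux|v].
  by have [] := is_diff_coord j (df x Ux).
apply: (Ck_on_eq oU _ (IH _ (H v))) => x Ux.
by have [_ ->] := is_diff_coord j (df x Ux).
Qed.

Lemma is_diff_row V n (f : V -> 'rV[R]_n) x :
  (forall j, differentiable (fun x => f x 0 j : R^o) x) ->
  is_diff x f (fun v => \row_j 'd (fun x => f x 0 j : R^o) x v).
Proof.
move=> df; have fE : f = \sum_j (fun y => (f y 0 j : R^o) *: (delta_mx 0 j : 'rV[R]_n)).
  by apply/funext => y; rewrite fct_sumE [LHS]row_sum_delta.
have d : differentiable f x.
  by rewrite fE; apply: differentiable_sum => j; exact: differentiableZl.
split=> //; apply/funext => v; apply/rowP => j; rewrite mxE.
by have [_ E] := is_diff_coord j d; exact: (esym (congr1 (@^~ v) E)).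
Qed.

Lemma Ck_on_row V n k (U : set V) (f : V -> 'rV[R]_n) : open U ->
  (forall j, Ck_on k U (fun x => f x 0 j : R^o)) -> Ck_on k U f.
Proof.
move=> oU; elim: k f => [|k IH] f H.
  move=> x Ux; apply/(@cvgrPdist_le _ 'rV[R]_n _ (nbhs x)) => e e0.
  have : \forall y \near x, forall j, `|f x 0 j - f y 0 j| <= e.
    apply: (@filter_forall _ _ (fun j y => `|f x 0 j - f y 0 j| <= e) (nbhs x)) => j.
    by have /(@cvgrPdist_le _ R^o _ (nbhs x)) := H j x Ux; apply.
  apply: filterS => y Hy; apply: norm_rV_le; first exact: ltW.
  by move=> j; rewrite !mxE; exact: Hy.
have df x : U x -> forall j, differentiable (fun x => f x 0 j : R^o) x.
  by move=> Ux j; have [+ _] := H j; exact.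
split=> [x Ux|v]; first by have [] := is_diff_row (df x Ux).
apply: IH => j; have [_ /(_ v)] := H j.
apply: Ck_on_eq => // x Ux.
by have [_ ->] := is_diff_row (df x Ux); rewrite mxE.
Qed.

(** By the chain rule the derivative of [g \o f] is a sum of products of coordinates of ['d f x v]
    with partial derivatives of [g] composed with [f], so the induction on [k] stays among scalar
    functions. *)
Lemma Ck_on_comp V n k (U : set V) (U' : set 'rV[R]_n)
    (f : V -> 'rV[R]_n) (g : 'rV[R]_n -> R^o) : open U ->
  (forall x, U x -> U' (f x)) ->
  Ck_on k U f -> Ck_on k U' g -> Ck_on k U (g \o f).
Proof.
move=> oU fU; elim: k f g fU => [|k IH] f g fU.
  by move=> H H' x Ux; apply: continuous_comp; [exact: H|apply: H'; exact: fU].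
move=> /[dup] Cf [df H] [dg H']; split=> [x Ux|v].
  exact: (differentiable_comp (df x Ux) (dg _ (fU _ Ux))).
have E x : U x -> \sum_j ('d f x v 0 j * 'd g (f x) (delta_mx 0 j))
                   = 'd (g \o f) x v.
  move=> Ux; rewrite (diff_comp (df x Ux) (dg _ (fU _ Ux))).
  by rewrite /= [RHS]linear_rowlin.
apply: (Ck_on_eq oU E); apply: Ck_on_sum => // j _; apply: Ck_onM => //.
  by apply: Ck_on_coord => //; exact: H.
apply: (IH f (fun y => 'd g y (delta_mx 0 j))) => //; last exact: H'.
exact: Ck_on_pred.
Qed.

Lemma Ck_on_compV V n k (U : set V) (U' : set 'rV[R]_n) p
    (f : V -> 'rV[R]_n) (g : 'rV[R]_n -> 'rV[R]_p) : open U ->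
  (forall x, U x -> U' (f x)) -> open U' ->
  Ck_on k U f -> Ck_on k U' g -> Ck_on k U (g \o f).
Proof.
move=> oU fU oU' Cf Cg; apply: Ck_on_row => // j.
exact: (@Ck_on_comp _ _ _ U U' f (fun y => g y 0 j : R^o) oU fU Cf (Ck_on_coord j oU' Cg)).
Qed.

Lemma Ck_on_inv V k (U : set V) (f : V -> R^o) : open U ->
  (forall x, U x -> f x != 0) ->
  Ck_on k U f -> Ck_on k U (fun x => (f x)^-1 : R^o).
Proof.
move=> oU f0; elim: k => [|k IH].
  by move=> H x Ux; apply: continuousV; [exact: f0|exact: H].
move=> /[dup] Cf [df H]; split=> [x Ux|v].
  by apply: (@differentiableV _ _ f); [exact: df|exact: f0].
have E x : U x -> - ((f x)^-1 * (f x)^-1) * 'd f x v = 'd (fun x => (f x)^-1) x v.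
  move=> Ux; rewrite (@diffV _ _ f); [|exact: df|exact: f0].
  by rewrite expr2 invfM.
apply: (Ck_on_eq oU E); apply: Ck_onM => //; last exact: H.
by apply: Ck_onN => //; apply: Ck_onM => //; apply: IH; exact: Ck_on_pred.
Qed.

End CkOn.

(** * Closure properties of smooth germs *)

Section SmoothGerm.
Context {R : realType}.
Implicit Types V W : normedModType R.

Lemma smooth_germ_cst V W (a : W) : smooth_germ (fun _ : V => a).
Proof. exists setT; split => //; [exact: openT|by move=> k; exact: Ck_on_cst]. Qed.

(** Neighbourhoods are intersected here once and for all; closure rules on open sets then pass to
    germs. *)
Lemma smooth_germ2 V1 V2 V3 V4 (f : V1 -> V2) (g : V1 -> V3) (h : V1 -> V4) :
  (forall (U : set V1) k, open U -> Ck_on k U f -> Ck_on k U g -> Ck_on k U h) ->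
  smooth_germ f -> smooth_germ g -> smooth_germ h.
Proof.
move=> H [U [oU U0 Cf]] [U' [oU' U'0 Cg]]; exists (U `&` U'); split=> //.
  exact: openI.
move=> k; apply: H; first exact: openI.
  by apply: (Ck_onS _ (Cf k)) => x [].
by apply: (Ck_onS _ (Cg k)) => x [].
Qed.

Lemma smooth_germD V W (f g : V -> W) :
  smooth_germ f -> smooth_germ g -> smooth_germ (fun x => f x + g x).
Proof. by apply: smooth_germ2 => U k oU; exact: Ck_onD. Qed.

Lemma smooth_germ_sum V W (I : finType) (P : pred I) (f : I -> V -> W) :
  (forall i, P i -> smooth_germ (f i)) ->
  smooth_germ (fun x => \sum_(i | P i) f i x).
Proof.
move=> H; elim: (index_enum I) => [|i r IH].
  rewrite (_ : (fun x => _) = (fun=> 0)); first exact: smooth_germ_cst.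
  by apply/funext => x; rewrite big_nil.
have [Pi|Pi] := boolP (P i).
  rewrite (_ : (fun x => _) = fun x => f i x + \sum_(j <- r | P j) f j x).
    by apply: smooth_germD => //; exact: H.
  by apply/funext => x; rewrite big_cons Pi.
rewrite (_ : (fun x => _) = fun x => \sum_(j <- r | P j) f j x)//.
by apply/funext => x; rewrite big_cons (negbTE Pi).
Qed.

Lemma smooth_germM V (f g : V -> R^o) :
  smooth_germ f -> smooth_germ g -> smooth_germ (fun x => f x * g x : R^o).
Proof. by apply: smooth_germ2 => U k oU; exact: Ck_onM. Qed.

Lemma smooth_germN V (f : V -> R^o) :
  smooth_germ f -> smooth_germ (fun x => - f x : R^o).
Proof.
by move=> sf; apply: (smooth_germ2 _ sf sf) => U k oU + _; exact: Ck_onN.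
Qed.

Lemma smooth_germB V (f g : V -> R^o) :
  smooth_germ f -> smooth_germ g -> smooth_germ (fun x => f x - g x : R^o).
Proof. by move=> sf sg; apply: smooth_germD => //; exact: smooth_germN. Qed.

Lemma smooth_germX V (f : V -> R^o) n :
  smooth_germ f -> smooth_germ (fun x => f x ^+ n : R^o).
Proof.
move=> sf; elim: n => [|n IH].
  by under eq_fun do rewrite expr0; exact: smooth_germ_cst.
by under eq_fun do rewrite exprS; exact: smooth_germM.
Qed.

Lemma smooth_germ_continuous V W (f : V -> W) : smooth_germ f ->
  \forall x \near (0 : V), {for x, continuous f}.
Proof.
move=> [U [oU U0 Cf]]; near=> x; apply: (Cf 0); near: x.
exact: open_nearP.
Unshelve. all: by end_near. Qed.

Lemma smooth_germ_continuous0 V W (f : V -> W) : smooth_germ f ->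
  {for 0, continuous f}.
Proof. by move=> /smooth_germ_continuous/nbhs_singleton. Qed.

Lemma smooth_germ_small V (f : V -> R^o) e : smooth_germ f -> f 0 = 0 -> 0 < e ->
  \forall x \near (0 : V), `|f x| <= e.
Proof.
move=> /smooth_germ_continuous0 fc f0 e0.
have /(@cvgr_dist_le _ R^o _ (nbhs 0)) /(_ e e0) := fc.
by apply: filterS => x; rewrite f0 sub0r normrN.
Qed.

Lemma smooth_germ_differentiable V W (f : V -> W) : smooth_germ f ->
  \forall x \near (0 : V), differentiable f x.
Proof.
move=> [U [oU U0 Cf]]; near=> x; have [+ _] := Cf 1; apply; near: x.
exact: open_nearP.
Unshelve. all: by end_near. Qed.

Lemma smooth_germ_differentiable0 V W (f : V -> W) : smooth_germ f ->
  differentiable f 0.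
Proof. by move=> /smooth_germ_differentiable/nbhs_singleton. Qed.

Lemma smooth_germ_diff V W (f : V -> W) v : smooth_germ f ->
  smooth_germ (fun x => 'd f x v).
Proof.
move=> [U [oU U0 Cf]]; exists U; split => // k; have [_ +] := Cf k.+1; exact.
Qed.

Lemma smooth_germ_inv V (f : V -> R^o) : smooth_germ f -> f 0 != 0 ->
  smooth_germ (fun x => (f x)^-1 : R^o).
Proof.
move=> /[dup] sf [U [oU U0 Cf]] f0.
have n0 : \forall x \near (0 : V), f x != 0.
  exact: (@cvgr_neq0 _ R^o _ (nbhs 0) _ f (f 0) (smooth_germ_continuous0 sf) f0).
exists (U `&` interior [set x | f x != 0]); split.
- exact: openI oU (open_interior _).
- by split.
- move=> k; apply: Ck_on_inv.
  + exact: openI oU (open_interior _).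
  + by move=> x [_ /interior_subset].
  + by apply: (Ck_onS _ (Cf k)) => x [].
Qed.

Lemma smooth_germ_linear n W (L : {linear 'rV[R]_n -> W}) : smooth_germ L.
Proof. by exists setT; split => //; [exact: openT|move=> k; exact: Ck_on_linear]. Qed.

Lemma smooth_germ_proj n (j : 'I_n) : smooth_germ (fun v : 'rV[R]_n => v 0 j : R^o).
Proof. exact: (smooth_germ_linear (coordl j)). Qed.

Lemma smooth_germ_coord V n (f : V -> 'rV[R]_n) j :
  smooth_germ f -> smooth_germ (fun x => f x 0 j : R^o).
Proof.
by move=> sf; apply: (smooth_germ2 _ sf sf) => U k oU + _; exact: Ck_on_coord.
Qed.

Lemma smooth_germ_row V n (f : V -> 'rV[R]_n) :
  (forall j, smooth_germ (fun x => f x 0 j : R^o)) -> smooth_germ f.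
Proof.
move=> /choice[U HU]; exists (interior [set x | forall j, U j x]); split.
- exact: open_interior.
- apply: (@filter_forall _ _ U (nbhs 0)) => j.
  by have [oU U0 _] := HU j; exact: (open_nearP oU U0).
- move=> k; apply: Ck_on_row; first exact: open_interior.
  move=> j; have [_ _ Cf] := HU j; apply: (Ck_onS _ (Cf k)) => x.
  by move/interior_subset; exact.
Qed.

Lemma smooth_germ_comp V n (f : V -> 'rV[R]_n) (g : 'rV[R]_n -> R^o) :
  map_germ f -> smooth_germ g -> smooth_germ (g \o f).
Proof.
move=> [sf f0] [U' [oU' U'0 Cg]]; have [U [oU U0 Cf]] := sf.
have fU' : \forall x \near (0 : V), U' (f x).
  apply: (smooth_germ_continuous0 sf); rewrite f0; exact: (open_nearP oU' U'0).
exists (U `&` interior [set x | U' (f x)]); split.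
- exact: openI oU (open_interior _).
- by split.
- move=> k; apply: (@Ck_on_comp _ _ _ _ _ U').
  + exact: openI oU (open_interior _).
  + by move=> x [_ /interior_subset].
  + by apply: (Ck_onS _ (Cf k)) => x [].
  + exact: Cg.
Qed.

Lemma smooth_germ_compV V n p (f : V -> 'rV[R]_n) (g : 'rV[R]_n -> 'rV[R]_p) :
  map_germ f -> smooth_germ g -> smooth_germ (g \o f).
Proof.
move=> mf sg; apply: smooth_germ_row => j.
exact: (smooth_germ_comp mf (smooth_germ_coord j sg)).
Qed.

Lemma map_germ_comp V n p (f : V -> 'rV[R]_n) (g : 'rV[R]_n -> 'rV[R]_p) :
  map_germ f -> map_germ g -> map_germ (g \o f).
Proof.
move=> mf [sg g0]; split; first exact: smooth_germ_compV.
by rewrite /= (proj2 mf).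
Qed.

Lemma near_comp V W (f : V -> W) (P : set W) : map_germ f ->
  (\forall y \near (0 : W), P y) -> \forall x \near (0 : V), P (f x).
Proof. by move=> [/smooth_germ_continuous0 + f0] => /(_ P); rewrite f0. Qed.

End SmoothGerm.

(** * The inverse function theorem *)

Section MeanValue.
Context {R : realType}.

Lemma mvt_segment (V : normedModType R) (phi : V -> R^o) (x h : V) :
  (forall t : R, 0 <= t <= 1 -> differentiable phi (x + t *: h)) ->
  exists2 t : R, 0 <= t <= 1 & phi (x + h) - phi x = 'd phi (x + t *: h) h.
Proof.
move=> dphi.
pose l (t : R^o) : V := x + t *: h.
have dl (t : R^o) : is_diff t l (fun s => s *: h).
  have := @is_diffD R R^o V (cst x) ( *:%R ^~ h) _ _ t (is_diff_cst x t) (is_diff_scalel t h).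
  move=> [dlt dlv]; split; first exact: dlt.
  by rewrite [LHS]dlv; apply/funext => s; rewrite !fctE add0r.
have D (t : R) : 0 <= t <= 1 -> is_derive t 1 (phi \o l : R -> R^o) ('d phi (l t) h).
  move=> t01; have dc : differentiable (phi \o l) (t : R^o).
    by apply: differentiable_comp => //; exact: dphi.
  apply: DeriveDef; first exact: diff_derivable.
  rewrite deriveE// diff_comp//; last exact: dphi.
  by rewrite /= diff_val scale1r.
have D' (t : R) : t \in `]0, 1[ -> is_derive t 1 (phi \o l : R -> R^o) ('d phi (l t) h).
  by rewrite in_itv/= => /andP[t0 t1]; apply: D; rewrite !ltW.
have Dc : {within `[0, 1], continuous (phi \o l : R -> R^o)}.
  apply: derivable_within_continuous => t; rewrite in_itv/= => /D.
  by move=> ?; exact: ex_derive.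
have [t t01] := MVT ltr01 D' Dc.
rewrite /l /= scale1r scale0r addr0 subr0 mulr1 => ->; exists t => //.
by move: t01; rewrite in_itv/= => /andP[t0 t1]; rewrite !ltW.
Qed.

Lemma norm_segment (V : normedModType R) (x y : V) (t r : R) : 0 <= t <= 1 ->
  `|x| <= r -> `|y| <= r -> `|x + t *: (y - x)| <= r.
Proof.
move=> /andP[t0 t1] xr yr.
have -> : x + t *: (y - x) = (1 - t) *: x + t *: y.
  by rewrite scalerBr scalerBl scale1r addrA addrAC.
rewrite (le_trans (ler_normD _ _))// !normrZ ger0_norm ?subr_ge0// (ger0_norm t0).
have : (1 - t) * `|x| <= (1 - t) * r by rewrite ler_wpM2l ?subr_ge0.
have : t * `|y| <= t * r by rewrite ler_wpM2l.
lra.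
Qed.

End MeanValue.

Section SmoothDeterminant.
Context {R : realType} {V : normedModType R}.

Lemma Ck_on_det k (U : set V) n (M : V -> 'M[R]_n) : open U ->
  (forall i j, Ck_on k U (fun x => M x i j : R^o)) ->
  Ck_on k U (fun x => \det (M x) : R^o).
Proof.
move=> oU H; rewrite /determinant; apply: Ck_on_sum => // s _.
apply: Ck_onM => //; first exact: Ck_on_cst.
by apply: (@Ck_on_prod _ _ _ _ _ _ _ (fun i x => M x i (s i))).
Qed.

(** Cramer's rule expresses the inverse by determinants, which are polynomial in the entries. *)
Lemma Ck_on_invmx k (U : set V) n (M : V -> 'M[R]_n) i j : open U ->
  (forall x, U x -> M x \in unitmx) ->
  (forall i j, Ck_on k U (fun x => M x i j : R^o)) ->
  Ck_on k U (fun x => invmx (M x) i j : R^o).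
Proof.
move=> oU uM H.
have E x : U x -> (\det (M x))^-1 * ((-1) ^+ (j + i) *
      \det (row' j (col' i (M x)))) = invmx (M x) i j.
  by move=> Ux; rewrite /invmx (uM _ Ux) !mxE.
apply: (Ck_on_eq oU E); apply: Ck_onM => //.
  apply: Ck_on_inv => //; last exact: Ck_on_det.
  by move=> x /uM; rewrite unitmxE unitfE.
apply: Ck_onM => //; first exact: Ck_on_cst.
by apply: Ck_on_det => // a b; under eq_fun do rewrite !mxE; exact: H.
Qed.

End SmoothDeterminant.

Section InverseFunction.
Context {R : realType} {n : nat}.
Implicit Types (d e : 'rV[R]_n -> 'rV[R]_n) (x y v : 'rV[R]_n).

Lemma diff_jacobian m p (f : 'rV[R]_m -> 'rV[R]_p) (x v : 'rV[R]_m) : 'd f x v = v *m 'J f x.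
Proof. by rewrite /jacobian mul_rV_lin1. Qed.

Lemma is_diff_linear_comp (V W : normedModType R) m (L : {linear 'rV[R]_m -> W})
    (f : V -> 'rV[R]_m) (x : V) : differentiable f x ->
  is_diff x (L \o f) (L \o 'd f x).
Proof.
move=> df; have cL := @linear_rV_continuous _ _ _ L.
have dL : differentiable L (f x) by exact: linear_differentiable.
split; first exact: differentiable_comp df dL.
by rewrite (diff_comp df dL) (diff_lin _ cL).
Qed.

Lemma diff_inj_jacobian_unit d x : (forall v, 'd d x v = 0 -> v = 0) ->
  'J d x \in unitmx.
Proof.
move=> H; rewrite -row_free_unit; apply/inj_row_free => v.
by rewrite -diff_jacobian; exact: H.
Qed.

(** The map [x - d x *m invmx ('J d 0)] has zero differential at 0, so its partial derivatives are
    small nearby, and the mean value theorem in each coordinate makes it contract by one half. *)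
Lemma local_injection d : smooth_germ d -> (forall v, 'd d 0 v = 0 -> v = 0) ->
  exists2 r : R, 0 < r & (forall x y, `|x| <= r -> `|y| <= r ->
    `|(x - d x *m invmx ('J d 0)) - (y - d y *m invmx ('J d 0))| <= `|x - y| / 2).
Proof.
move=> sd dinj; set A := invmx _.
have JA : 'J d 0 *m A = 1%:M by rewrite mulmxV// diff_inj_jacobian_unit.
pose G x := x - d x *m A.
have sG j : smooth_germ (fun x => G x 0 j : R^o).
  rewrite (_ : (fun x => _) = (fun x => x 0 j - \sum_i d x 0 i * A i j)).
    apply: smooth_germB; first exact: smooth_germ_proj.
    apply: smooth_germ_sum => i _; apply: smooth_germM.
      exact: smooth_germ_coord.
    exact: smooth_germ_cst.
  by apply/funext => x; rewrite !mxE.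
have dG j v : 'd (fun x => G x 0 j : R^o) 0 v = 0.
  have dd := smooth_germ_differentiable0 sd.
  have D := is_diffB (is_diff_id 0) (is_diff_linear_comp (mulmxr A) dd).
  have [_ E] := is_diff_coord j (@ex_diff _ _ _ _ _ _ _ D).
  have -> : (fun x => G x 0 j) = (fun x => (id - (mulmxr A \o d)) x 0 j).
    by apply/funext => x; rewrite /G !fctE.
  rewrite E (@diff_val _ _ _ _ _ _ _ D) !fctE /=.
  by rewrite diff_jacobian -mulmxA JA mulmx1 subrr mxE.
(* A sum of [n] partial derivatives of this size stays below one half; [n.+1] keeps the denominator
   positive for [n = 0]. *)
have e0 : 0 < (2 * n.+1%:R)^-1 :> R by rewrite invr_gt0 mulr_gt0.
have [r r0 Hr] : exists2 r : R, 0 < r & forall x, `|x| <= r -> forall j,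
    differentiable (fun x => G x 0 j : R^o) x /\
    forall i, `|'d (fun x => G x 0 j : R^o) x (delta_mx 0 i)| <= (2 * n.+1%:R)^-1.
  have : \forall x \near (0 : 'rV[R]_n), forall j,
    differentiable (fun x => G x 0 j : R^o) x /\
    forall i, `|'d (fun x => G x 0 j : R^o) x (delta_mx 0 i)| <= (2 * n.+1%:R)^-1.
    apply: near_forall => j.
    have Hb : \forall x \near (0 : 'rV[R]_n), forall i : 'I_n, `|'d (fun x => G x 0 j : R^o) x (delta_mx 0 i)| <= (2 * n.+1%:R)^-1.
      apply: near_forall => i.
      exact: (smooth_germ_small (smooth_germ_diff (delta_mx 0 i) (sG j)) (dG j _) e0).
    by apply: filterS2 (smooth_germ_differentiable (sG j)) Hb => x; split.
  move/nbhs_norm0P => [r /= r0 Hr]; exists (r / 2); first by rewrite divr_gt0.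
  move=> x xr; apply: Hr => /=; rewrite (le_lt_trans xr)// ltr_pdivrMr//.
  by rewrite ltr_pMr// ltr1n.
exists r => // x y xr yr; apply: norm_rV_le; first by rewrite mulr_ge0.
move=> j; rewrite -/(G x) -/(G y).
have [|t t01] := @mvt_segment R _ (fun x => G x 0 j : R^o) y (x - y).
  by move=> t t01; apply: (Hr _ _ j).1; exact: norm_segment.
rewrite subrKC.
have [_ /=] := Hr (y + t *: (x - y)) (norm_segment t01 yr xr) j.
move=> Hd E; rewrite mxE [(- _ : 'rV_n) _ _]mxE E linear_rowlin.
apply: (le_trans (rowlin_bound _ _)).
rewrite mulrC ler_wpM2l//.
apply: (@le_trans _ _ (\sum_(i < n) (2 * n.+1%:R)^-1)).
  by apply: ler_sum => i _; exact: Hd.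
rewrite sumr_const card_ord -[leLHS]mulr_natr invfM -mulrA.
by rewrite ler_piMr ?invr_ge0// mulrC ler_pdivrMr// mul1r ler_nat.
Qed.

Lemma mulmx_bound m (A : 'M[R]_(n, m)) :
  exists2 C : R, 0 < C & forall v : 'rV[R]_n, `|v *m A| <= C * `|v|.
Proof.
exists (\sum_j `|(delta_mx 0 j : 'rV[R]_n) *m A| + 1); first by rewrite ltr_wpDl ?sumr_ge0.
move=> v; rewrite -[v *m A]/(mulmxr A v) linear_rowlin.
rewrite (le_trans (rowlin_bound _ _))// ler_wpM2r// lerDl//.
Qed.

(** On a vector [h] of the kernel, [d (h + x) - d x] is [o(h)], against the lower bound; any kernel
    vector can be scaled to be small. This gives invertible Jacobians on a whole ball. *)
Lemma diff_inj_of_expanding d x C : 0 < C -> differentiable d x ->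
  (\forall h \near (0 : 'rV[R]_n), `|h| <= C * `|d (h + x) - d x|) ->
  forall v, 'd d x v = 0 -> v = 0.
Proof.
move=> C0 dd H v dv.
have e0 : 0 < (2 * C)^-1 by rewrite invr_gt0 mulr_gt0.
have : \forall h \near (0 : 'rV[R]_n), 'd d x h = 0 -> h = 0.
  apply: filterS2 H (diff_eps dd e0) => h H1 + dh; rewrite dh subr0 => H2.
  apply/eqP; rewrite -normr_le0 leNgt; apply/negP => h0.
  have : `|h| <= C * ((2 * C)^-1 * `|h|).
    by rewrite (le_trans H1)// ler_wpM2l// ltW.
  have -> : C * ((2 * C)^-1 * `|h|) = `|h| / 2 by field; rewrite gt_eqF.
  lra.
move=> /nbhs_norm0P[r /= r0 Hr]; apply/eqP/negPn/negP => v0.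
have nv : 0 < `|v| by rewrite normr_gt0.
have t0 : r / 2 / `|v| != 0 by rewrite gt_eqF// !divr_gt0.
have : (r / 2 / `|v|) *: v = 0.
  apply: Hr; last by rewrite linearZ/= dv scaler0.
  rewrite /= normrZ ger0_norm ?divr_ge0 ?ltW// divfK ?gt_eqF//; lra.
by move/eqP; rewrite scaler_eq0 (negbTE t0) (negbTE v0).
Qed.

Lemma closed_ball_fixpoint (r : R) (f : 'rV[R]_n -> 'rV[R]_n) : 0 <= r ->
  (forall x, `|x| <= r -> `|f x| <= r) ->
  (forall x y, `|x| <= r -> `|y| <= r -> `|f x - f y| <= `|x - y| / 2) ->
  exists2 x, `|x| <= r & x = f x.
Proof.
move=> r0 fr fc.
pose U : set 'rV[R]_n := [set x | `|x| <= r].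
have fU : set_fun U U f by move=> x; exact: fr.
pose g : {fun U >-> U} := HB.pack f (isFun.Build _ _ U U f fU).
have cg : is_contraction g.
  have h0 : 0 <= 2^-1 :> R by [].
  exists (NngNum h0); split => /=; first lra.
  by move=> [x y] /= [Ux Uy]; rewrite mulrC; exact: fc.
pose X : completeNormedModType R := HB.pack_for (completeNormedModType R) 'rV[R]_n.
have [||x Ux xE] := @banach_fixed_point R X U g cg.
- have := @closed_closed_ball_ _ 'rV[R]_n 0 r; rewrite /closed_ball_.
  by under eq_set do rewrite sub0r normrN.
- by exists 0; rewrite /U /= normr0.
- by exists x.
Qed.

(** Existence of the inverse comes from the contraction principle, its differentiability from a
    Lipschitz bound, and its smoothness from the formula for its differential. *)
Theorem inverse_function_germ d : map_germ d ->
  (forall v, 'd d 0 v = 0 -> v = 0) -> diffeo_germ d.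
Proof.
move=> /[dup] md [sd d0] dinj.
have [r1 r10 contr] := local_injection sd dinj.
have [U [oU U0 Cd]] := sd.
have [r2 /= r20 rU] : exists2 r : R, 0 < r & forall x, `|x| < r -> U x.
  by have /nbhs_norm0P[r ? H] := open_nearP oU U0; exists r.
pose r := Num.min r1 (r2 / 2).
have r0 : 0 < r by rewrite lt_min r10 divr_gt0.
have rr1 x : `|x| <= r -> `|x| <= r1.
  by move/le_trans; apply; rewrite ge_min lexx.
have {}rU x : `|x| <= r -> U x.
  move=> xr; apply: rU; rewrite (le_lt_trans xr)// gt_min; apply/orP; right.
  by rewrite ltr_pdivrMr// ltr_pMr// ltr1n.
set A := invmx ('J d 0) in contr.
have [C C0 AC] := mulmx_bound A.
have lipA x y : `|x| <= r -> `|y| <= r -> `|x - y| <= 2 * `|(d x - d y) *m A|.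
  move=> xr yr; have := contr _ _ (rr1 _ xr) (rr1 _ yr).
  have -> : x - d x *m A - (y - d y *m A) = (x - y) - (d x - d y) *m A.
    by rewrite mulmxBl !opprD !opprK addrACA.
  have := ler_normD (x - y - (d x - d y) *m A) ((d x - d y) *m A).
  rewrite subrK; lra.
have lip x y : `|x| <= r -> `|y| <= r -> `|x - y| <= 2 * C * `|d x - d y|.
  move=> xr yr; rewrite (le_trans (lipA _ _ xr yr))// -mulrA ler_wpM2l//.
have JA : 'J d 0 *m A = 1%:M by rewrite mulmxV// diff_inj_jacobian_unit.
(* Solutions of [d x = y] are the fixed points of [x |-> y *m A + (x - d x *m A)]; where [y *m A] is
   too large, 0 is a default value. *)
have /choice[e eE] y : exists x, `|y *m A| <= r / 2 -> `|x| <= r /\ d x = y.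
  have [yr|yr] := lerP `|y *m A| (r / 2); last by exists 0.
  have [|x xr|x x'|x xr xE] :=
    @closed_ball_fixpoint r (fun x => y *m A + (x - d x *m A)); first exact: ltW.
  - have := contr x 0 (rr1 _ xr); rewrite normr0 ltW// => /(_ isT).
    rewrite d0 mul0mx !subr0 => H.
    rewrite (le_trans (ler_normD _ _))//; lra.
  - move=> xr x'r; rewrite opprD addrACA subrr add0r.
    by apply: contr; exact: rr1.
  - exists x => _; split => //.
    have : (d x - y) *m A = 0.
      move/eqP: xE; rewrite addrCA -subr_eq0 opprD addrA subrr add0r oppr_eq0.
      by rewrite mulmxBl subr_eq0 => /eqP ->; rewrite subrr.
    move/(congr1 (mulmx^~ ('J d 0))); rewrite -mulmxA mulVmx; last first.
      exact: diff_inj_jacobian_unit.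
    by rewrite mulmx1 mul0mx => /eqP; rewrite subr_eq0 => /eqP.
pose rho := r / (2 * C).
have rho0 : 0 < rho by rewrite divr_gt0// mulr_gt0.
pose W : set 'rV[R]_n := [set y | `|y| < rho].
have WA y : W y -> `|y *m A| < r / 2.
  move=> Wy; rewrite (le_lt_trans (AC y))//.
  have -> : r / 2 = C * rho by rewrite /rho; field; rewrite gt_eqF.
  by rewrite ltr_pM2l.
have oW : open W.
  rewrite (_ : W = ball 0 rho); first exact: ball_open.
  by rewrite -ball_normE; apply/seteqP; split=> y /=; rewrite sub0r normrN.
have W0 : W 0 by rewrite /W /= normr0.
have eW y : W y -> `|e y| < r /\ d (e y) = y.
  move=> /WA Wy; have [er dey] := eE y (ltW Wy); split => //.
  have := lipA (e y) 0 er; rewrite normr0 ltW// => /(_ isT).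
  rewrite subr0 d0 subr0 dey; lra.
have eK x : `|x| <= r -> W (d x) -> e (d x) = x.
  move=> xr /eW[er de]; apply/eqP; rewrite -subr_eq0 -normr_le0.
  by rewrite (le_trans (lip _ _ (ltW er) xr))// de subrr normr0 mulr0.
have e0 : e 0 = 0 by rewrite -[X in e X]d0 eK ?d0// normr0 ltW.
have dd x : U x -> differentiable d x by have [+ _] := Cd 1%N; apply.
have near_r x : `|x| < r -> \forall h \near (0 : 'rV[R]_n), `|h + x| < r.
  move=> xr; have H : \forall h \near (0 : 'rV[R]_n), `|h| < r - `|x|.
    by apply: nbhs0_lt; rewrite subr_gt0.
  by apply: filterS H => h hr; rewrite (le_lt_trans (ler_normD _ _))//; lra.
have Ju x : `|x| < r -> 'J d x \in unitmx.
  move=> xr; apply: diff_inj_jacobian_unit.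
  apply: (@diff_inj_of_expanding d x (2 * C)); first by rewrite mulr_gt0.
    by apply: dd; apply: rU; exact: ltW.
  apply: filterS (near_r _ xr) => h hr.
  by rewrite (le_trans _ (lip _ _ (ltW hr) (ltW xr)))// addrK.
have de y : W y -> is_diff y e (mulmxr (invmx ('J d (e y)))).
  move=> Wy; have [er dey] := eW _ Wy; set B := invmx _.
  apply: is_diff_eps; first exact: (@linear_rV_continuous _ _ _ (mulmxr B)).
  move=> eps eps0; have [D D0 BD] := mulmx_bound B.
  (* [D] bounds the inverse Jacobian and [2 * C] is the Lipschitz constant of [e]: an error [o(h)]
     for [d] becomes an error [o(k)] for [e]. *)
  have e'0 : 0 < eps / (2 * C * D) by rewrite divr_gt0// !mulr_gt0.
  have /nbhs_norm0P[s /= s0 Hs] := diff_eps (dd _ (rU _ (ltW er))) e'0.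
  have Wk : \forall k \near (0 : 'rV[R]_n), W (k + y).
    have := open_nearP oW Wy; rewrite (near_shift 0) /=.
    by apply: filterS => k; rewrite /= subr0.
  have sk : \forall k \near (0 : 'rV[R]_n), `|k| < s / (2 * C).
    by apply: nbhs0_lt; rewrite divr_gt0// mulr_gt0.
  apply: filterS2 Wk sk => k /eW[ekr dek] ks.
  set h := e (k + y) - e y.
  have hk : `|h| <= 2 * C * `|k|.
    by have := lip _ _ (ltW ekr) (ltW er); rewrite dek dey addrK.
  have hs : `|h| < s.
    rewrite (le_lt_trans hk)// mulrC -ltr_pdivlMr// mulr_gt0//.
  have := Hs h hs; rewrite subrK dek dey addrK diff_jacobian => H.
  rewrite /= -[h](mulmxK (Ju _ er)) -mulmxBl -normrN -mulNmx opprB.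
  rewrite (le_trans (BD _))// (le_trans (ler_wpM2l (ltW D0) H))//.
  rewrite (@le_trans _ _ (D * (eps / (2 * C * D) * (2 * C * `|k|))))//.
    by rewrite ler_pM2l// ler_pM2l.
  rewrite le_eqVlt; apply/orP; left; apply/eqP.
  by field; rewrite !gt_eqF.
(* Bootstrap: the differential of [e] is the inverse Jacobian of [d] taken at [e y], hence as
   regular as [e] itself. *)
have Ce k : Ck_on k W e.
  elim: k => [|k IH].
    by move=> y Wy; apply: differentiable_continuous; have [] := de _ Wy.
  split=> [y Wy|v]; first by have [] := de _ Wy.
  have E y : W y -> v *m invmx ('J d (e y)) = 'd e y v.
    by move=> Wy; have [_ ->] := de _ Wy.
  apply: (Ck_on_eq oW E).
  pose X : set 'rV[R]_n := [set x | `|x| < r].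
  have oX : open X.
    rewrite (_ : X = ball 0 r); first exact: ball_open.
    by rewrite -ball_normE; apply/seteqP; split=> y /=; rewrite sub0r normrN.
  apply: (@Ck_on_compV R 'rV[R]_n n k W X n e (fun x => v *m invmx ('J d x))) => //.
    by move=> y /eW[].
  apply: Ck_on_row => // j; under eq_fun do rewrite mxE.
  apply: Ck_on_sum => // i _; apply: Ck_onM => //; first exact: Ck_on_cst.
  apply: Ck_on_invmx => // a b; under eq_fun do rewrite mxE.
  apply: Ck_on_coord => //; have [_ /(_ (delta_mx 0 a))] := Cd k.+1.
  by apply: Ck_onS => x /ltW; exact: rU.
split => //; exists e; split.
- by split => //; exists W.
- have : \forall x \near (0 : 'rV[R]_n), W (d x) by exact: near_comp (open_nearP oW W0).
  by apply: filterS2 (nbhs0_le r0) => x xr; exact: eK.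
- by apply: filterS (open_nearP oW W0) => y /eW[].
Qed.

End InverseFunction.

(** * Powers and cutoff functions *)

Section ScalarComposition.
Context {R : realType} {V : normedModType R}.

Lemma is_diff_scalar (g : R^o -> R^o) (y D : R^o) :
  is_derive y 1 g D -> is_diff y g (fun s => s * D : R^o).
Proof.
move=> dg; have dgy : derivable g y 1 by exact: ex_derive.
have /derivable1_diffP dy := dgy.
split => //; apply/funext => s.
have -> : s = s *: (1 : R^o) by rewrite /GRing.scale /= mulr1.
rewrite linearZ /= -deriveE// (@derive_val _ _ _ _ _ _ _ dg).
by rewrite /GRing.scale /= mulr1.
Qed.

Lemma is_diff_scalar_comp (g : R^o -> R^o) (f : V -> R^o) (x : V) (D : R^o) :
  is_diff (f x) g (fun s => s * D : R^o) -> differentiable f x ->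
  is_diff x (g \o f) (fun v => 'd f x v * D : R^o).
Proof.
move=> [dg Dg] df; split; first exact: differentiable_comp df dg.
by rewrite (diff_comp df dg) Dg.
Qed.

Lemma Ck_on_powR k (U : set V) (f : V -> R^o) (a : R) : open U ->
  (forall x, U x -> 0 < f x) -> Ck_on k U f ->
  Ck_on k U (fun x => f x `^ a : R^o).
Proof.
move=> oU f0; elim: k a => [|k IH] a.
  move=> Cf x Ux; apply: (@continuous_comp _ _ _ f (fun y => y `^ a : R^o)).
    exact: Cf.
  apply: differentiable_continuous; apply/derivable1_diffP.
  by apply: derivable_powR; rewrite in_itv/= andbT f0.
move=> /[dup] Cf [df H].
have D x : U x -> is_diff x (fun x => f x `^ a : R^o) (fun v => 'd f x v * (a * f x `^ (a - 1)) : R^o).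
  move=> Ux; apply: (@is_diff_scalar_comp (fun y => y `^ a)); last exact: df.
  have fx : f x \in `]0, +oo[ by rewrite in_itv/= andbT f0.
  apply: is_diff_scalar; apply: DeriveDef; first exact: derivable_powR.
  by rewrite -derive1E powR_derive1.
split=> [x /D[]//|v].
have E x : U x -> 'd f x v * (a * f x `^ (a - 1)) = 'd (fun x => f x `^ a : R^o) x v.
  by move=> /D[_ ->].
apply: (Ck_on_eq oU E); apply: Ck_onM => //; first exact: H.
apply: Ck_onM => //; first exact: Ck_on_cst.
by apply: IH; exact: Ck_on_pred.
Qed.

Lemma smooth_germ_powR (f : V -> R^o) (a : R) : smooth_germ f -> 0 < f 0 ->
  smooth_germ (fun x => f x `^ a : R^o).
Proof.
move=> /[dup] sf [U [oU U0 Cf]] f0.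
have n0 : \forall x \near (0 : V), 0 < f x.
  exact: (@cvgr_gt _ _ (nbhs 0) _ f (f 0) (smooth_germ_continuous0 sf) _ f0).
exists (U `&` interior [set x | 0 < f x]); split.
- exact: openI oU (open_interior _).
- by split.
- move=> k; apply: Ck_on_powR.
  + exact: openI oU (open_interior _).
  + by move=> x [_ /interior_subset].
  + by apply: (Ck_onS _ (Cf k)) => x [].
Qed.

End ScalarComposition.

Section FlatFunction.
Context {R : realType}.

(* The power of [x^-1] makes the family closed under differentiation. *)
Definition flat_exp (n : nat) (x : R^o) : R^o :=
  if 0 < x then x^-1 ^+ n * expR (- x^-1) else 0.

Lemma flat_exp_ge0 n x : 0 <= flat_exp n x.
Proof.
rewrite /flat_exp; case: ifP => // x0.
by rewrite mulr_ge0 ?expR_ge0// exprn_ge0// invr_ge0 ltW.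
Qed.

(** The term of degree [n + 1] of the exponential series at [x^-1] already dominates [x^-1 ^+ n] by
    a factor proportional to [x^-1]. *)
Lemma flat_exp_le n x : flat_exp n x <= n.+1`!%:R * `|x|.
Proof.
rewrite /flat_exp; case: ifP => x0; last by rewrite mulr_ge0.
rewrite gtr0_norm// expRN.
have s0 : 0 < x^-1 by rewrite invr_gt0.
have := expR_ge1Dxn n (ltW s0).
have F0 : 0 < n.+1`!%:R :> R by rewrite ltr0n fact_gt0.
move=> H; rewrite ler_pdivrMr ?expR_gt0//.
have : x^-1 ^+ n.+1 / n.+1`!%:R <= expR x^-1 by lra.
rewrite ler_pdivrMr// exprS => /(ler_wpM2l (ltW x0)).
rewrite mulVKf ?gt_eqF//.
by have -> : n.+1`!%:R * x * expR x^-1 = x * (expR x^-1 * n.+1`!%:R) by ring.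
Qed.

Lemma flat_expS n x : flat_exp n x = flat_exp n.+1 x * x.
Proof.
rewrite /flat_exp; case: ifP => x0; last by rewrite mul0r.
by rewrite exprS [RHS]mulrC -!mulrA mulVKf// gt_eqF.
Qed.

Lemma flat_exp_diff n y :
  is_diff y (flat_exp n)
    (fun s => s * (flat_exp n.+2 y - n%:R * flat_exp n.+1 y) : R^o).
Proof.
have [y0|y0|->] := ltgtP y 0.
- have E : \forall x \near y, (fun=> 0) x = flat_exp n x.
    near=> x; rewrite /flat_exp ifF//; apply/negP/negP; rewrite -leNgt ltW//.
    by near: x; exact: lt_nbhsl.
  have [d1 d2] := is_diff_near E (differentiable_cst (0 : R^o) y).
  split => //; rewrite [LHS]d2 diff_cst; apply/funext => s.
  by rewrite /flat_exp !ifF ?mulr0 ?subr0 ?mulr0//; apply/negP/negP; rewrite -leNgt ltW.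
- have E : \forall x \near y, (fun x : R^o => x^-1 ^+ n * expR (- x^-1) : R^o) x = flat_exp n x.
    near=> x; rewrite /flat_exp ifT//.
    by near: x; exact: lt_nbhsr.
  have y1 : y != 0 by rewrite gt_eqF.
  have D : is_derive y 1 (fun x : R^o => x^-1 ^+ n * expR (- x^-1) : R^o)
      (flat_exp n.+2 y - n%:R * flat_exp n.+1 y).
    have D1 : is_derive y 1 (fun x : R^o => x^-1 : R^o) (- y ^- 2).
      apply: DeriveDef; first exact: (@derivableV _ _ id).
      by rewrite (@deriveV _ _ id)// derive_id /GRing.scale /= mulr1.
    have D2 := is_deriveX n D1.
    have De : is_derive (- y^-1) 1 (@expR R) (expR (- y^-1)).
      by apply: DeriveDef; [exact: derivable_expR|exact: (congr1 (@^~ _) (derive_expR R))].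
    have D3 : is_derive y 1 (fun x : R^o => expR (- x^-1) : R^o) (expR (- y^-1) * y ^- 2).
      have D1' : is_derive (y : R) 1 (fun x : R => - x^-1) (y ^- 2).
        by have := is_deriveN D1; rewrite opprK.
      exact: (@is_derive1_comp _ (@expR R) (fun x : R => - x^-1) y _ _ De D1').
    have [dA dB] := is_deriveM D2 D3; rewrite exprfctE in dA dB.
    apply: DeriveDef; [exact: dA|rewrite [LHS]dB].
    rewrite /flat_exp y0 /GRing.scale /=.
    case: (n) => [|m] /=; first by rewrite !mul0r mulr0 addr0 subr0 expr0 mul1r expr2 invfM mulrC.
    by rewrite !exprS expr0 !invfM invr1; ring.
  have [d0 d1] := is_diff_scalar D.
  have [d2 d3] := is_diff_near E d0.
  by split => //; rewrite [LHS]d3.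
(* At 0 the differential is zero: [flat_exp n] is [flat_exp n.+1] times the variable, and the former
   factor is itself linearly small. *)
- have -> : (fun s => s * (flat_exp n.+2 0 - n%:R * flat_exp n.+1 0) : R^o) = (fun=> 0) :> (R^o -> R^o).
    by apply/funext => s; rewrite /flat_exp ltxx mulr0 subr0 mulr0.
  apply: (@is_diff_eps _ _ _ (flat_exp n) (0 : R^o) \0).
    exact: cst_continuous.
  move=> e e0; have F0 : 0 < n.+2`!%:R :> R by rewrite ltr0n fact_gt0.
  have : \forall h \near (0 : R^o), `|h| <= e / n.+2`!%:R.
    by apply: nbhs0_le; rewrite divr_gt0.
  apply: filterS => h he; rewrite addr0 /= subr0.
  have -> : flat_exp n 0 = 0 by rewrite /flat_exp ltxx.
  rewrite subr0 flat_expS normrM ger0_norm ?flat_exp_ge0// ler_wpM2r//.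
  by rewrite (le_trans (flat_exp_le _ _))// mulrC -ler_pdivlMr.
Unshelve. all: by end_near. Qed.

Lemma Ck_on_flat_exp (V : normedModType R) k (U : set V) (f : V -> R^o) n : open U ->
  Ck_on k U f -> Ck_on k U (flat_exp n \o f).
Proof.
move=> oU; elim: k n => [|k IH] n.
  move=> Cf x Ux; apply: continuous_comp; first exact: Cf.
  by apply: differentiable_continuous; have [] := flat_exp_diff n (f x).
move=> /[dup] Cf [df H].
have D x : U x -> is_diff x (flat_exp n \o f) (fun v => 'd f x v * (flat_exp n.+2 (f x) - n%:R * flat_exp n.+1 (f x)) : R^o).
  by move=> Ux; apply: is_diff_scalar_comp; [exact: flat_exp_diff|exact: df].
split=> [x /D[]//|v].
have E x : U x -> 'd f x v * (flat_exp n.+2 (f x) + (- n%:R) * flat_exp n.+1 (f x)) = 'd (flat_exp n \o f) x v.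
  by move=> /D[_ ->]; rewrite mulNr.
have {}IH m : Ck_on k U (flat_exp m \o f) by apply: IH; exact: Ck_on_pred.
apply: (Ck_on_eq oU E); apply: Ck_onM => //; first exact: H.
apply: Ck_onD => //; first exact: IH.
by apply: Ck_onM => //; [exact: Ck_on_cst|exact: IH].
Qed.

End FlatFunction.

Section CompactSupport.
Context {R : realType} {n : nat}.
Implicit Types (phi : 'rV[R]_n -> R^o) (p v : 'rV[R]_n).

(** Compact support bounds every derivative on the whole space, as averages over unbounded
    rescalings require. *)
Definition csmooth phi := (forall k, Ck_on k setT phi) /\
  exists r : R, forall p, r <= `|p| -> phi p = 0.

Lemma csmooth_differentiable phi p : csmooth phi -> differentiable phi p.
Proof. by move=> [/(_ 1%N)[+ _] _]; apply. Qed.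

Lemma csmooth_continuous phi : csmooth phi -> continuous phi.
Proof. by move=> [/(_ 0%N) H _] p; exact: H. Qed.

Lemma csmooth_diff phi v : csmooth phi -> csmooth (fun p => 'd phi p v : R^o).
Proof.
move=> [Cp [r Hr]]; split; first by move=> k; have [_] := Cp k.+1; exact.
exists (r + 1) => p rp.
have E : \forall q \near p, (fun=> 0) q = phi q.
  have : \forall q \near p, r < `|q|.
    apply: (@cvgr_gt _ _ (nbhs p) _ (fun q => `|q|) `|p|); last lra.
    exact: norm_continuous.
  by apply: filterS => q rq; rewrite Hr// ltW.
by rewrite (diff_near E (differentiable_cst (0 : R^o) p)) diff_cst.
Qed.

Lemma csmooth_bounded phi : csmooth phi -> exists M, forall p, `|phi p| <= M.
Proof.
move=> /[dup] /csmooth_continuous cphi [_ [r Hr]].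
pose A : set 'rV[R]_n := [set p | `|p| <= `|r|].
have cA : compact A.
  apply: bounded_closed_compact.
    by exists `|r|; split => //; move=> x xr p /= pr; rewrite (le_trans pr)// ltW.
  have := @closed_closed_ball_ _ 'rV[R]_n 0 `|r|; rewrite /closed_ball_.
  by under eq_set do rewrite sub0r normrN.
have [||c cA0 Hc] := @EVT_max_rV R n (fun p => `|phi p|) A _ cA.
- by exists 0; rewrite /A /= normr0.
- apply: continuous_subspaceT => p; apply: continuous_comp; first exact: cphi.
  exact: norm_continuous.
exists `|phi c| => p; have [pr|pr] := lerP `|p| `|r|.
  by apply: Hc; rewrite inE.
by rewrite Hr ?normr0// (le_trans (ler_norm r))// ltW.
Qed.

Lemma Ck_on_local (V W : normedModType R) k (U : set V) (f : V -> W) :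
  (forall x, U x -> exists U', [/\ open U', U' x & Ck_on k U' f]) -> Ck_on k U f.
Proof.
elim: k f => [|k IH] f H.
  by move=> x /H[U' [_ U'x]]; exact.
split=> [x /H[U' [_ U'x [+ _]]]|v]; first exact.
apply: IH => x /H[U' [oU U'x [_ Hd]]]; exists U'; split=> //.
exact: Hd.
Qed.

(** The argument of [flat_exp] is polynomial, hence smooth where the sup norm is not, and even in
    every coordinate, so that cutting off preserves evenness. *)
Definition bump (r : R) (p : 'rV[R]_n) : R^o :=
  flat_exp 0 (r ^+ 2 - \sum_j p 0 j ^+ 2).

Lemma Ck_on_bump k U r : open U -> Ck_on k U (bump r).
Proof.
move=> oU; apply: (@Ck_on_flat_exp _ _ k U (fun p => r ^+ 2 - \sum_j p 0 j ^+ 2)) => //.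
apply: Ck_onD => //; first exact: Ck_on_cst.
apply: Ck_onN => //; apply: Ck_on_sum => // j _.
under eq_fun do rewrite expr2.
by apply: Ck_onM => //; apply: (Ck_on_linear k U (coordl j)).
Qed.

Lemma norm_sqr_le p : `|p| ^+ 2 <= \sum_j p 0 j ^+ 2.
Proof.
have s0 : 0 <= \sum_j p 0 j ^+ 2 by rewrite sumr_ge0// => j _; exact: sqr_ge0.
rewrite -[leRHS]sqr_sqrtr// ler_sqr ?nnegrE ?sqrtr_ge0//.
apply: norm_rV_le; first exact: sqrtr_ge0.
move=> j; rewrite -sqrtr_sqr ler_sqrt// (bigD1 j)//= lerDl sumr_ge0// => i _.
exact: sqr_ge0.
Qed.

Lemma bump_outside r p : 0 < r -> r <= `|p| -> bump r p = 0.
Proof.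
move=> r0 rp; rewrite /bump /flat_exp ifF//; apply/negP/negP.
rewrite -leNgt subr_le0 (le_trans _ (norm_sqr_le p))//.
by rewrite ler_sqr ?nnegrE ?normr_ge0// ltW.
Qed.

Lemma bump0_gt0 r : 0 < r -> 0 < bump r 0.
Proof.
move=> r0; rewrite /bump big1; last by move=> j _; rewrite mxE expr0n.
by rewrite subr0 /flat_exp exprn_gt0// expr0 mul1r expR_gt0.
Qed.

Lemma smooth_germ_bump r : smooth_germ (bump r).
Proof. by exists setT; split => //; [exact: openT|move=> k; exact/Ck_on_bump/openT]. Qed.

(** The factor [bump r] is positive near 0 but not equal to 1 there, so it has to be divided out
    after use. *)
Lemma csmooth_cutoff phi : smooth_germ phi ->
  \forall r \near 0^'+, csmooth (fun p => phi p * bump r p : R^o).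
Proof.
move=> [U [oU U0 Cp]]; have /nbhs_norm0P[s /= s0 Hs] := open_nearP oU U0.
near=> r; have r0 : 0 < r by [].
have rs : r < s by near: r; exact: nbhs_right_lt.
split; last first.
  by exists r => p rp; rewrite bump_outside ?mulr0.
move=> k; apply: Ck_on_local => p _.
have [pr|pr] := ltP `|p| s.
  exists U; split => //; first exact: Hs.
  by apply: Ck_onM => //; exact: Ck_on_bump.
have oX : open [set q : 'rV[R]_n | r < `|q|].
  apply: (@open_comp _ _ (fun q : 'rV[R]_n => `|q|) [set x | r < x]).
    by move=> q _; exact: norm_continuous.
  exact: open_gt.
exists [set q | r < `|q|]; split => //=; first exact: lt_le_trans pr.
apply: (@Ck_on_eq _ _ _ _ _ (fun=> 0)) => //; last exact: Ck_on_cst.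
by move=> q rq; rewrite bump_outside ?mulr0// ltW.
Unshelve. all: by end_near. Qed.

End CompactSupport.

(** * Averages over rescalings of one coordinate; Hadamard's lemma *)

Section CoordinateUpdate.
Context {R : realType} {n : nat}.
Implicit Types (i j : 'I_n) (p h : 'rV[R]_n).

Definition upd i (c : R) p : 'rV[R]_n := \row_j (if j == i then c else p 0 j).

Lemma updE i c p j : upd i c p 0 j = if j == i then c else p 0 j.
Proof. by rewrite mxE. Qed.

Lemma upd_id i p : upd i (p 0 i) p = p.
Proof. by apply/rowP => j; rewrite updE; case: eqP => [->|]. Qed.

Lemma updK i c c' p : upd i c (upd i c' p) = upd i c p.
Proof. by apply/rowP => j; rewrite !updE; case: eqP. Qed.

Lemma upd0 i : upd i 0 0 = 0.
Proof. by apply/rowP => j; rewrite updE mxE if_same. Qed.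

Lemma updD i c c' p p' : upd i (c + c') (p + p') = upd i c p + upd i c' p'.
Proof. by apply/rowP => j; rewrite !mxE; case: eqP. Qed.

Lemma updZ i a c p : upd i (a * c) (a *: p) = a *: upd i c p.
Proof. by apply/rowP => j; rewrite !mxE; case: eqP. Qed.

Lemma upd_delta i c : upd i c 0 = c *: delta_mx 0 i.
Proof. by apply/rowP => j; rewrite !mxE; case: eqP; rewrite ?mulr1 ?mulr0. Qed.

Lemma norm_upd i c p : `|upd i c p| <= Num.max `|c| `|p|.
Proof.
apply: norm_rV_le; first by rewrite le_max normr_ge0.
move=> j; rewrite updE le_max; case: eqP => _; first by rewrite lexx.
by rewrite coord_le_norm orbT.
Qed.

Definition scale_coord i (b : R) p : 'rV[R]_n := upd i (b * p 0 i) p.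

Lemma scale_coord_is_linear i b : linear (scale_coord i b).
Proof.
move=> a u v; rewrite /scale_coord -updZ -updD !mxE.
by congr upd; ring.
Qed.

HB.instance Definition _ i b :=
  GRing.isLinear.Build R 'rV[R]_n 'rV[R]_n *:%R (scale_coord i b)
    (scale_coord_is_linear i b).

Lemma norm_scale_coord_sqr i b p : `|scale_coord i b p| ^+ 2 <= (1 + b ^+ 2) * `|p| ^+ 2.
Proof.
have : `|scale_coord i b p| <= Num.max `|b * p 0 i| `|p| by exact: norm_upd.
have b2 : 0 <= b ^+ 2 by exact: sqr_ge0.
have p2 : 0 <= `|p| ^+ 2 by exact: sqr_ge0.
have bp2 : 0 <= b ^+ 2 * `|p| ^+ 2 by exact: mulr_ge0.
rewrite le_max => /orP[|] H.
  have {}H : `|scale_coord i b p| ^+ 2 <= (`|b| * `|p|) ^+ 2.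
    rewrite ler_sqr ?nnegrE ?mulr_ge0//; apply: le_trans H _.
    by rewrite normrM ler_wpM2l// coord_le_norm.
  move: H; rewrite exprMn real_normK ?num_real//; lra.
have : `|scale_coord i b p| ^+ 2 <= `|p| ^+ 2 by rewrite ler_sqr ?nnegrE.
lra.
Qed.

Lemma diff_scale_coord (phi : 'rV[R]_n -> R^o) i b p h :
  'd phi p (scale_coord i b h) =
  \sum_j h 0 j * ((if j == i then b else 1) * 'd phi p (delta_mx 0 j)).
Proof.
rewrite linear_rowlin /rowlin; apply: eq_bigr => j _; rewrite updE mulrA.
by congr (_ *: _); case: eqP => [->|]; rewrite ?mulr1// mulrC.
Qed.

(** The mean value theorem is applied twice, the second derivatives being bounded. Uniformity of [M]
    in [p] is what permits integrating the estimate. *)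
Lemma csmooth_taylor2 (phi : 'rV[R]_n -> R^o) : csmooth phi ->
  exists M, forall p h, `|phi (p + h) - phi p - 'd phi p h| <= M * `|h| ^+ 2.
Proof.
move=> cphi.
have /choice[M HM] (ij : 'I_n * 'I_n) : exists M, forall p,
    `|'d (fun q => 'd phi q (delta_mx 0 ij.1) : R^o) p (delta_mx 0 ij.2)| <= M.
  by apply: csmooth_bounded; apply: csmooth_diff; exact: csmooth_diff.
exists (\sum_i \sum_j M (i, j)) => p h.
have [t t01 ->] := @mvt_segment R _ phi p h (fun t _ => csmooth_differentiable _ cphi).
have E q v : 'd phi q v = \sum_j v 0 j *: ('d phi q (delta_mx 0 j)) by exact: linear_rowlin.
have -> : 'd phi (p + t *: h) h - 'd phi p h =
    \sum_j h 0 j *: ('d phi (p + t *: h) (delta_mx 0 j) - 'd phi p (delta_mx 0 j)).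
  rewrite [X in X - _]E [X in _ - X]E -sumrB.
  by apply: eq_bigr => j _; rewrite -scalerBr.
rewrite (le_trans (ler_norm_sum _ _ _))// mulr_suml.
apply: ler_sum => i _; rewrite normrZ expr2 mulrA.
have [s s01 ->] := @mvt_segment R _ (fun q => 'd phi q (delta_mx 0 i) : R^o) p (t *: h)
  (fun t _ => csmooth_differentiable _ (csmooth_diff _ cphi)).
rewrite -mulrA mulrCA ler_pM// ?coord_le_norm//.
rewrite linear_rowlin /rowlin (le_trans (ler_norm_sum _ _ _))// mulr_suml.
apply: ler_sum => j _; rewrite normrZ mulrC ler_pM//; first exact: (HM (i, j)).
rewrite mxE normrM; case/andP: t01 => t0 t1.
by rewrite (le_trans _ (coord_le_norm h j))// ler_piMl// ger0_norm.
Qed.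

Lemma is_diff_quadratic (f : 'rV[R]_n -> R^o) p (c : 'I_n -> R^o) K :
  (forall h, `|f (p + h) - f p - rowlin c h| <= K * `|h| ^+ 2) -> is_diff p f (rowlin c).
Proof.
move=> H; apply: is_diff_eps; first exact: rowlin_continuous.
move=> e e0; have K0 : 0 < `|K| + 1 by rewrite ltr_wpDl.
have : \forall h \near (0 : 'rV[R]_n), `|h| <= e / (`|K| + 1).
  by apply: nbhs0_le; rewrite divr_gt0.
apply: filterS => h he; rewrite [h + p]addrC (le_trans (H h))// expr2 mulrA ler_wpM2r//.
move: he; rewrite ler_pdivlMr// mulrC; apply: le_trans; rewrite ler_wpM2r//.
by rewrite (le_trans (ler_norm _))// lerDl.
Qed.

End CoordinateUpdate.

Section Average.
Context {R : realType} d {T : measurableType d} (mu : {measure set T -> \bar R}).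
Context (D : set T) (mD : measurable D) {n : nat} (i : 'I_n).
Context (b : T -> R) (mb : measurable_fun D b).
Implicit Types (phi : 'rV[R]_n -> R^o) (a : T -> R) (p h : 'rV[R]_n).

(* Both Hadamard's quotients ([D = [0, 1]], [b] the identity) and Seeley's series
   (the counting measure on [nat]) are such averages. *)
Definition weight a := measurable_fun D a /\
  forall m, mu.-integrable D (EFin \o (fun w => a w * b w ^+ m)).

Definition avg a phi p : R^o :=
  \int[mu]_(w in D) (a w * phi (scale_coord i (b w) p)).

Lemma weightM a : weight a -> weight (fun w => a w * b w).
Proof.
move=> [ma Ha]; split; first exact: measurable_funM.
move=> m; under eq_fun do rewrite /= -mulrA -exprS; exact: Ha.
Qed.

Lemma weight_integrable a phi p : weight a -> csmooth phi ->
  mu.-integrable D (EFin \o (fun w => a w * phi (scale_coord i (b w) p))).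
Proof.
move=> [ma Ha] cphi; have [M HM] := csmooth_bounded cphi.
have mphi : measurable_fun D (fun w => phi (scale_coord i (b w) p) : R).
  apply: (@measurableT_comp _ _ _ _ _ _ (fun s : R => phi (scale_coord i s p) : R)) => //.
  apply: continuous_measurable_fun => s.
  apply: (@continuous_comp _ _ _ (fun s : R => scale_coord i s p) phi); last first.
    exact: csmooth_continuous.
  rewrite (_ : (fun s => _) = (fun s : R => upd i 0 p + (s * p 0 i) *: delta_mx 0 i)).
    apply: cvgD; first exact: cvg_cst.
    by apply: cvgZr_tmp; apply: cvgM; [exact: cvg_id|exact: cvg_cst].
  apply/funext => t; apply/rowP => j; rewrite !mxE /=.
  by case: eqP => _; rewrite ?mulr1 ?mulr0 ?add0r ?addr0.
apply: (@le_integrable _ _ _ mu D mD _ (EFin \o (fun w => `|M| * (a w * b w ^+ 0)))).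
- by apply/measurable_EFinP; exact: measurable_funM.
- move=> w _ /=; rewrite lee_fin expr0 mulr1 !normrM normr_id mulrC ler_wpM2r//.
  by rewrite (le_trans (HM _))// ler_norm.
- by have := integrableZl mD `|M| (Ha 0); apply: eq_integrable => // w _ /=; rewrite EFinM.
Qed.

Lemma Rintegral_sum m (f : 'I_m -> T -> R) :
  (forall j, mu.-integrable D (EFin \o f j)) ->
  mu.-integrable D (EFin \o (fun w => \sum_j f j w)) /\
  \int[mu]_(w in D) (\sum_j f j w) = \sum_j \int[mu]_(w in D) f j w.
Proof.
move=> H; elim: (index_enum 'I_m) => [|j r [I1 I2]].
  have -> : (fun w => \sum_(j <- [::]) f j w) = (fun=> 0) by apply/funext => w; rewrite big_nil.
  rewrite big_nil /Rintegral integral0; split => //; exact: integrable0.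
have -> : (fun w => \sum_(j <- j :: r) f j w) = (fun w => f j w + \sum_(j <- r) f j w).
  by apply/funext => w; rewrite big_cons.
split; first exact: (integrableD mD (H j) I1).
by rewrite RintegralD// I2 big_cons.
Qed.

(** Differentiation under the integral sign: the uniform Taylor remainder at a rescaled point is at
    most a constant times [1 + b ^+ 2] times the squared norm of [h], and this is integrable against
    the weight. The derivative in the [i]-th coordinate pulls out a factor [b w], which is absorbed
    in the weight. *)
Lemma avg_is_diff a phi p : weight a -> csmooth phi ->
  is_diff p (avg a phi) (rowlin (fun j => avg (fun w => a w * (if j == i then b w else 1))
                                     (fun q => 'd phi q (delta_mx 0 j) : R^o) p)).
Proof.
move=> wa cphi; have [M HM] := csmooth_taylor2 cphi.
have wj j : weight (fun w => a w * (if j == i then b w else 1)).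
  case: eqP => _; first exact: weightM.
  by under eq_fun do rewrite mulr1.
have M0 : 0 <= `|M| by [].
pose K := \int[mu]_(w in D) (`|M| * (`|a w| + `|a w * b w ^+ 2|)).
apply: (is_diff_quadratic (K := K)) => h.
pose g j w := h 0 j * (a w * (if j == i then b w else 1) *
  'd phi (scale_coord i (b w) p) (delta_mx 0 j)).
have ij j : mu.-integrable D (EFin \o g j).
  have := weight_integrable p (wj j) (csmooth_diff (delta_mx 0 j) cphi).
  by move/(integrableZl mD (h 0 j)); apply: eq_integrable => // w _ /=; rewrite EFinM.
have [isum sj] := Rintegral_sum ij.
have -> : rowlin (fun j => avg (fun w => a w * (if j == i then b w else 1))
    (fun q => 'd phi q (delta_mx 0 j) : R^o) p) h = \int[mu]_(w in D) (\sum_j g j w).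
  rewrite sj /rowlin; apply: eq_bigr => j _; rewrite /g RintegralZl//.
  exact: weight_integrable (wj j) (csmooth_diff _ cphi).
have I1 := weight_integrable (p + h) wa cphi.
have I2 := weight_integrable p wa cphi.
have I12 := integrableB mD I1 I2.
have I3 := integrableB mD I12 isum.
have ia m : mu.-integrable D (EFin \o (fun w => `|a w * b w ^+ m|)).
  by apply: integrable_norm; exact: wa.2.
have ia0 : mu.-integrable D (EFin \o (fun w => `|a w|)).
  by apply: eq_integrable (ia 0%N) => // w _ /=; rewrite expr0 mulr1.
have I4 : mu.-integrable D (EFin \o (fun w => `|M| * (`|a w| + `|a w * b w ^+ 2|))).
  have := integrableZl mD `|M| (integrableD mD ia0 (ia 2%N)).
  by apply: eq_integrable => // w _ /=; rewrite EFinM EFinD.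
rewrite /avg -(RintegralB mD I1 I2) -(RintegralB mD I12 isum).
rewrite (le_trans (le_normr_Rintegral mD I3))// /K -RintegralZr//.
apply: le_Rintegral => //.
- exact: integrable_norm I3.
- have := integrableZr mD (`|h| ^+ 2) I4.
  by apply: eq_integrable => // w _ /=; rewrite EFinM.
move=> w _ /=.
have -> : a w * phi (scale_coord i (b w) (p + h)) - a w * phi (scale_coord i (b w) p) -
     \sum_j g j w = a w * (phi (scale_coord i (b w) p + scale_coord i (b w) h) -
     phi (scale_coord i (b w) p) - 'd phi (scale_coord i (b w) p) (scale_coord i (b w) h)).
  rewrite diff_scale_coord linearD /= mulrBr mulrBr mulr_sumr; congr (_ - _).
  by apply: eq_bigr => j _; rewrite /g -mulrA mulrCA.
rewrite normrM (le_trans (ler_wpM2l (normr_ge0 _) (HM _ _)))//.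
have := norm_scale_coord_sqr i (b w) h => H.
have H2 : M * `|scale_coord i (b w) h| ^+ 2 <= `|M| * ((1 + b w ^+ 2) * `|h| ^+ 2).
  by rewrite (@le_trans _ _ (`|M| * `|scale_coord i (b w) h| ^+ 2))//
    ?ler_wpM2r ?ler_norm ?sqr_ge0// ler_wpM2l.
rewrite (le_trans (ler_wpM2l (normr_ge0 _) H2))// normrM normrX real_normK ?num_real//.
by rewrite le_eqVlt; apply/orP; left; apply/eqP; ring.
Qed.

(** Partial derivatives of averages are averages of partial derivatives with other weights; hence
    the induction over all [a] and [phi]. *)
Lemma Ck_avg k a phi : weight a -> csmooth phi -> Ck_on k setT (avg a phi).
Proof.
elim: k a phi => [|k IH] a phi wa cphi.
  move=> p _; apply: differentiable_continuous.
  by have [] := avg_is_diff p wa cphi.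
split=> [p _|v]; first by have [] := avg_is_diff p wa cphi.
have -> : (fun p => 'd (avg a phi) p v) = (fun p => \sum_j v 0 j *:
    avg (fun w => a w * (if j == i then b w else 1)) (fun q => 'd phi q (delta_mx 0 j) : R^o) p).
  apply/funext => p; have [_ E] := avg_is_diff p wa cphi.
  exact: (congr1 (@^~ v) E).
apply: Ck_on_sum; first exact: openT.
move=> j _; apply: Ck_onM; [exact: openT|exact: Ck_on_cst|apply: IH].
  case: eqP => _; first exact: weightM.
  by under eq_fun do rewrite mulr1.
exact: csmooth_diff.
Qed.

Lemma diff_avg_delta a phi p j : weight a -> csmooth phi ->
  'd (avg a phi) p (delta_mx 0 j) =
  avg (fun w => a w * (if j == i then b w else 1)) (fun q => 'd phi q (delta_mx 0 j) : R^o) p.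
Proof.
move=> wa cphi; have [_ E] := avg_is_diff p wa cphi.
rewrite [LHS](congr1 (@^~ (delta_mx 0 j)) E) /rowlin (bigD1 j)//= big1 => [|l lj]; last first.
  by rewrite mxE (negbTE lj) scale0r.
by rewrite mxE !eqxx scale1r addr0.
Qed.

End Average.

Section Hadamard.
Context {R : realType} {n : nat} (i : 'I_n).
Implicit Types (phi f : 'rV[R]_n -> R^o) (p : 'rV[R]_n).

Let mu := @lebesgue_measure R.
Let I01 : set (measurableTypeR R) := `[0, 1]%classic.
Let idR : measurableTypeR R -> R := id.


Lemma weight1_01 : weight mu I01 idR (fun=> 1).
Proof.
split; first exact: measurable_cst.
move=> m; apply: continuous_compact_integrable; first exact: segment_compact.
apply: continuous_subspaceT => x; under eq_fun do rewrite mul1r.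
exact: exprn_continuous.
Qed.

Let avg01 := avg mu I01 i idR (fun=> 1).

Lemma scale_coordE s p : scale_coord i s p = upd i 0 p + s *: (p 0 i *: delta_mx 0 i).
Proof.
apply/rowP => j; rewrite !mxE /=.
by case: eqP => _; rewrite ?mulr1 ?mulr0 ?add0r ?addr0.
Qed.

(** The fundamental theorem of calculus along [s |-> scale_coord i s p], which runs from [upd i 0 p]
    to [p]. *)
Lemma avg01E phi p : csmooth phi ->
  p 0 i * avg01 (fun q => 'd phi q (delta_mx 0 i) : R^o) p = phi p - phi (upd i 0 p).
Proof.
move=> cphi; have cd := csmooth_diff (delta_mx 0 i) cphi.
pose G (s : R) : R := phi (scale_coord i s p).
pose g (s : R) : R := p 0 i * 'd phi (scale_coord i s p) (delta_mx 0 i).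
have sc : continuous (fun s : R => scale_coord i s p).
  move=> s; under eq_fun do rewrite scale_coordE.
  by apply: cvgD; [exact: cvg_cst|apply: cvgZr_tmp; exact: cvg_id].
have cg : continuous g.
  move=> s; apply: cvgM; first exact: cvg_cst.
  apply: (@continuous_comp _ _ _ (fun s : R => scale_coord i s p) (fun q => 'd phi q (delta_mx 0 i) : R^o)).
    exact: sc.
  exact: csmooth_continuous.
have dG (s : R) : is_derive s 1 (G : R -> R^o) (g s).
  have ds : is_diff (s : R^o) (fun s : R^o => scale_coord i s p) (fun t => t *: (p 0 i *: delta_mx 0 i)).
    have [d1 d2] := @is_diffD R R^o 'rV[R]_n (cst (upd i 0 p)) ( *:%R ^~ (p 0 i *: delta_mx 0 i)) _ _ s
      (is_diff_cst _ _) (is_diff_scalel _ _).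
    have -> : (fun s : R^o => scale_coord i s p) = cst (upd i 0 p) + *:%R ^~ (p 0 i *: delta_mx 0 i).
      by apply/funext => t; rewrite scale_coordE.
    by split; [exact: d1|rewrite [LHS]d2; apply/funext => t; rewrite !fctE add0r].
  have [ds1 ds2] := ds; have dphi := csmooth_differentiable (scale_coord i s p) cphi.
  have dc : differentiable (phi \o (fun s : R^o => scale_coord i s p)) (s : R^o).
    exact: differentiable_comp ds1 dphi.
  apply: DeriveDef; first exact: diff_derivable.
  rewrite deriveE// (diff_comp ds1 dphi) /= ds2 scale1r linearZ//.
have := @continuous_FTC2 R g G 0 1 ltr01.
rewrite -/mu => H.
have -> : phi p - phi (upd i 0 p) = \int[mu]_(x in I01) g x.
  rewrite /Rintegral H.
  - by rewrite /= /G /scale_coord mul1r mul0r upd_id.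
  - exact: continuous_subspaceT.
  - split.
    + by move=> s _; exact: ex_derive.
    + by apply: cvg_at_right_filter; apply: differentiable_continuous; apply/derivable1_diffP; exact: ex_derive.
    + by apply: cvg_at_left_filter; apply: differentiable_continuous; apply/derivable1_diffP; exact: ex_derive.
  - by move=> s _; rewrite derive1E derive_val.
have mI : measurable I01 by exact: measurable_itv.
have mid : measurable_fun I01 idR by exact: measurable_id.
have WI := weight_integrable mI i mid p weight1_01 cd.
rewrite /avg01 /avg -(RintegralZl _ mI WI).
by apply: eq_Rintegral => s _; rewrite /g mul1r.
Qed.

Lemma hadamard_csmooth phi : csmooth phi -> (forall p, phi (upd i 0 p) = 0) ->
  exists2 psi, csmooth psi & forall p, phi p = p 0 i * psi p.
Proof.
move=> cphi phi0; have cd := csmooth_diff (delta_mx 0 i) cphi.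
exists (avg01 (fun q => 'd phi q (delta_mx 0 i) : R^o)); last first.
  by move=> p; rewrite avg01E// phi0 subr0.
split; first by move=> k; apply: Ck_avg => //; [exact: measurable_itv|exact: measurable_id|exact: weight1_01].
have [_ [r Hr]] := cphi; have [_ [s Hs]] := cd.
exists (Num.max r s) => p; rewrite ge_max => /andP[rp sp].
(* Off the hyperplane the quotient is determined by [phi], zero at this [p]; on it rescaling fixes
   [p], so the integrand is the vanishing derivative. *)
have [p0|p0] := eqVneq (p 0 i) 0; last first.
  by apply: (mulfI p0); rewrite avg01E// phi0 Hr// mulr0 subr0.
rewrite /avg01 /avg.
under eq_Rintegral do rewrite /scale_coord p0 mulr0 -p0 upd_id Hs// mulr0.
by rewrite /Rintegral integral0.
Qed.

Lemma csmooth_smooth_germ phi : csmooth phi -> smooth_germ phi.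
Proof. by move=> [C _]; exists setT; split => //; exact: openT. Qed.

Lemma map_germ_linear m (L : {linear 'rV[R]_n -> 'rV[R]_m}) : map_germ L.
Proof. by split; [exact: smooth_germ_linear|rewrite linear0]. Qed.

Lemma map_germ_upd0 : map_germ (upd i 0 : 'rV[R]_n -> 'rV[R]_n).
Proof.
have -> : (upd i 0 : 'rV[R]_n -> 'rV[R]_n) = scale_coord i 0.
  by apply/funext => p; rewrite /scale_coord mul0r.
exact: map_germ_linear.
Qed.

Lemma norm_upd0 p : `|upd i 0 p| <= `|p|.
Proof. by have := norm_upd i 0 p; rewrite normr0 le_max normr_le0 => /orP[/eqP->|//]; rewrite ?normr0. Qed.

Lemma hadamard_germ f : smooth_germ f ->
  (\forall p \near (0 : 'rV[R]_n), f (upd i 0 p) = 0) ->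
  exists2 g : 'rV[R]_n -> R^o, smooth_germ g &
    \forall p \near (0 : 'rV[R]_n), f p = p 0 i * g p.
Proof.
move=> sf /nbhs_norm0P[s /= s0 Hs].
have [r [cs r0 rs]] : exists r, [/\ csmooth (fun p => f p * bump r p : R^o), 0 < r & r < s].
  apply: (@filter_ex _ (0 : R)^'+); apply: filterS3 (csmooth_cutoff sf)
    (nbhs_right_gt (0 : R)) (nbhs_right_lt s0) => r; exact: And3.
have [p|psi cpsi psiE] := hadamard_csmooth cs.
  have [pr|pr] := ltP `|upd i 0 p| r; last by rewrite bump_outside ?mulr0.
  by have := Hs (upd i 0 p) (lt_trans pr rs); rewrite updK => ->; rewrite mul0r.
have b0 : bump r (0 : 'rV[R]_n) != 0 by rewrite gt_eqF ?bump0_gt0.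
exists (fun p => psi p * (bump r p)^-1 : R^o).
  apply: smooth_germM; first exact: csmooth_smooth_germ.
  by apply: smooth_germ_inv => //; exact: smooth_germ_bump.
have : \forall p \near (0 : 'rV[R]_n), bump r p != 0.
  exact: (@cvgr_neq0 _ R^o _ (nbhs 0) _ _ (bump r 0) (smooth_germ_continuous0 (smooth_germ_bump r)) b0).
by apply: filterS => p bp; rewrite mulrA -psiE mulfK.
Qed.

End Hadamard.

(** * Whitney's theorem on even functions *)

Section CountingIntegral.
Context {R : realType}.
Notation mu := (@counting nat R).

Lemma measurable_nat (x : nat -> R) : measurable_fun [set: nat] x.
Proof. by []. Qed.

Lemma ge0_count_lim (x : nat -> R) (L : R) : (forall k, 0 <= x k) ->
  (fun n => \sum_(0 <= k < n) x k) @ \oo --> L ->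
  (\int[mu]_t (x t)%:E = L%:E)%E.
Proof.
move=> x0 xL; rewrite ge0_integral_count//.
apply: cvg_lim => //; under eq_fun do rewrite sumEFin.
by apply: cvg_EFin; first exact: nearW.
Qed.

Lemma geometric_integrable (x : nat -> R) (K r : R) : 0 <= r < 1 ->
  (forall k, `|x k| <= K * r ^+ k) -> mu.-integrable setT (EFin \o x).
Proof.
move=> /andP[r0 r1] xK.
have K0 : 0 <= K by have := xK 0%N; rewrite expr0 mulr1; apply: le_trans.
apply: (@le_integrable _ _ _ mu setT measurableT _ (EFin \o (fun k => K * r ^+ k))) => //.
  by move=> k _ /=; rewrite lee_fin (le_trans (xK k))// ler_norm.
apply/integrableP; split => //=.
rewrite (@ge0_count_lim (fun k => `|K * r ^+ k|) (K * (1 - r)^-1)) ?ltry//.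
under eq_fun do under eq_bigr do rewrite ger0_norm ?mulr_ge0 ?exprn_ge0//.
have := @cvg_geometric_series R K r; rewrite ger0_norm// => /(_ r1).
by [].
Qed.

Lemma count_lim (x : nat -> R) (L : R) : mu.-integrable setT (EFin \o x) ->
  (fun n => \sum_(0 <= k < n) x k) @ \oo --> L ->
  \int[mu]_t x t = L.
Proof.
move=> /integrableP[_ xoo] xL; rewrite /Rintegral integral_count; last first.
  rewrite /summable -nneseries_esumT//= -ge0_integral_count//.
rewrite (_ : limn _ = L%:E)//.
apply: cvg_lim => //; under eq_fun do rewrite sumEFin.
by apply: cvg_EFin; first exact: nearW.
Qed.

End CountingIntegral.

(** * Weights all of whose moments equal 1 *)

Section SeeleyCoefficients.
Context {R : realType}.
Notation mu := (@counting nat R).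

(* The coefficients of [prod_(j >= 0) (1 - z / 8 ^ j)], which vanishes at every
   [8 ^ m]. *)
Fixpoint euler_coef (k : nat) : R :=
  if k is k'.+1 then - (euler_coef k' * 8 / (8 * 8 ^+ k' - 1)) else 1.

Lemma pow8_ge1 k : 1 <= 8 ^+ k :> R.
Proof. by rewrite exprn_ege1// ler1n. Qed.

Lemma euler_coefS k : euler_coef k.+1 * (8 * 8 ^+ k - 1) = - (8 * euler_coef k).
Proof.
have := pow8_ge1 k; set B := 8 ^+ k => B1 /=; rewrite -/B.
by field; apply/eqP => E; lra.
Qed.

Lemma euler_coef_decay k : `|euler_coef k.+1| * 8 ^+ k <= 2 * `|euler_coef k|.
Proof.
have := pow8_ge1 k; have := euler_coefS k; set B := 8 ^+ k => E B1.
have B0 : 0 < 8 * B - 1 by lra.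
have : `|euler_coef k.+1| * (8 * B - 1) = 8 * `|euler_coef k|.
  rewrite -(gtr0_norm B0) -normrM E normrN normrM ger0_norm//.
have : 0 <= `|euler_coef k.+1| * (B - 1) by rewrite mulr_ge0// subr_ge0.
have := normr_ge0 (euler_coef k.+1); lra.
Qed.

Lemma eventually_decreasing_bounded (v : nat -> R) N : (forall k, 0 <= v k) ->
  (forall k, (N <= k)%N -> v k.+1 <= v k) -> exists K, forall k, v k <= K.
Proof.
move=> v0 vd; exists (\sum_(j < N.+1) v j) => k.
elim: k => [|k IH]; first by rewrite big_ord_recl lerDl sumr_ge0.
have [kN|kN] := leqP N k; first exact: le_trans (vd _ kN) IH.
rewrite (bigD1 (Ordinal (kN : (k.+1 < N.+1)%N)))//= lerDl sumr_ge0//.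
Qed.

(** Passing from [k] to [k + 1] multiplies the quantity by at most [2 * 8 ^ m / 8 ^ k], which is
    below 1 once [m < k]. *)
Lemma euler_coef_rapid m : exists K, forall k, `|euler_coef k| * 8 ^+ (m * k) <= K.
Proof.
apply: (@eventually_decreasing_bounded _ m.+1) => [k|k mk].
  by rewrite mulr_ge0// exprn_ge0.
have := euler_coef_decay k; rewrite -/(euler_coef k.+1); set u := `|euler_coef k.+1|; set u' := `|euler_coef k| => H.
rewrite mulnS exprD mulrA.
have E : 8 ^+ k = 8 ^+ (k - m) * 8 ^+ m :> R by rewrite -exprD subnK// ltnW.
have : 8 <= 8 ^+ (k - m) :> R.
  by rewrite -[leLHS]expr1 ler_weXn2l ?ler1n// subn_gt0.
move=> H8; rewrite ler_wpM2r ?exprn_ge0//.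
have m0 : 0 <= 8 ^+ m :> R by rewrite exprn_ge0.
have u0 : 0 <= u by exact: normr_ge0.
have u'0 : 0 <= u' by exact: normr_ge0.
have : u * 8 ^+ m * 8 <= u * 8 ^+ m * 8 ^+ (k - m).
  by rewrite ler_wpM2l ?mulr_ge0.
rewrite E in H.
have : u * (8 ^+ (k - m) * 8 ^+ m) = u * 8 ^+ m * 8 ^+ (k - m) by ring.
lra.
Qed.

Lemma euler_coef_geometric m : exists K, forall k,
  `|euler_coef k * (8 ^+ k) ^+ m| <= K * (8^-1) ^+ k.
Proof.
have [K HK] := euler_coef_rapid m.+1; exists K => k.
rewrite normrM (ger0_norm (exprn_ge0 _ (exprn_ge0 _ _)))//.
rewrite -exprM exprVn ler_pdivlMr ?exprn_gt0// -mulrA -exprD.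
by have := HK k; rewrite mulSn addnC mulnC.
Qed.

Lemma inv8_itv : 0 <= (8^-1 : R) < 1.
Proof. by apply/andP; split; lra. Qed.

Lemma euler_coef_integrable m :
  mu.-integrable setT (EFin \o (fun k => euler_coef k * (8 ^+ k) ^+ m)).
Proof.
have [K HK] := euler_coef_geometric m; exact: geometric_integrable inv8_itv HK.
Qed.

(* Coefficientwise, the functional equation [E z = (1 - z) * E (z / 8)] of the
   product. *)
Lemma euler_coef_rec k (z : R) : euler_coef k.+1 * z ^+ k.+1 =
  euler_coef k.+1 * (z / 8) ^+ k.+1 - z * (euler_coef k * (z / 8) ^+ k).
Proof.
have B1 := pow8_ge1 k; have E := euler_coefS k.
have -> : euler_coef k = - (euler_coef k.+1 * (8 * 8 ^+ k - 1)) / 8.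
  by rewrite E opprK mulrC mulKf.
rewrite !expr_div_n !exprS; field.
by rewrite gt_eqF// (lt_le_trans _ B1).
Qed.

(** At [z = 1] the recursion [euler_coef_rec] telescopes. The remainder tends to 0, which is the
    vanishing of the product at 1. *)
Lemma euler_sum0 N :
  \sum_(0 <= k < N.+1) euler_coef k * (8 ^+ k) ^+ 0 = euler_coef N / 8 ^+ N.
Proof.
elim: N => [|N IH]; first by rewrite big_nat1 !expr0 mulr1 divr1.
rewrite big_nat_recr//= IH expr0 mulr1 -/(euler_coef N.+1).
have := euler_coef_rec N 1; rewrite !expr1n !mulr1 !mul1r => E.
by rewrite [X in _ + X]E !exprVn addrCA subrr addr0.
Qed.

(** The functional equation truncated at degree [N], with the boundary term left by the truncation:
    zeros propagate from [8 ^ m] to [8 ^ m.+1]. *)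
Lemma euler_sumS m N :
  \sum_(0 <= k < N.+1) euler_coef k * (8 ^+ k) ^+ m.+1 =
  (1 - 8 ^+ m.+1) * (\sum_(0 <= k < N.+1) euler_coef k * (8 ^+ k) ^+ m) +
  8 ^+ m.+1 * (euler_coef N * (8 ^+ N) ^+ m).
Proof.
have P k l : (8 ^+ k) ^+ l = (8 ^+ l) ^+ k :> R by rewrite -!exprM mulnC.
elim: N => [|N IH]; first by rewrite !big_nat1 /= !expr0 !expr1n; ring.
rewrite big_nat_recr//= -/(euler_coef N.+1) IH [in RHS]big_nat_recr//= -/(euler_coef N.+1).
have := euler_coef_rec N (8 ^+ m.+1).
have -> : 8 ^+ m.+1 / 8 = 8 ^+ m :> R by rewrite exprS mulrC mulKf.
rewrite (P N.+1 m.+1) (P N.+1 m) (P N m) => ->; ring.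
Qed.

Lemma euler_term_cvg0 m : (fun k => euler_coef k * (8 ^+ k) ^+ m) @ \oo --> 0.
Proof.
have [K HK] := euler_coef_geometric m.
apply/norm_cvg0P; apply: (@squeeze_cvgr _ _ _ _ (cst 0) (geometric K 8^-1)).
- by apply: nearW => k; rewrite normr_ge0 /= HK.
- exact: cvg_cst.
- by apply: cvg_geometric; rewrite ger0_norm; have /andP[] := inv8_itv.
Qed.

Lemma euler_sum_cvg0 m :
  (fun N => \sum_(0 <= k < N) euler_coef k * (8 ^+ k) ^+ m) @ \oo --> 0.
Proof.
rewrite -cvg_shiftS; elim: m => [|m IH].
  under eq_fun do rewrite euler_sum0.
  have := @cvg_geometric R 1 8^-1.
  have := euler_term_cvg0 0; under eq_fun do rewrite expr0 mulr1.
  move=> H1; rewrite ger0_norm; last by have /andP[] := inv8_itv.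
  have /andP[_ ->] := inv8_itv => /(_ isT) H2.
  have := cvgM H1 H2; rewrite mul0r.
  rewrite (_ : _ \* _ = (fun k => euler_coef k / 8 ^+ k)); first exact.
  by apply/funext => k /=; rewrite mul1r exprVn.
under eq_fun do rewrite euler_sumS.
have C (x : R) : (fun _ : nat => x) @ \oo --> x by exact: cvg_cst.
have := cvgD (cvgM (C (1 - 8 ^+ m.+1)) IH) (cvgM (C (8 ^+ m.+1)) (euler_term_cvg0 m)).
rewrite !mulr0 addr0; exact.
Qed.

Lemma euler_moment m : \int[mu]_k (euler_coef k * (8 ^+ k) ^+ m) = 0.
Proof. exact: count_lim (euler_coef_integrable m) (euler_sum_cvg0 m). Qed.

(** The ratio of consecutive terms is largest in absolute value at [k = 0], where it is [16 / 63].
    Such fast decay, due to the base 8, lets the first term outweigh all others, so that the sum can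
    be normalized to 1. *)
Lemma euler_div_decay k :
  `|euler_coef k / (1 + 8 ^+ k)| <= 2^-1 * 3^-1 ^+ k :> R.
Proof.
elim: k => [|k IH]; first by rewrite /= !expr0 mul1r mulr1 ger0_norm ?invr_ge0 ?addr_ge0//; lra.
apply: (@le_trans _ _ (`|euler_coef k / (1 + 8 ^+ k)| * 3^-1)); last first.
  by rewrite exprSr mulrA ler_wpM2r// invr_ge0.
have := pow8_ge1 k; rewrite /= exprS; set B := 8 ^+ k => B1.
have -> : - (euler_coef k * 8 / (8 * B - 1)) / (1 + 8 * B) =
    (euler_coef k / (1 + B)) * (- (8 * (1 + B) / ((8 * B - 1) * (1 + 8 * B)))).
  by field; apply/and3P; split; apply/eqP => E; lra.
rewrite normrM normrN ler_wpM2l// ger0_norm; last first.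
  by rewrite divr_ge0 ?mulr_ge0//; lra.
rewrite ler_pdivrMr; last by rewrite mulr_gt0//; lra.
have : 0 <= (B - 1) * (B - 1) by exact: sqr_ge0.
lra.
Qed.

Lemma seeley_coefficients : exists a : nat -> R,
  weight mu setT (fun k => 8 ^+ k) a /\
  forall m, \int[mu]_k (a k * (- 8 ^+ k) ^+ m) = 1.
Proof.
(* Since [t k * (1 + 8 ^+ k)] is [euler_coef k], all of whose moments vanish, the
   moments of [t] alternate in sign. *)
pose t k : R := euler_coef k / (1 + 8 ^+ k).
have tle k m : `|t k * (8 ^+ k) ^+ m| <= `|euler_coef k * (8 ^+ k) ^+ m|.
  rewrite !normrM ler_wpM2r// ler_piMr// normfV invf_le1; last first.
    by rewrite normr_gt0 gt_eqF// ltr_wpDr ?exprn_ge0.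
  by rewrite ger0_norm ?addr_ge0 ?exprn_ge0// lerDl exprn_ge0.
have ti m : mu.-integrable setT (EFin \o (fun k => t k * (8 ^+ k) ^+ m)).
  apply: (le_integrable measurableT _ _ (euler_coef_integrable m)) => // k _ /=.
  by rewrite lee_fin.
have ti0 : mu.-integrable setT (EFin \o t).
  by apply: eq_integrable (ti 0%N) => // k _ /=; rewrite expr0 mulr1.
pose c := \int[mu]_k t k.
have r3 : 0 <= (3^-1 : R) < 1 by apply/andP; split; lra.
(* A minorant of [t]: both are [1 / 2] at 0, and further on [w] is minus the bound on the absolute
   value of [t]. Its sum is [1 - 3 / 4]. *)
pose w k : R := (k == 0%N)%:R - 2^-1 * 3^-1 ^+ k.
have wi : mu.-integrable setT (EFin \o w).
  apply: (geometric_integrable (K := 1) r3) => -[|k]; rewrite /w /=.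
    by rewrite expr0 ger0_norm; lra.
  rewrite sub0r normrN ger0_norm ?mulr_ge0 ?exprn_ge0 ?invr_ge0//.
  by rewrite ler_wpM2r ?exprn_ge0 ?invr_ge0//; lra.
have c_ge : 4^-1 <= c.
  have <- : \int[mu]_k w k = 4^-1.
    apply: count_lim => //; rewrite -cvg_shiftS.
    have E N : \sum_(0 <= k < N.+1) w k = 1 - series (geometric 2^-1 3^-1) N.+1.
      have I : \sum_(0 <= k < N.+1) (k == 0%N)%:R = 1 :> R.
        by rewrite big_nat_recl// big1 ?addr0.
      by rewrite /series /= sumrB I.
    under eq_fun do rewrite E.
    have -> : 4^-1 = 1 - 2^-1 * (1 - 3^-1)^-1 :> R by field.
    apply: cvgB; first exact: cvg_cst.
    rewrite cvg_shiftS; apply: cvg_geometric_series.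
    by rewrite ger0_norm; have /andP[] := r3.
  apply: le_Rintegral => //= k _.
  have := euler_div_decay k; rewrite -/(t k) ler_norml => /andP[H1 H2].
  rewrite /w; case: k {H2} H1 => [|k] /=; last by rewrite sub0r.
  have E2 : (1 + 1)^-1 = 2^-1 :> R by [].
  rewrite /t !expr0 /= mul1r mulr1 mulr1n E2 => _; lra.
have c0 : c != 0 by rewrite gt_eqF// (lt_le_trans _ c_ge)// invr_gt0.
exists (fun k => c^-1 * t k).
have ci m : mu.-integrable setT (EFin \o (fun k => c^-1 * t k * (8 ^+ k) ^+ m)).
  have := integrableZl measurableT c^-1 (ti m).
  by apply: eq_integrable => // k _ /=; rewrite -EFinM mulrA.
split; first by split.
elim=> [|m IH].
  under eq_Rintegral do rewrite expr0 mulr1.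
  by rewrite RintegralZl// -/c mulVf.
have ni l : mu.-integrable setT (EFin \o (fun k => c^-1 * t k * (- 8 ^+ k) ^+ l)).
  apply: (le_integrable measurableT _ _ (ci l)) => // k _ /=.
  by rewrite lee_fin !normrM !normrX normrN normrX.
have := euler_moment m.
have -> : (fun k => euler_coef k * (8 ^+ k) ^+ m) =
    (fun k => (-1) ^+ m * c * (c^-1 * t k * (- 8 ^+ k) ^+ m - c^-1 * t k * (- 8 ^+ k) ^+ m.+1)).
  apply/funext => k; rewrite [in RHS]exprS -[- 8 ^+ k]mulN1r exprMn.
  have B1 := pow8_ge1 k; rewrite /t.
  have -> : (-1) ^+ m * c * (c^-1 * (euler_coef k / (1 + 8 ^+ k)) * ((-1) ^+ m * (8 ^+ k) ^+ m) -
    c^-1 * (euler_coef k / (1 + 8 ^+ k)) * (-1 * 8 ^+ k * ((-1) ^+ m * (8 ^+ k) ^+ m))) =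
    ((-1) ^+ m * (-1) ^+ m) * (euler_coef k * (8 ^+ k) ^+ m).
    by field; rewrite c0 andbT gt_eqF//; lra.
  by rewrite -exprMn mulrNN mulr1 expr1n mul1r.
rewrite RintegralZl//; last exact: (integrableB measurableT (ni m) (ni m.+1)).
rewrite RintegralB// IH => /eqP; rewrite !mulf_eq0 (negbTE c0) orbF signr_eq0/=.
by rewrite subr_eq0 => /eqP <-.
Qed.

End SeeleyCoefficients.

Section EvenFunctions.
Context {R : realType} {n : nat} (i : 'I_n).
Implicit Types (phi psi : 'rV[R]_n -> R^o) (p v : 'rV[R]_n).

Definition even_in phi := forall p, phi (scale_coord i (-1) p) = phi p.

Lemma scale_delta b j : scale_coord i b (delta_mx 0 j) =
  (if j == i then b else 1) *: delta_mx 0 j :> 'rV[R]_n.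
Proof.
apply/rowP => l; rewrite !mxE /=.
case: (eqVneq l i) => [->|li]; case: (eqVneq j i) => [ji|ji]; rewrite ?mul1r//.
- by rewrite mulr0.
- by rewrite ji (negbTE li) mulr0.
Qed.

Lemma even_in_diff phi p j : csmooth phi -> even_in phi ->
  'd phi (scale_coord i (-1) p) (delta_mx 0 j) =
  (if j == i then -1 else 1) * 'd phi p (delta_mx 0 j).
Proof.
move=> cphi ephi.
have dphi q := csmooth_differentiable q cphi.
have E : phi \o scale_coord i (-1) = phi by apply/funext => q; exact: ephi.
have cs := @linear_rV_continuous _ _ _ (scale_coord i (-1) : {linear 'rV[R]_n -> 'rV[R]_n}).
have ds : differentiable (scale_coord i (-1)) p by exact: linear_differentiable.
have := diff_comp ds (dphi (scale_coord i (-1) p)).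
rewrite E (diff_lin _ cs) => /(congr1 (@^~ (delta_mx 0 j))) /=.
have Z : 'd phi (scale_coord i (-1) p) (scale_coord i (-1) (delta_mx 0 j)) =
    (if j == i then -1 else 1) *: 'd phi (scale_coord i (-1) p) (delta_mx 0 j).
  by apply: (etrans (congr1 ('d phi (scale_coord i (-1) p)) (scale_delta (-1) j))); exact: linearZ.
move=> H0; have H := etrans H0 Z.
apply/esym; apply: (etrans (congr1 (fun x : R => (if j == i then -1 else 1) * x) H)).
by rewrite /GRing.scale /= mulrA; case: (j == i); rewrite ?mulrNN !mul1r.
Qed.

Lemma even_in_partial phi j : j != i -> csmooth phi -> even_in phi ->
  even_in (fun p => 'd phi p (delta_mx 0 j)).
Proof.
move=> ji cphi ephi p; have := even_in_diff p j cphi ephi.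
by rewrite (negbTE ji) mul1r.
Qed.

Lemma csmoothZ (c : R) phi : csmooth phi -> csmooth (fun p => c * phi p : R^o).
Proof.
move=> [Cp [r Hr]]; split; last by exists r => p /Hr ->; rewrite mulr0.
move=> k; apply: Ck_onM; [exact: openT|exact: Ck_on_cst|exact: Cp].
Qed.

(** The derivative is odd, hence zero on the hyperplane, and Hadamard's lemma divides it by the
    coordinate. With the factor 2, [psi] is the derivative of [phi] with respect to the square of
    that coordinate. *)
Lemma even_in_derivative phi : csmooth phi -> even_in phi ->
  exists psi, [/\ csmooth psi, even_in psi &
    forall p, 'd phi p (delta_mx 0 i) = 2 * p 0 i * psi p].
Proof.
move=> cphi ephi.
have odd p := even_in_diff p i cphi ephi.
rewrite eqxx in odd.
have [p|chi cchi chiE] := hadamard_csmooth (i := i) (csmooth_diff (delta_mx 0 i) cphi).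
  have E : scale_coord i (-1) (upd i 0 p) = upd i 0 p.
    by rewrite /scale_coord updE eqxx mulr0 updK.
  by have := odd (upd i 0 p); rewrite E; lra.
exists (fun p => 2^-1 * chi p : R^o); split; first exact: csmoothZ.
- move=> p; congr (_ * _).
  have [p0|p0] := eqVneq (p 0 i) 0.
    by rewrite /scale_coord p0 mulr0 -p0 upd_id.
  have H1 := chiE p; have H2 := chiE (scale_coord i (-1) p).
  have H3 := odd p; have H4 : scale_coord i (-1) p 0 i = - p 0 i by rewrite updE eqxx mulN1r.
  apply: (mulfI p0); apply: (etrans _ H1); apply: oppr_inj.
  have H5 : - p 0 i * chi (scale_coord i (-1) p) = -1 * 'd phi p (delta_mx 0 i).
    exact: (etrans (etrans (congr1 ( *%R^~ (chi (scale_coord i (-1) p))) (esym H4)) (esym H2)) H3).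
  by rewrite -mulNr H5 mulN1r.
- by move=> p; rewrite chiE; field.
Qed.

Lemma is_diff_upd s p : is_diff (s : R^o) (fun s : R^o => upd i s p)
  (fun t => t *: delta_mx 0 i).
Proof.
have [d1 d2] := @is_diffD R R^o 'rV[R]_n (cst (upd i 0 p)) ( *:%R ^~ (delta_mx 0 i)) _ _ s
  (is_diff_cst _ _) (is_diff_scalel _ _).
have E : (fun s : R^o => upd i s p) = cst (upd i 0 p) + *:%R ^~ (delta_mx 0 i).
  by apply/funext => t; rewrite !fctE /= -upd_delta -updD add0r addr0.
rewrite E; split; [exact: d1|rewrite [LHS]d2; apply/funext => t; by rewrite !fctE add0r].
Qed.

(** The mean value theorem for [phi - C * y ^+ 2] along the [i]-th axis. Taking [C] to be 0, then
    [psi (upd i 0 p)], yields the expansions of [phi] in powers of [y ^+ 2]. *)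
Lemma mvt_upd phi p (y C : R) : csmooth phi -> exists2 t : R, 0 <= t <= 1 &
  phi (upd i y p) - phi (upd i 0 p) - C * y ^+ 2 =
  y * ('d phi (upd i (t * y) p) (delta_mx 0 i) - 2 * (t * y) * C).
Proof.
move=> cphi.
pose g (s : R^o) : R^o := phi (upd i s p) - C * s ^+ 2.
have dg s : is_diff s g (fun t => t * ('d phi (upd i s p) (delta_mx 0 i) - 2 * s * C) : R^o).
  have [d1 d2] := is_diff_upd s p.
  have dphi := csmooth_differentiable (upd i s p) cphi.
  have D1 : is_diff s (phi \o (fun s : R^o => upd i s p)) ('d phi (upd i s p) \o (fun t => t *: delta_mx 0 i)).
    by split; [exact: differentiable_comp|rewrite diff_comp// d2].
  have D2 : is_derive s 1 (fun s : R^o => C * s ^+ 2 : R^o) (2 * s * C).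
    have H := is_deriveZ C (is_deriveX 2 (is_derive_id s (1 : R^o))).
    have [h1 h2] := H; apply: DeriveDef; first exact: h1.
    by rewrite [LHS]h2 /GRing.scale /= expr1; ring.
  have [d3 d4] := is_diffB D1 (is_diff_scalar D2).
  split; first exact: d3.
  rewrite [LHS]d4; apply/funext => t; rewrite !fctE /= linearZ /= /GRing.scale /=; ring.
have [t t01] := @mvt_segment R R^o g 0 y (fun t _ => @ex_diff _ _ _ _ _ _ _ (dg _)).
rewrite add0r add0r [t *: y]/(t * y) => E; exists t => //.
have [_ d] := dg (t * y); rewrite d in E.
by rewrite -E /g expr0n /=; ring.
Qed.

Lemma even_in_quadratic phi : csmooth phi -> even_in phi ->
  exists M, forall p y, `|phi (upd i y p) - phi (upd i 0 p)| <= M * y ^+ 2.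
Proof.
move=> cphi ephi; have [psi [cpsi _ psiE]] := even_in_derivative cphi ephi.
have [M HM] := csmooth_bounded cpsi; exists (2 * M) => p y.
have [t /andP[t0 t1]] := mvt_upd p y 0 cphi.
rewrite mul0r mulr0 !subr0 psiE updE eqxx => ->.
rewrite (_ : y * (2 * (t * y) * _) = y ^+ 2 * (2 * t * psi (upd i (t * y) p))); last by ring.
rewrite normrM ger0_norm ?sqr_ge0// mulrC ler_wpM2r ?sqr_ge0//.
rewrite !normrM ger0_norm// (ger0_norm t0) -mulrA ler_wpM2l//.
have := HM (upd i (t * y) p).
have : t * `|psi (upd i (t * y) p)| <= `|psi (upd i (t * y) p)| by rewrite ler_piMl.
lra.
Qed.

(** The mean value theorem leaves [y ^+ 2] times a difference of values of [psi], which is quadratic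
    in [y] since [psi] is even. The remainder is thus quadratic in the variable [y ^+ 2]. *)
Lemma even_in_quartic phi psi : csmooth phi -> csmooth psi -> even_in psi ->
  (forall p, 'd phi p (delta_mx 0 i) = 2 * p 0 i * psi p) ->
  exists M, forall p y,
    `|phi (upd i y p) - phi (upd i 0 p) - y ^+ 2 * psi (upd i 0 p)| <= M * y ^+ 4.
Proof.
move=> cphi cpsi epsi psiE.
have [M HM] := even_in_quadratic cpsi epsi; exists (2 * `|M|) => p y.
have [t /andP[t0 t1]] := mvt_upd p y (psi (upd i 0 p)) cphi.
rewrite [psi _ * _]mulrC psiE updE eqxx => ->.
rewrite (_ : _ * (_ - _) = y ^+ 2 * (2 * t * (psi (upd i (t * y) p) - psi (upd i 0 p)))); last by ring.
rewrite normrM ger0_norm ?sqr_ge0// (_ : y ^+ 4 = y ^+ 2 * y ^+ 2); last by rewrite -exprD.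
rewrite mulrCA ler_wpM2l ?sqr_ge0//.
rewrite !normrM ger0_norm// (ger0_norm t0) -!mulrA ler_wpM2l//.
have H := HM p (t * y).
have H2 : M * (t * y) ^+ 2 <= `|M| * y ^+ 2.
  rewrite (@le_trans _ _ (`|M| * (t * y) ^+ 2))// ?ler_wpM2r ?sqr_ge0 ?ler_norm//.
  by rewrite ler_wpM2l// exprMn ler_piMl ?sqr_ge0// expr_le1.
have : t * `|psi (upd i (t * y) p) - psi (upd i 0 p)| <= `|psi (upd i (t * y) p) - psi (upd i 0 p)| by rewrite ler_piMl.
lra.
Qed.

Lemma csmooth_lipschitz phi : csmooth phi ->
  exists M, forall p h, `|phi (p + h) - phi p| <= M * `|h|.
Proof.
move=> cphi.
have /choice[M HM] j : exists M, forall p, `|'d phi p (delta_mx 0 j)| <= M.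
  exact: csmooth_bounded (csmooth_diff _ cphi).
exists (\sum_j M j) => p h.
have [t t01 ->] := @mvt_segment R _ phi p h (fun t _ => csmooth_differentiable _ cphi).
rewrite linear_rowlin (le_trans (rowlin_bound _ _))// ler_wpM2r//.
by apply: ler_sum => j _; exact: HM.
Qed.

End EvenFunctions.

Section SquareRootSubstitution.
Context {R : realType} {n : nat} (i : 'I_n).
Implicit Types (phi psi chi : 'rV[R]_n -> R^o) (p v : 'rV[R]_n).

Lemma is_diff_upd_sqrt chi p : 0 < p 0 i ->
  differentiable chi (upd i (Num.sqrt (p 0 i)) p) ->
  is_diff p (fun q => chi (upd i (Num.sqrt (q 0 i)) q) : R^o)
    (rowlin (fun j => (if j == i then (2 * Num.sqrt (p 0 i))^-1 else 1) *
       'd chi (upd i (Num.sqrt (p 0 i)) p) (delta_mx 0 j) : R^o)).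
Proof.
move=> p0 dchi; pose s (q : 'rV[R]_n) : 'rV[R]_n := upd i (Num.sqrt (q 0 i)) q.
have dproj j : is_diff p (fun q : 'rV[R]_n => q 0 j : R^o) (fun v => v 0 j : R^o).
  have cl := @linear_rV_continuous _ _ _ (@coordl R n j).
  split; first exact: (@linear_differentiable _ _ _ (coordl j)).
  exact: (@diff_lin _ _ _ (coordl j)).
have ds j : is_diff p (fun q => s q 0 j : R^o)
    (fun v => v 0 j * (if j == i then (2 * Num.sqrt (p 0 i))^-1 else 1) : R^o).
  have [->|ji] := eqVneq j i.
    have -> : (fun q => s q 0 i : R^o) = (@Num.sqrt R) \o (fun q : 'rV[R]_n => q 0 i : R^o).
      by apply/funext => q; rewrite /= updE eqxx.
    have [d1 d2] := dproj i.
    have := is_diff_scalar_comp (is_diff_scalar (is_derive1_sqrt p0)) d1.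
    by rewrite d2.
  have -> : (fun q => s q 0 j : R^o) = (fun q : 'rV[R]_n => q 0 j : R^o).
    by apply/funext => q; rewrite updE (negbTE ji).
  by under [X in is_diff _ _ X]eq_fun do rewrite mulr1; exact: dproj.
have [d1 d2] := @is_diff_row R _ n s p (fun j => @ex_diff _ _ _ _ _ _ _ (ds j)).
have d3 : differentiable chi (s p) := dchi.
split; first exact: differentiable_comp d1 d3.
rewrite [LHS](diff_comp d1 d3) d2; apply/funext => v /=.
have -> : \row_j 'd (fun q => s q 0 j : R^o) p v =
    \row_j (v 0 j * (if j == i then (2 * Num.sqrt (p 0 i))^-1 else 1)).
  apply/rowP => j; rewrite !mxE.
  exact: (congr1 (@^~ v) (@diff_val _ _ _ _ _ _ _ (ds j))).
rewrite [LHS]linear_rowlin; apply: eq_bigr => j _.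
by rewrite mxE /GRing.scale /= mulrA.
Qed.

Lemma rowlin_scale (c : 'I_n -> R^o) b v : rowlin c (scale_coord i b v) =
  rowlin (fun j => (if j == i then b else 1) * c j : R^o) v.
Proof.
apply: eq_bigr => j _; rewrite updE; case: eqP => [->|_]; last by rewrite mul1r.
by rewrite /GRing.scale /= mulrA (mulrC b).
Qed.

(** Reflecting the [i]-th coordinate reduces to positive values. *)
Lemma is_diff_upd_sqrtN chi p : p 0 i < 0 ->
  differentiable chi (upd i (Num.sqrt (- p 0 i)) p) ->
  is_diff p (fun q => chi (upd i (Num.sqrt (- q 0 i)) q) : R^o)
    (rowlin (fun j => (if j == i then - (2 * Num.sqrt (- p 0 i))^-1 else 1) *
       'd chi (upd i (Num.sqrt (- p 0 i)) p) (delta_mx 0 j) : R^o)).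
Proof.
move=> p0 dchi; pose s : {linear 'rV[R]_n -> 'rV[R]_n} := scale_coord i (-1).
have sE q : upd i (Num.sqrt (s q 0 i)) (s q) = upd i (Num.sqrt (- q 0 i)) q.
  by rewrite updE eqxx mulN1r updK.
have sp0 : 0 < s p 0 i by rewrite updE eqxx mulN1r oppr_gt0.
have := @is_diff_upd_sqrt chi (s p) sp0; rewrite sE => /(_ dchi) [d1 d2].
have -> : (fun q : 'rV[R]_n => chi (upd i (Num.sqrt (- q 0 i)) q) : R^o) =
    (fun q : 'rV[R]_n => chi (upd i (Num.sqrt (q 0 i)) q) : R^o) \o s.
  by apply/funext => q; rewrite /= sE.
have cs := @linear_rV_continuous _ _ _ s.
have ds : differentiable s p by exact: linear_differentiable.
split; first exact: differentiable_comp ds d1.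
have d4 := diff_lin p cs.
apply: (etrans (diff_comp ds d1)); apply/funext => v.
apply: (etrans (congr1 (@^~ ('d s p v)) d2)).
apply: (etrans (congr1 (rowlin _) (congr1 (@^~ v) d4))).
apply: (etrans (rowlin_scale _ _ _)); apply: eq_bigr => j _; congr (_ *: _).
have -> : s p 0 i = - p 0 i by rewrite updE eqxx mulN1r.
by case: eqP => _; rewrite ?mul1r// mulN1r mulNr.
Qed.

End SquareRootSubstitution.

(** * Extension of [phi (sqrt u)] to negative [u] *)

Section SeeleyExtension.
Context {R : realType} {n : nat} (i : 'I_n).
Implicit Types (phi psi : 'rV[R]_n -> R^o) (a : nat -> R) (p v : 'rV[R]_n).
Notation mu := (@counting nat R).

(** Multiplying [u] by [8 ^+ k] rescales its square root by this factor. *)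
Definition beta (k : nat) : R := Num.sqrt (8 ^+ k).

Lemma scale_coord_upd b y p : scale_coord i b (upd i y p) = upd i (b * y) p.
Proof. by rewrite /scale_coord updK updE eqxx. Qed.

Lemma beta_sqr k : beta k ^+ 2 = 8 ^+ k.
Proof. by rewrite sqr_sqrtr// exprn_ge0. Qed.

(** Integrability is asked against powers of [beta] because the averages rescale [t]; the moments
    are those in the variable [u = t ^ 2]. *)
Definition seeley a := weight mu setT beta a /\
  forall m, \int[mu]_k (a k * (- 8 ^+ k) ^+ m) = 1.

Lemma seeley_exists : exists a, seeley a.
Proof.
have [a [[ma Ha] Hm]] := @seeley_coefficients R; exists a; split => //.
split => // m; apply: (le_integrable measurableT _ _ (Ha m)) => // k _ /=.
rewrite lee_fin -beta_sqr -exprM !normrM ler_wpM2l// !normrX ler_weXn2l//.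
  by rewrite ger0_norm ?sqrtr_ge0// -sqrtr1 ler_sqrt ?exprn_ge0// pow8_ge1.
by rewrite leq_pmull.
Qed.

Lemma seeley_weightM a : weight mu setT beta a -> weight mu setT beta (fun k => a k * - 8 ^+ k).
Proof.
move=> [_ Ha]; split => // m; apply: (le_integrable measurableT _ _ (Ha m.+2)) => // k _ /=.
have -> : beta k ^+ m.+2 = 8 ^+ k * beta k ^+ m by rewrite -beta_sqr -exprD.
by rewrite lee_fin mulrN mulNr normrN mulrA.
Qed.

(* Differentiating [seeley_ext] below in the [i]-th coordinate multiplies the
   [k]-th weight by [- 8 ^+ k]. *)
Lemma seeley_next a : seeley a -> seeley (fun k => a k * - 8 ^+ k).
Proof.
move=> [wa Hm]; split; first exact: seeley_weightM.
by move=> m; under eq_Rintegral do rewrite -mulrA -exprS; exact: Hm.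
Qed.

Lemma seeley_integrable a m : seeley a ->
  mu.-integrable setT (EFin \o (fun k => a k * (- 8 ^+ k) ^+ m)).
Proof.
move=> [[_ Ha] _]; apply: (le_integrable measurableT _ _ (Ha (2 * m)%N)) => // k _ /=.
by rewrite lee_fin exprM beta_sqr !normrM !normrX normrN normrX.
Qed.

Lemma seeley_sum a : seeley a -> \int[mu]_k a k = 1.
Proof. by move=> [_ /(_ 0%N)]; under eq_Rintegral do rewrite expr0 mulr1. Qed.

Lemma seeley_sum1 a : seeley a -> \int[mu]_k (a k * 8 ^+ k) = -1.
Proof.
move=> /[dup] sa [_ /(_ 1%N)] H.
have I := seeley_integrable 1 sa.
have := RintegralZl (-1) measurableT I; rewrite H mulr1 => <-.
by apply: eq_Rintegral => k _; rewrite expr1 mulN1r mulrN opprK.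
Qed.

Definition seeley_ext a phi p : R^o :=
  if 0 <= p 0 i then phi (upd i (Num.sqrt (p 0 i)) p)
  else avg mu setT i beta a phi (upd i (Num.sqrt (- p 0 i)) p).

(** Two factors [beta k], one from the chain rule and one from [2 * p 0 i] at the rescaled point,
    multiply to [8 ^+ k]: the weights are shifted as in [seeley_next]. *)
Lemma avg_even_derivative a phi psi q :
  weight mu setT beta a -> csmooth psi ->
  (forall p, 'd phi p (delta_mx 0 i) = 2 * p 0 i * psi p) ->
  avg mu setT i beta (fun k => a k * beta k)
     (fun p => 'd phi p (delta_mx 0 i) : R^o) q =
  - (2 * q 0 i * avg mu setT i beta (fun k => a k * - 8 ^+ k) psi q).
Proof.
move=> wa cpsi psiE; rewrite -mulNr /avg.
have I := weight_integrable measurableT i (measurable_nat beta) q (seeley_weightM wa) cpsi.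
rewrite -(RintegralZl _ measurableT I); apply: eq_Rintegral => k _.
rewrite psiE updE eqxx -beta_sqr; ring.
Qed.

(** For [u < 0] the zeroth moment reproduces the value at [u = 0] and the first moment the
    derivative, so the expansion is the same from both sides; the remainder, quartic in [t], is
    integrable against the weight. *)
Lemma seeley_ext_expansion a phi psi : seeley a -> csmooth phi ->
  csmooth psi -> even_in i psi ->
  (forall p, 'd phi p (delta_mx 0 i) = 2 * p 0 i * psi p) ->
  exists K, forall p, `|seeley_ext a phi p - phi (upd i 0 p) -
    p 0 i * psi (upd i 0 p)| <= K * p 0 i ^+ 2.
Proof.
move=> sa cphi cpsi epsi psiE.
have wa := sa.1.
have [M HM] := even_in_quartic cphi cpsi epsi psiE.
have M0 : 0 <= `|M| by [].
have iab : mu.-integrable setT (EFin \o (fun k => `|a k * beta k ^+ 4|)).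
  by apply: integrable_norm; exact: wa.2.
exists (`|M| + `|M| * \int[mu]_k `|a k * beta k ^+ 4|) => p.
have I0 : 0 <= \int[mu]_k `|a k * beta k ^+ 4| by exact: Rintegral_ge0.
have MI0 : 0 <= `|M| * \int[mu]_k `|a k * beta k ^+ 4| by rewrite mulr_ge0.
have p2 : 0 <= p 0 i ^+ 2 by exact: sqr_ge0.
rewrite /seeley_ext; case: ifPn => [p0|]; last rewrite -ltNge => p0.
  have := HM p (Num.sqrt (p 0 i)); rewrite sqr_sqrtr//.
  rewrite (_ : _ ^+ 4 = p 0 i ^+ 2); last by rewrite (exprM _ 2 2) sqr_sqrtr.
  move/le_trans; apply; rewrite ler_wpM2r//; have := ler_norm M; lra.
set y := Num.sqrt _; have y2 : y ^+ 2 = - p 0 i by rewrite sqr_sqrtr// oppr_ge0 ltW.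
set q0 := upd i 0 p.
have Iphi := weight_integrable measurableT i (measurable_nat beta) (upd i y p) wa cphi.
have Ia : mu.-integrable setT (EFin \o a).
  by apply: eq_integrable (wa.2 0%N) => // k _ /=; rewrite expr0 mulr1.
have Ia8 : mu.-integrable setT (EFin \o (fun k => a k * 8 ^+ k)).
  by apply: eq_integrable (wa.2 2%N) => // k _ /=; rewrite beta_sqr.
have I1 := integrableZr measurableT (phi q0) Ia.
have I2 := integrableZr measurableT (y ^+ 2 * psi q0) Ia8.
have E1 : phi q0 = \int[mu]_k (a k * phi q0) by rewrite RintegralZr// seeley_sum// mul1r.
have E2 : p 0 i * psi q0 = \int[mu]_k (a k * 8 ^+ k * (y ^+ 2 * psi q0)).
  by rewrite RintegralZr// seeley_sum1// y2; ring.
rewrite {1}E1 E2 /avg.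
have I12 := integrableB measurableT Iphi I1.
have I123 := integrableB measurableT I12 I2.
rewrite -(RintegralB measurableT Iphi I1) -(RintegralB measurableT I12 I2).
rewrite (le_trans (le_normr_Rintegral measurableT I123))//.
have Ibd := integrableZr measurableT (p 0 i ^+ 2) (integrableZl measurableT `|M| iab).
rewrite (@le_trans _ _ (\int[mu]_k (`|M| * `|a k * beta k ^+ 4| * p 0 i ^+ 2)))//.
  apply: le_Rintegral => //=.
  - exact: integrable_norm I123.
  - move=> k _; rewrite scale_coord_upd -beta_sqr.
    have := HM p (beta k * y); rewrite -/q0 => H.
    have -> : a k * phi (upd i (beta k * y) p) - a k * phi q0 -
        a k * beta k ^+ 2 * (y ^+ 2 * psi q0) =
      a k * (phi (upd i (beta k * y) p) - phi q0 - (beta k * y) ^+ 2 * psi q0) by ring.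
    rewrite normrM (le_trans (ler_wpM2l (normr_ge0 _) H))//.
    have -> : (beta k * y) ^+ 4 = beta k ^+ 4 * p 0 i ^+ 2.
      by rewrite exprMn (exprM y 2 2) y2 sqrrN.
    have b4 : 0 <= beta k ^+ 4 by rewrite exprn_ge0// sqrtr_ge0.
    rewrite normrM (ger0_norm b4) mulrCA [X in _ <= X](_ : _ = `|M| * (`|a k| * (beta k ^+ 4 * p 0 i ^+ 2))); last by ring.
    by rewrite ler_wpM2r ?ler_norm// mulr_ge0// mulr_ge0.
have -> : \int[mu]_k (`|M| * `|a k * beta k ^+ 4| * p 0 i ^+ 2) =
    `|M| * \int[mu]_k `|a k * beta k ^+ 4| * p 0 i ^+ 2.
  rewrite RintegralZr//; last exact: (integrableZl measurableT `|M| iab).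
  by rewrite RintegralZl.
by rewrite ler_wpM2r// lerDr.
Qed.

End SeeleyExtension.

Section WhitneyEven.
Context {R : realType} {n : nat} (i : 'I_n).
Implicit Types (phi psi : 'rV[R]_n -> R^o) (a : nat -> R) (p v : 'rV[R]_n).
Notation mu := (@counting nat R).

Lemma near_coord_gt0 p : 0 < p 0 i -> \forall q \near p, 0 < (q : 'rV[R]_n) 0 i.
Proof.
move=> p0; apply: (@cvgr_gt _ _ (nbhs p) _ (fun q : 'rV[R]_n => q 0 i) (p 0 i)) => //.
exact: coord_continuous.
Qed.

Lemma near_coord_lt0 p : p 0 i < 0 -> \forall q \near p, (q : 'rV[R]_n) 0 i < 0.
Proof.
move=> p0; apply: (@cvgr_lt _ _ (nbhs p) _ (fun q : 'rV[R]_n => q 0 i) (p 0 i)) => //.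
exact: coord_continuous.
Qed.

(** The partial derivatives of [seeley_ext]. Both branches are again extensions of even functions,
    which closes the induction in [Ck_seeley_ext]. *)
Definition seeley_ext_partial a phi psi p j : R^o :=
  if j == i then seeley_ext i (fun k => a k * - 8 ^+ k) psi p
  else seeley_ext i a (fun q => 'd phi q (delta_mx 0 j) : R^o) p.

Lemma is_diff_rowlin (f : 'rV[R]_n -> R^o) p (c c' : 'I_n -> R^o) :
  is_diff p f (rowlin c) -> (forall j, c j = c' j) -> is_diff p f (rowlin c').
Proof. by move=> H /funext <-. Qed.

(** Off the hyperplane the chain rule applies, the factor [1 / (2 sqrt u)] cancelling the [2 t] in
    the derivative of an even function. On the hyperplane the two-sided expansion in [u] is combined
    with Taylor's formula in the other coordinates. *)
Lemma seeley_ext_is_diff a phi psi p : seeley a -> csmooth phi ->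
  csmooth psi -> even_in i psi ->
  (forall p, 'd phi p (delta_mx 0 i) = 2 * p 0 i * psi p) ->
  is_diff p (seeley_ext i a phi) (rowlin (seeley_ext_partial a phi psi p)).
Proof.
move=> sa cphi cpsi epsi psiE; have wa := sa.1.
have [p0|p0|p0] := ltgtP (p 0 i) 0.
- pose chi := avg mu setT i beta a phi.
  have dchi q : differentiable chi q.
    by have [] := avg_is_diff measurableT i (measurable_nat beta) q wa cphi.
  have [d1 d2] := is_diff_upd_sqrtN p0 (dchi _).
  have E : \forall q \near p, chi (upd i (Num.sqrt (- (q : 'rV[R]_n) 0 i)) q) = seeley_ext i a phi q.
    by apply: filterS (near_coord_lt0 p0) => q q0; rewrite /seeley_ext leNgt q0.
  have := is_diff_near E d1; rewrite d2 => /is_diff_rowlin; apply => j.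
  set q := upd i _ p.
  have -> : 'd chi q (delta_mx 0 j) = avg mu setT i beta (fun k => a k * (if j == i then beta k else 1))
      (fun q => 'd phi q (delta_mx 0 j) : R^o) q.
    exact: diff_avg_delta.
  rewrite /seeley_ext_partial /seeley_ext leNgt p0 /= -/q.
  case: eqP => [->|_]; last first.
    by rewrite mul1r; congr avg; apply/funext => k; rewrite mulr1.
  rewrite (avg_even_derivative q wa cpsi psiE) updE eqxx mulrNN mulKf//.
  by rewrite mulf_neq0// gt_eqF// sqrtr_gt0 oppr_gt0.
- have dphi q := csmooth_differentiable q cphi.
  have [d1 d2] := is_diff_upd_sqrt p0 (dphi _).
  have E : \forall q \near p, phi (upd i (Num.sqrt ((q : 'rV[R]_n) 0 i)) q) = seeley_ext i a phi q.
    by apply: filterS (near_coord_gt0 p0) => q q0; rewrite /seeley_ext ltW.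
  have := is_diff_near E d1; rewrite d2 => /is_diff_rowlin; apply => j.
  rewrite /seeley_ext_partial /seeley_ext ltW//.
  case: eqP => [->|_]; last by rewrite mul1r.
  rewrite psiE updE eqxx mulKf//.
  by rewrite mulf_neq0// gt_eqF// sqrtr_gt0.
- have [K HK] := seeley_ext_expansion sa cphi cpsi epsi psiE.
  have [M HM] := csmooth_taylor2 cphi.
  have [L HL] := csmooth_lipschitz cpsi.
  have up : upd i 0 p = p by rewrite -p0 upd_id.
  have ext0 b f : seeley_ext i b f p = f p.
    by rewrite /seeley_ext p0 lexx sqrtr0 up.
  apply: (is_diff_quadratic (K := `|K| + `|M| + `|L|)) => h.
  have -> : rowlin (seeley_ext_partial a phi psi p) h =
      h 0 i * psi p + 'd phi p (upd i 0 h).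
    rewrite [X in _ = _ + X]linear_rowlin /rowlin (bigD1 i)//= [in RHS](bigD1 i)//=.
    rewrite updE eqxx scale0r add0r /seeley_ext_partial eqxx ext0; congr (_ + _).
    by apply: eq_bigr => j ji; rewrite updE (negbTE ji) ext0.
  have := HK (p + h); rewrite mxE p0 add0r ext0 => H1.
  have uph : upd i 0 (p + h) = p + upd i 0 h by rewrite -{1}[0]addr0 updD up.
  rewrite uph in H1; have H2 := HM p (upd i 0 h); have H3 := HL p (upd i 0 h).
  have n0 : `|upd i 0 h| <= `|h| := norm_upd0 i h.
  have hi : `|h 0 i| <= `|h| := coord_le_norm h i.
  have h2 : 0 <= `|h| ^+ 2 by exact: sqr_ge0.
  have B1 : K * h 0 i ^+ 2 <= `|K| * `|h| ^+ 2.
    rewrite (@le_trans _ _ (`|K| * h 0 i ^+ 2))// ?ler_wpM2r ?sqr_ge0 ?ler_norm//.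
    by rewrite ler_wpM2l// -real_normK ?num_real// ler_sqr ?nnegrE.
  have B2 : M * `|upd i 0 h| ^+ 2 <= `|M| * `|h| ^+ 2.
    rewrite (@le_trans _ _ (`|M| * `|upd i 0 h| ^+ 2))// ?ler_wpM2r ?sqr_ge0 ?ler_norm//.
    by rewrite ler_wpM2l// ler_sqr ?nnegrE.
  have B3 : `|h 0 i * (psi (p + upd i 0 h) - psi p)| <= `|L| * `|h| ^+ 2.
    rewrite normrM expr2 mulrCA ler_pM//.
    rewrite (le_trans H3)// (@le_trans _ _ (`|L| * `|upd i 0 h|))//.
      by rewrite ler_wpM2r// ler_norm.
    by rewrite ler_wpM2l.
  have -> : seeley_ext i a phi (p + h) - phi p - (h 0 i * psi p + 'd phi p (upd i 0 h)) =
    (seeley_ext i a phi (p + h) - phi (p + upd i 0 h) - h 0 i * psi (p + upd i 0 h)) +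
    (phi (p + upd i 0 h) - phi p - 'd phi p (upd i 0 h)) +
    h 0 i * (psi (p + upd i 0 h) - psi p) by ring.
  rewrite (le_trans (ler_normD _ _))// !mulrDl lerD// ?(le_trans H3)//.
  rewrite (le_trans (ler_normD _ _))// lerD//.
    exact: le_trans H1 B1.
  exact: le_trans H2 B2.
Qed.

Lemma Ck_seeley_ext k a phi : seeley a -> csmooth phi -> even_in i phi ->
  Ck_on k setT (seeley_ext i a phi).
Proof.
elim: k a phi => [|k IH] a phi sa cphi ephi;
  have [psi [cpsi epsi psiE]] := even_in_derivative cphi ephi;
  have D p := seeley_ext_is_diff p sa cphi cpsi epsi psiE.
  by move=> p _; apply: differentiable_continuous; have [] := D p.
split=> [p _|v]; first by have [] := D p.
have -> : (fun p => 'd (seeley_ext i a phi) p v) =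
    (fun p => \sum_j v 0 j *: seeley_ext_partial a phi psi p j).
  apply/funext => p; have [_ E] := D p.
  exact: (congr1 (@^~ v) E).
apply: Ck_on_sum; first exact: openT.
move=> j _; apply: Ck_onM; [exact: openT|exact: Ck_on_cst|].
rewrite /seeley_ext_partial; have [ji|ji] := eqVneq j i.
  by apply: IH => //; exact: seeley_next.
exact: (IH _ _ sa (csmooth_diff _ cphi) (even_in_partial ji cphi ephi)).
Qed.

Theorem whitney_even (f : 'rV[R]_n -> R^o) : smooth_germ f ->
  (\forall p \near (0 : 'rV[R]_n), f (scale_coord i (-1) p) = f p) ->
  exists2 g : 'rV[R]_n -> R^o, smooth_germ g &
    \forall p \near (0 : 'rV[R]_n), f p = g (upd i (p 0 i ^+ 2) p).
Proof.
move=> sf /nbhs_norm0P[s /= s0 Hs].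
have [r [cs r0 rs]] : exists r, [/\ csmooth (fun p => f p * bump r p : R^o), 0 < r & r < s].
  apply: (@filter_ex _ (0 : R)^'+); apply: filterS3 (csmooth_cutoff sf)
    (nbhs_right_gt (0 : R)) (nbhs_right_lt s0) => r; exact: And3.
have eb p : bump r (scale_coord i (-1) p) = bump r p.
  rewrite /bump; congr (flat_exp 0 (_ - _)); apply: eq_bigr => j _.
  by rewrite updE; case: eqP => [->|//]; rewrite mulN1r sqrrN.
have ecs : even_in i (fun p => f p * bump r p : R^o).
  move=> p; rewrite eb; have [pr|pr] := ltP `|p| r; last by rewrite bump_outside ?mulr0.
  by rewrite Hs//=; exact: lt_trans rs.
have [a sa] := @seeley_exists R.
(* The cutoff written in [u = t ^ 2]: this expression is smooth on both sides of [u = 0], so the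
   cutoff can be divided out of the extension. *)
pose Z (q : 'rV[R]_n) : R^o := flat_exp 0 (r ^+ 2 - \sum_(j | j != i) q 0 j ^+ 2 - q 0 i).
have sZ : smooth_germ Z.
  exists setT; split => //; first exact: openT.
  move=> k; apply: (@Ck_on_flat_exp _ _ k setT
    (fun q : 'rV[R]_n => r ^+ 2 - \sum_(j | j != i) q 0 j ^+ 2 - q 0 i)); first exact: openT.
  have Cp j : Ck_on k setT (fun q : 'rV[R]_n => q 0 j : R^o) by exact: (Ck_on_linear k setT (coordl j)).
  apply: Ck_onD; [exact: openT| |apply: Ck_onN; [exact: openT|exact: Cp]].
  apply: Ck_onD; [exact: openT|exact: Ck_on_cst|apply: Ck_onN; first exact: openT].
  apply: Ck_on_sum; first exact: openT.
  move=> j _; under eq_fun do rewrite expr2.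
  by apply: Ck_onM; [exact: openT|exact: Cp|exact: Cp].
have Z0 : Z 0 != 0.
  rewrite /Z big1 => [|j _]; last by rewrite mxE expr0n.
  rewrite mxE !subr0 /flat_exp exprn_gt0// expr0 mul1r gt_eqF// expR_gt0//.
have ZE p : Z (upd i (p 0 i ^+ 2) p) = bump r p.
  rewrite /Z /bump updE eqxx [in RHS](bigD1 i)//= opprD addrA [in RHS]addrAC.
  congr (flat_exp 0 (_ - _ - _)); apply: eq_bigr => j ji.
  by rewrite updE (negbTE ji).
exists (fun q => seeley_ext i a (fun p => f p * bump r p : R^o) q * (Z q)^-1 : R^o).
  apply: smooth_germM; last exact: smooth_germ_inv.
  by exists setT; split => //; [exact: openT|move=> k; exact: Ck_seeley_ext].
have : \forall p \near (0 : 'rV[R]_n), bump r p != 0.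
  have b0 : bump r (0 : 'rV[R]_n) != 0 by rewrite gt_eqF ?bump0_gt0.
  exact: (@cvgr_neq0 _ R^o _ (nbhs 0) _ _ (bump r 0) (smooth_germ_continuous0 (smooth_germ_bump r)) b0).
apply: filterS => p bp; rewrite ZE /seeley_ext updE eqxx sqr_ge0 updK sqrtr_sqr.
(* The square root of the square is the absolute value, and evenness takes care of the sign. *)
suff -> : f (upd i `|p 0 i| p) * bump r (upd i `|p 0 i| p) = f p * bump r p by rewrite mulfK.
have [pi0|pi0] := ger0P (p 0 i); first by rewrite upd_id.
by have := ecs p; rewrite /scale_coord mulN1r.
Qed.

End WhitneyEven.

(** * Normal form of the composition *)

Lemma near_all (T : topologicalType) (x : T) (P : T -> Prop) :
  (forall y, P y) -> \forall y \near x, P y.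
Proof. exact: nearW. Qed.

(** * Calculus of differentials at the origin *)

Section DerivativesAtZero.
Context {R : realType}.

Lemma smooth_germ_gt0 (V : normedModType R) (f : V -> R^o) : smooth_germ f -> 0 < f 0 ->
  \forall x \near (0 : V), 0 < f x.
Proof.
move=> sf f0.
exact: (@cvgr_gt _ _ (nbhs 0) _ f (f 0) (smooth_germ_continuous0 sf) _ f0).
Qed.

Lemma smooth_germ_neq0 (V : normedModType R) (f : V -> R^o) : smooth_germ f -> f 0 != 0 ->
  \forall x \near (0 : V), f x != 0.
Proof.
move=> sf f0; exact: (@cvgr_neq0 _ R^o _ (nbhs 0) _ f (f 0) (smooth_germ_continuous0 sf) f0).
Qed.

Lemma diff0_comp (V : normedModType R) m (W : normedModType R) (f : V -> 'rV[R]_m)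
    (g : 'rV[R]_m -> W) v : map_germ f -> smooth_germ g ->
  'd (g \o f) 0 v = 'd g 0 ('d f 0 v).
Proof.
move=> [sf f0] sg; have df := smooth_germ_differentiable0 sf.
have dg : differentiable g (f 0) by rewrite f0; exact: smooth_germ_differentiable0.
by have := congr1 (@^~ v) (diff_comp df dg); rewrite /= f0.
Qed.

Lemma diff0M (V : normedModType R) (f g : V -> R^o) v : smooth_germ f -> smooth_germ g ->
  'd (fun x => f x * g x : R^o) 0 v = f 0 * 'd g 0 v + g 0 * 'd f 0 v.
Proof.
move=> /smooth_germ_differentiable0 df /smooth_germ_differentiable0 dg.
exact: (congr1 (@^~ v) (diffM df dg)).
Qed.

Lemma diff0D (V W : normedModType R) (f g : V -> W) v : smooth_germ f -> smooth_germ g ->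
  'd (fun x => f x + g x) 0 v = 'd f 0 v + 'd g 0 v.
Proof.
move=> /smooth_germ_differentiable0 df /smooth_germ_differentiable0 dg.
exact: (congr1 (@^~ v) (diffD df dg)).
Qed.

Lemma diff0N (V W : normedModType R) (f : V -> W) v : smooth_germ f ->
  'd (fun x => - f x) 0 v = - 'd f 0 v.
Proof.
by move=> /smooth_germ_differentiable0 df; exact: (congr1 (@^~ v) (diffN df)).
Qed.

Lemma diff0_cst (V W : normedModType R) (a : W) (v : V) : 'd (fun _ : V => a) 0 v = 0.
Proof. exact: (congr1 (@^~ v) (@diff_cst _ V W a 0)). Qed.

Lemma diff_linear n (W : normedModType R) (L : {linear 'rV[R]_n -> W}) (x v : 'rV[R]_n) :
  'd L x v = L v.
Proof. exact: (congr1 (@^~ v) (diff_lin x (@linear_rV_continuous _ _ _ L))). Qed.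

Lemma diff_proj n (j : 'I_n) (x v : 'rV[R]_n) : 'd (fun q : 'rV[R]_n => q 0 j : R^o) x v = v 0 j.
Proof. exact: (diff_linear (coordl j)). Qed.

Lemma diff0_coord (V : normedModType R) n (f : V -> 'rV[R]_n) j v : smooth_germ f ->
  'd f 0 v 0 j = 'd (fun x => f x 0 j : R^o) 0 v.
Proof.
move=> /smooth_germ_differentiable0 df; have [_ d] := is_diff_coord j df.
exact: (esym (congr1 (@^~ v) d)).
Qed.

Lemma diff0_near (V W : normedModType R) (f g : V -> W) v : smooth_germ f ->
  (\forall x \near (0 : V), f x = g x) -> 'd g 0 v = 'd f 0 v.
Proof.
by move=> /smooth_germ_differentiable0 df fg; exact: (congr1 (@^~ v) (diff_near fg df)).
Qed.

Lemma diff0_vanishing_mul (V : normedModType R) (f g : V -> R^o) v :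
  smooth_germ f -> smooth_germ g -> f 0 = 0 ->
  'd (fun x => f x * g x : R^o) 0 v = g 0 * 'd f 0 v.
Proof.
move=> sf sg f0; apply: (etrans (diff0M v sf sg)).
by rewrite f0 mul0r add0r.
Qed.

End DerivativesAtZero.

Section DiffeoGerms.
Context {R : realType}.

Lemma map_germ_id n : map_germ (id : 'rV[R]_n -> 'rV[R]_n).
Proof. exact: (map_germ_linear (idfun : {linear 'rV[R]_n -> 'rV[R]_n})). Qed.

Lemma diffeo_germ_comp n (d1 d2 : 'rV[R]_n -> 'rV[R]_n) :
  diffeo_germ d1 -> diffeo_germ d2 -> diffeo_germ (d2 \o d1).
Proof.
move=> [m1 [e1 [me1 ed1 de1]]] [m2 [e2 [me2 ed2 de2]]].
split; first exact: map_germ_comp.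
exists (e1 \o e2); split; first exact: map_germ_comp.
- by apply: filterS2 ed1 (near_comp m1 ed2) => x /= H1 ->.
- by apply: filterS2 de2 (near_comp me2 de1) => y /= H1 ->.
Qed.

Lemma A_equiv_trans m n (f g h : 'rV[R]_m -> 'rV[R]_n) : map_germ f ->
  A_equiv f g -> A_equiv g h -> A_equiv f h.
Proof.
move=> mf [s1 [t1 [ds1 dt1 E1]]] [s2 [t2 [ds2 dt2 E2]]].
exists (s2 \o s1), (t2 \o t1); split; [exact: diffeo_germ_comp|exact: diffeo_germ_comp|].
by apply: filterS2 E1 (near_comp ds1.1 E2) => x /= -> ->.
Qed.

Lemma cancel_diff0 m n (d : 'rV[R]_n -> 'rV[R]_m) (e : 'rV[R]_m -> 'rV[R]_n) v : map_germ d -> map_germ e ->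
  (\forall x \near (0 : 'rV[R]_n), e (d x) = x) -> 'd e 0 ('d d 0 v) = v.
Proof.
move=> md me ed; rewrite -(diff0_comp v md me.1).
rewrite -[RHS](diff_linear (idfun : {linear 'rV[R]_n -> 'rV[R]_n}) 0 v).
apply: diff0_near; first exact: (map_germ_id n).1.
by apply: filterS ed => x /= ->.
Qed.

Lemma diffeo_germ_diff_inj n (d : 'rV[R]_n -> 'rV[R]_n) : diffeo_germ d ->
  forall v, 'd d 0 v = 0 -> v = 0.
Proof.
move=> [md [e [me ed _]]] v dv.
apply: (etrans (esym (cancel_diff0 v md me ed))).
by apply: (etrans (congr1 ('d e 0) dv)); exact: linear0.
Qed.

End DiffeoGerms.

Section LowDimensionalRows.
Context {R : realType}.

Definition vec2 (a b : R) : 'rV[R]_2 := \row_i tnth [tuple a; b] i.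

Lemma vec2_0 a b : vec2 a b 0 0 = a. Proof. by rewrite mxE. Qed.
Lemma vec2_1 a b : vec2 a b 0 1 = b. Proof. by rewrite mxE. Qed.
Lemma vec3_0 a b c : vec3 a b c 0 0 = a :> R. Proof. by rewrite mxE. Qed.
Lemma vec3_1 a b c : vec3 a b c 0 1 = b :> R. Proof. by rewrite mxE. Qed.
Lemma vec3_2 a b c : vec3 a b c 0 2%:R = c :> R. Proof. by rewrite mxE. Qed.

Definition vecE := (vec2_0, vec2_1, vec3_0, vec3_1, vec3_2).

Lemma row2P (u v : 'rV[R]_2) : u 0 0 = v 0 0 -> u 0 1 = v 0 1 -> u = v.
Proof.
move=> h0 h1; apply/rowP => -[[|[|//]] lt]; first by rewrite (_ : Ordinal lt = 0)//; exact: val_inj.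
by rewrite (_ : Ordinal lt = 1)//; exact: val_inj.
Qed.

Lemma row3P (u v : 'rV[R]_3) : u 0 0 = v 0 0 -> u 0 1 = v 0 1 ->
  u 0 2%:R = v 0 2%:R -> u = v.
Proof.
move=> h0 h1 h2; apply/rowP => -[[|[|[|//]]] lt].
- by rewrite (_ : Ordinal lt = 0)//; exact: val_inj.
- by rewrite (_ : Ordinal lt = 1)//; exact: val_inj.
- by rewrite (_ : Ordinal lt = 2%:R)//; exact: val_inj.
Qed.

Lemma smooth_germ_vec2 m (a b : 'rV[R]_m -> R^o) :
  smooth_germ a -> smooth_germ b -> smooth_germ (fun x => vec2 (a x) (b x)).
Proof.
move=> sa sb; apply: smooth_germ_row => -[[|[|//]] lt].
- by under eq_fun do rewrite mxE (tnth_nth 0) /=.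
- by under eq_fun do rewrite mxE (tnth_nth 0) /=.
Qed.

Lemma smooth_germ_vec3 m (a b c : 'rV[R]_m -> R^o) :
  smooth_germ a -> smooth_germ b -> smooth_germ c ->
  smooth_germ (fun x => vec3 (a x) (b x) (c x)).
Proof.
move=> sa sb sc; apply: smooth_germ_row => -[[|[|[|//]]] lt].
- by under eq_fun do rewrite mxE (tnth_nth 0) /=.
- by under eq_fun do rewrite mxE (tnth_nth 0) /=.
- by under eq_fun do rewrite mxE (tnth_nth 0) /=.
Qed.

Lemma diff0_vec2 m (a b : 'rV[R]_m -> R^o) v : smooth_germ a -> smooth_germ b ->
  'd (fun x => vec2 (a x) (b x)) 0 v = vec2 ('d a 0 v) ('d b 0 v).
Proof.
move=> sa sb; have s := smooth_germ_vec2 sa sb.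
have d (j : 'I_2) (f : 'rV[R]_m -> R^o) : (fun x => vec2 (a x) (b x) 0 j : R^o) = f ->
    'd (fun x => vec2 (a x) (b x)) 0 v 0 j = 'd f 0 v.
  by move=> <-; exact: (diff0_coord j v s).
apply: row2P; rewrite vecE.
- by apply: (d 0 a); apply/funext => x; rewrite vecE.
- by apply: (d 1 b); apply/funext => x; rewrite vecE.
Qed.

Lemma diff0_vec3 m (a b c : 'rV[R]_m -> R^o) v :
  smooth_germ a -> smooth_germ b -> smooth_germ c ->
  'd (fun x => vec3 (a x) (b x) (c x)) 0 v = vec3 ('d a 0 v) ('d b 0 v) ('d c 0 v).
Proof.
move=> sa sb sc; have s := smooth_germ_vec3 sa sb sc.
have d (j : 'I_3) (f : 'rV[R]_m -> R^o) : (fun x => vec3 (a x) (b x) (c x) 0 j : R^o) = f ->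
    'd (fun x => vec3 (a x) (b x) (c x)) 0 v 0 j = 'd f 0 v.
  by move=> <-; exact: (diff0_coord j v s).
apply: row3P; rewrite vecE.
- by apply: (d 0 a); apply/funext => x; rewrite vecE.
- by apply: (d 1 b); apply/funext => x; rewrite vecE.
- by apply: (d 2%:R c); apply/funext => x; rewrite vecE.
Qed.

End LowDimensionalRows.

Section EvenOddSplitting.
Context {R : realType} {n : nat} (i : 'I_n).

(** The odd part is divisible by the coordinate, with an even quotient; Whitney's theorem applies to
    this quotient and to the even part. *)
Lemma whitney_split (f : 'rV[R]_n -> R^o) : smooth_germ f ->
  exists g h : 'rV[R]_n -> R^o, [/\ smooth_germ g, smooth_germ h &
    \forall p \near (0 : 'rV[R]_n),
      f p = g (upd i (p 0 i ^+ 2) p) + p 0 i * h (upd i (p 0 i ^+ 2) p)].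
Proof.
move=> sf; pose s : {linear 'rV[R]_n -> 'rV[R]_n} := scale_coord i (-1).
have ms : map_germ s := map_germ_linear s.
have ss p : s (s p) = p.
  by rewrite /s /= scale_coord_upd mulN1r mulN1r opprK upd_id.
have sfs : smooth_germ (f \o s) by exact: smooth_germ_comp.
pose fe p : R^o := 2^-1 * (f p + f (s p)).
pose fo p : R^o := 2^-1 * (f p - f (s p)).
have sc : smooth_germ (fun _ : 'rV[R]_n => 2^-1 : R^o) by exact: smooth_germ_cst.
have sfe : smooth_germ fe by apply: smooth_germM sc _; exact: smooth_germD.
have sfo : smooth_germ fo by apply: smooth_germM sc _; exact: smooth_germB.
have [|g sg gE] := whitney_even (i := i) sfe.
  by apply: near_all => p; rewrite -/(s p) /fe ss addrC.
have [|k sk kE] := hadamard_germ (i := i) sfo.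
  apply: near_all => p; rewrite /fo (_ : s (upd i 0 p) = upd i 0 p) ?subrr ?mulr0//.
  by rewrite /s /= scale_coord_upd mulr0.
have [|h sh hE] := whitney_even (i := i) sk.
  have kEs : \forall p \near (0 : 'rV[R]_n), fo (s p) = (s p) 0 i * k (s p) by exact: near_comp ms kE.
  apply: filterS2 kE kEs => p E1 E2.
  have [p0|p0] := eqVneq (p 0 i) 0.
    by rewrite /scale_coord p0 mulr0 -p0 upd_id.
  have E3 : fo (s p) = - fo p by rewrite /fo ss -mulrN opprB.
  apply: (mulfI p0); apply: oppr_inj; rewrite -E1 -E3 E2 -mulNr; congr (_ * _).
  by rewrite updE eqxx mulN1r.
exists g, h; split => //.
apply: filterS3 gE kE hE => p E1 E2 E3.
rewrite -E1 -E3 -E2 /fe /fo; lra.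
Qed.

End EvenOddSplitting.

Section Lifting.
Context {R : realType}.

(** The image of [inc] is the limiting tangent plane at 0 of the model cuspidal edge. *)
Definition inc (v : 'rV[R]_2) : 'rV[R]_3 := vec3 (v 0 0) (v 0 1) 0.
Definition prj (q : 'rV[R]_3) : 'rV[R]_2 := vec2 (q 0 0) (q 0 1).

Lemma inc_is_linear : linear inc.
Proof. by move=> a u v; apply: row3P; rewrite mxE [in RHS]mxE !vecE ?mxE// mulr0 addr0. Qed.

Lemma prj_is_linear : linear prj.
Proof. by move=> a u v; apply: row2P; rewrite mxE [in RHS]mxE !vecE !mxE. Qed.

HB.instance Definition _ := GRing.isLinear.Build R 'rV[R]_2 'rV[R]_3 *:%R inc inc_is_linear.
HB.instance Definition _ := GRing.isLinear.Build R 'rV[R]_3 'rV[R]_2 *:%R prj prj_is_linear.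

Lemma map_germ_inc : map_germ inc. Proof. exact: (map_germ_linear inc). Qed.
Lemma map_germ_prj : map_germ prj. Proof. exact: (map_germ_linear prj). Qed.

Lemma incK v : prj (inc v) = v.
Proof. by apply: row2P; rewrite !vecE. Qed.

Lemma inc_prj (q : 'rV[R]_3) : q 0 2%:R = 0 -> inc (prj q) = q.
Proof. by move=> q2; apply: row3P; rewrite !vecE. Qed.

Lemma inc_prj_upd q : inc (prj q) = upd 2%:R 0 q.
Proof. by apply: row3P; rewrite updE !vecE. Qed.

(** A change of the first two coordinates that may depend on the third, made into a map of the whole
    space. *)
Definition lift_map (N : 'rV[R]_3 -> 'rV[R]_2) (q : 'rV[R]_3) : 'rV[R]_3 :=
  vec3 (N q 0 0) (N q 0 1) (q 0 2%:R).

Lemma map_germ_lift N : map_germ N -> map_germ (lift_map N).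
Proof.
move=> [sN N0]; split.
  by apply: smooth_germ_vec3; [exact: smooth_germ_coord|exact: smooth_germ_coord|exact: smooth_germ_proj].
by apply: row3P; rewrite /lift_map vecE ?N0 !mxE.
Qed.

Lemma diff0_lift N (v : 'rV[R]_3) : map_germ N ->
  'd (lift_map N) 0 v = vec3 ('d N 0 v 0 0) ('d N 0 v 0 1) (v 0 2%:R).
Proof.
move=> [sN _].
apply: (etrans (diff0_vec3 v (smooth_germ_coord 0 sN) (smooth_germ_coord 1 sN) (smooth_germ_proj 2%:R))).
apply: row3P; rewrite !vecE.
- exact: (esym (diff0_coord 0 v sN)).
- exact: (esym (diff0_coord 1 v sN)).
- exact: diff_proj.
Qed.

Lemma diffeo_germ_lift N : map_germ N ->
  (forall v : 'rV[R]_3, v 0 2%:R = 0 -> 'd N 0 v = 0 -> v = 0) -> diffeo_germ (lift_map N).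
Proof.
move=> mN H; apply: inverse_function_germ; first exact: map_germ_lift.
move=> v /(etrans (esym (diff0_lift v mN))) E.
have E0 := congr1 (fun w : 'rV[R]_3 => w 0 0) E.
have E1 := congr1 (fun w : 'rV[R]_3 => w 0 1) E.
have E2 := congr1 (fun w : 'rV[R]_3 => w 0 2%:R) E.
rewrite /= !vecE !mxE in E0 E1 E2.
by apply: H => //; apply: row2P; rewrite ?E0 ?E1 mxE.
Qed.

(** Functions of [(x, t ^ 2)] are those composed with [fold2]. *)
Definition fold2 (x : 'rV[R]_2) : 'rV[R]_2 := upd 1 (x 0 1 ^+ 2) x.

Lemma fold2_0 (x : 'rV[R]_2) : fold2 x 0 0 = x 0 0. Proof. by rewrite updE. Qed.
Lemma fold2_1 (x : 'rV[R]_2) : fold2 x 0 1 = x 0 1 ^+ 2. Proof. by rewrite updE. Qed.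

Lemma map_germ_fold2 : map_germ fold2.
Proof.
split; last by rewrite /fold2 mxE expr0n /= upd0.
have -> : fold2 = fun x => vec2 (x 0 0) (x 0 1 ^+ 2).
  by apply/funext => x; apply: row2P; rewrite vecE ?fold2_0 ?fold2_1.
by apply: smooth_germ_vec2; [|apply: smooth_germX]; exact: smooth_germ_proj.
Qed.

Lemma map_germ_cuspidal_edge : map_germ (@cuspidal_edge R).
Proof.
split; last by apply: row3P; rewrite /cuspidal_edge vecE !mxE ?expr0n.
apply: smooth_germ_vec3; first exact: smooth_germ_proj.
- by apply: smooth_germX; exact: smooth_germ_proj.
- by apply: smooth_germX; exact: smooth_germ_proj.
Qed.

Lemma map_germ_fold_map : map_germ (@fold_map R).
Proof.
split; last by apply: row3P; rewrite /fold_map vecE !mxE ?expr0n.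
apply: smooth_germ_vec3; [exact: smooth_germ_proj|exact: smooth_germ_proj|].
by apply: smooth_germX; exact: smooth_germ_proj.
Qed.

End Lifting.

Section NormalForm.
Context {R : realType} (Phi : 'rV[R]_3 -> 'rV[R]_3).

Definition cuspidal_height (p b : 'rV[R]_2 -> R^o) (x : 'rV[R]_2) : R^o :=
  p (fold2 x) + x 0 1 ^+ 3 * b (fold2 x).

(** The hypothesis on [prj] is what (A) provides. The last two conclusions record the values of [p]
    on the first axis, which govern the contact in (C), and its differential at 0, on which (B)
    bears. *)
Lemma cuspidal_normal_form : diffeo_germ Phi ->
  (forall v, prj ('d Phi 0 (inc v)) = 0 -> v = 0) ->
  exists (s : 'rV[R]_2 -> 'rV[R]_2) (p b : 'rV[R]_2 -> R^o),
    [/\ diffeo_germ s, smooth_germ p, smooth_germ b & b 0 != 0] /\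
    [/\ A_equiv (fold_map \o (Phi \o cuspidal_edge))
          (fun x => vec3 (x 0 0) (x 0 1 ^+ 2) (cuspidal_height p b x ^+ 2)),
        \forall x \near (0 : 'rV[R]_2),
          Phi (cuspidal_edge x) 0 2%:R = cuspidal_height p b (s x),
        forall v, p (upd 1 0 v) = Phi (inc (upd 1 0 v)) 0 2%:R &
        forall v, 'd p 0 v = 'd Phi 0 (inc v) 0 2%:R].
Proof.
move=> dPhi tr; have mPhi := dPhi.1.
have minc := @map_germ_inc R; have mprj := @map_germ_prj R.
have mce := @map_germ_cuspidal_edge R.
pose Theta := prj \o Phi \o inc.
have mPi : map_germ (Phi \o inc) by exact: map_germ_comp.
have mpP : map_germ (prj \o Phi) by exact: map_germ_comp.
have mTheta : map_germ Theta by exact: (map_germ_comp mPi mprj).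
have dTheta v : 'd Theta 0 v = prj ('d Phi 0 (inc v)).
  apply: (etrans (diff0_comp v mPi mprj.1)).
  apply: (etrans (diff_linear (prj : {linear _ -> _}) 0 _)); congr prj.
  apply: (etrans (diff0_comp v minc mPhi.1)); congr ('d Phi 0 _).
  exact: diff_linear.
have fTheta : diffeo_germ Theta.
  by apply: inverse_function_germ => // v; rewrite dTheta; exact: tr.
have [_ [Ti [mTi TiK TKi]]] := fTheta.
have fTi : diffeo_germ Ti by split => //; exists Theta.
(* [M] is normalized so as to invert [inc]; it then differs from [prj] by multiples of the third
   coordinate, which is [t ^ 3] on the cuspidal edge. *)
pose M := Ti \o (prj \o Phi).
have mM : map_germ M by exact: map_germ_comp.
have MincE : \forall x \near (0 : 'rV[R]_2), M (inc x) = x by exact: TiK.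
have dMinc v : 'd M 0 (inc v) = v.
  apply: (etrans _ (cancel_diff0 v minc mM MincE)); congr ('d M 0 _).
  by apply/esym; exact: diff_linear.
pose La := lift_map M.
have mLa : map_germ La by exact: map_germ_lift.
have fLa : diffeo_germ La.
  apply: diffeo_germ_lift => // v v2 dv.
  have /esym E := inc_prj v2; have := dMinc (prj v); rewrite -E dv => pv.
  by rewrite E -pv linear0.
have [_ [Li [mLi LiK LKi]]] := fLa.
have LaincE : \forall x \near (0 : 'rV[R]_2), La (inc x) = inc x.
  by apply: filterS MincE => x E; apply: row3P; rewrite /La /lift_map E !vecE.
have nearprj : \forall q \near (0 : 'rV[R]_3), M (inc (prj q)) = prj q by exact: (near_comp mprj MincE).
have hadM (j : 'I_2) (j' : 'I_3) : (forall q : 'rV[R]_3, prj q 0 j = q 0 j') -> j' != 2%:R -> exists2 A : 'rV[R]_3 -> R^o, smooth_germ A &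
    \forall q \near (0 : 'rV[R]_3), M q 0 j = q 0 j' + q 0 2%:R * A q.
  move=> Ej j2.
  have sf : smooth_germ (fun q : 'rV[R]_3 => M q 0 j - q 0 j' : R^o).
    by apply: smooth_germB; [exact: smooth_germ_coord j mM.1|exact: smooth_germ_proj].
  have [|A sA AE] := hadamard_germ (i := 2%:R) sf.
    apply: filterS nearprj => q E.
    have -> : M (upd 2%:R 0 q) = prj q by rewrite -inc_prj_upd.
    apply/eqP; rewrite subr_eq0; apply/eqP; apply: (etrans (Ej q)).
    by rewrite updE (negbTE j2).
  by exists A => //; apply: filterS AE => q <-; rewrite addrC subrK.
have [A sA AE] := hadM 0 0 (fun q => vec2_0 _ _) isT.
have [B sB BE] := hadM 1 1 (fun q => vec2_1 _ _) isT.
have sAc : smooth_germ (A \o cuspidal_edge) by exact: smooth_germ_comp.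
have sBc : smooth_germ (B \o cuspidal_edge) by exact: smooth_germ_comp.
have sx0 : smooth_germ (fun x : 'rV[R]_2 => x 0 0 : R^o) by exact: smooth_germ_proj.
have sx1 : smooth_germ (fun x : 'rV[R]_2 => x 0 1 : R^o) by exact: smooth_germ_proj.
(* On the cuspidal edge the second component of [M] is [t ^ 2 + t ^ 3 * B = t ^ 2 * w], the square
   of the new source coordinate [t * sqrt w]. *)
pose w (x : 'rV[R]_2) : R^o := 1 + x 0 1 * B (cuspidal_edge x).
have sw : smooth_germ w by apply: smooth_germD; [exact: smooth_germ_cst|exact: smooth_germM].
have w0 : w 0 = 1 by rewrite /w mxE mul0r addr0.
pose rho (x : 'rV[R]_2) : R^o := w x `^ 2^-1.
have srho : smooth_germ rho by apply: smooth_germ_powR; rewrite ?w0.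
have rho0 : rho 0 = 1 by rewrite /rho w0 powR1.
have w_gt0 : \forall x \near (0 : 'rV[R]_2), 0 < w x.
  by apply: smooth_germ_gt0 => //; rewrite w0.
pose s (x : 'rV[R]_2) : 'rV[R]_2 := vec2 (x 0 0 + x 0 1 ^+ 3 * A (cuspidal_edge x)) (x 0 1 * rho x).
have ss0 : smooth_germ (fun x : 'rV[R]_2 => x 0 0 + x 0 1 ^+ 3 * A (cuspidal_edge x) : R^o).
  by apply: smooth_germD => //; apply: smooth_germM => //; exact: smooth_germX.
have ss1 : smooth_germ (fun x : 'rV[R]_2 => x 0 1 * rho x : R^o) by exact: smooth_germM.
have ms : map_germ s.
  split; first exact: smooth_germ_vec2.
  by apply: row2P; rewrite /s vecE !mxE ?expr0n /= !mul0r// addr0.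
have ds v : 'd s 0 v = v.
  apply: (etrans (diff0_vec2 v ss0 ss1)); apply: row2P; rewrite vecE.
    have sf : smooth_germ (fun x : 'rV[R]_2 => x 0 1 ^+ 2 * A (cuspidal_edge x) : R^o).
      by apply: smooth_germM => //; exact: smooth_germX.
    have -> : (fun x : 'rV[R]_2 => x 0 0 + x 0 1 ^+ 3 * A (cuspidal_edge x) : R^o) =
        (fun x : 'rV[R]_2 => x 0 0 + x 0 1 * (x 0 1 ^+ 2 * A (cuspidal_edge x)) : R^o).
      by apply/funext => x; rewrite exprS mulrA.
    apply: (etrans (diff0D v sx0 (smooth_germM sx1 sf))).
    apply: (etrans (congr2 +%R (diff_proj 0 0 v) (diff0_vanishing_mul v sx1 sf (mxE _ _ _ _)))).
    by rewrite mxE expr0n /= mul0r mul0r addr0.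
  apply: (etrans (diff0_vanishing_mul v sx1 srho (mxE _ _ _ _))).
  by rewrite rho0 mul1r diff_proj.
have fs : diffeo_germ s by apply: inverse_function_germ => // v; rewrite ds.
have [_ [si [msi siK sKi]]] := fs.
have ME : \forall x \near (0 : 'rV[R]_2), M (cuspidal_edge x) = fold2 (s x).
  apply: filterS3 (near_comp mce AE) (near_comp mce BE) w_gt0 => x EA EB wx.
  apply: row2P; rewrite ?EA ?EB ?fold2_0 ?fold2_1 /s !vecE//.
  rewrite exprMn /rho powR12_sqrt ?ltW// sqr_sqrtr ?ltW// /w; ring.
(* The third component of [Phi] in the coordinates [La]. Its restriction to the plane of [inc] gives
   the main part of [p], the rest being divisible by the third coordinate. *)
pose F3 q : R^o := Phi (Li q) 0 2%:R.
have mPLi : map_germ (Phi \o Li) by exact: map_germ_comp.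
have sF3 : smooth_germ F3 by exact: smooth_germ_coord 2%:R mPLi.1.
have F3inc : \forall y \near (0 : 'rV[R]_2), F3 (inc y) = Phi (inc y) 0 2%:R.
  apply: filterS2 LaincE (near_comp minc LiK) => y E1 E2.
  by rewrite /F3 -{1}E1 E2.
have mupd := @map_germ_upd0 R 3 2%:R.
pose F q : R^o := F3 q - F3 (upd 2%:R 0 q).
have sF3u : smooth_germ (F3 \o upd 2%:R 0) by exact: smooth_germ_comp.
have sF : smooth_germ F by exact: smooth_germB.
have [|P sP PE] := hadamard_germ (i := 2%:R) sF.
  by apply: near_all => q; rewrite /F updK subrr.
have e2 : (delta_mx 0 2%:R : 'rV[R]_3) 0 2%:R = 1 by rewrite mxE !eqxx.
(* If [P 0] vanished, all three components of ['d Phi 0] would kill the direction that ['d La 0]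
   sends to the third axis. *)
have P0 : P 0 != 0.
  have pE : 'd F 0 (delta_mx 0 2%:R) = P 0.
    have sq2 : smooth_germ (fun q : 'rV[R]_3 => q 0 2%:R : R^o) by exact: smooth_germ_proj.
    have PE' : \forall q \near (0 : 'rV[R]_3), (q : 'rV[R]_3) 0 2%:R * P q = F q by apply: filterS PE => q ->.
    apply: (etrans (diff0_near _ (smooth_germM sq2 sP) PE')).
    apply: (etrans (diff0_vanishing_mul _ sq2 sP (mxE _ _ _ _))).
    apply: (etrans (congr1 ( *%R (P 0)) (diff_proj _ _ _))).
    by rewrite e2 mulr1.
  have dF : 'd F 0 (delta_mx 0 2%:R) = 'd F3 0 (delta_mx 0 2%:R).
    apply: (etrans (diff0D _ sF3 (smooth_germN sF3u))).
    have Z : 'd (F3 \o upd 2%:R 0) 0 (delta_mx 0 2%:R) = 0.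
      apply: (etrans (diff0_comp _ mupd sF3)).
      have -> : 'd (upd 2%:R 0 : 'rV[R]_3 -> 'rV[R]_3) 0 (delta_mx 0 2%:R) = 0; last exact: linear0.
      have -> : (upd 2%:R 0 : 'rV[R]_3 -> 'rV[R]_3) = scale_coord 2%:R 0.
        by apply/funext => q; rewrite /scale_coord mul0r.
      apply: (etrans (diff_linear _ _ _)); apply: (etrans (scale_delta _ _ _)).
      by rewrite eqxx scale0r.
    apply: (etrans (congr1 (fun z : R => _ + z) (etrans (diff0N _ sF3u) (congr1 -%R Z)))).
    by rewrite oppr0 addr0.
  rewrite -pE dF; apply/negP => /eqP F30.
  pose u := 'd Li 0 (delta_mx 0 2%:R) : 'rV[R]_3.
  have LaE : 'd La 0 u = delta_mx 0 2%:R by exact: cancel_diff0 mLi mLa LKi.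
  have lE := etrans (esym (diff0_lift u mM)) LaE.
  have E0 := congr1 (fun q : 'rV[R]_3 => q 0 0) lE.
  have E1 := congr1 (fun q : 'rV[R]_3 => q 0 1) lE.
  have E2 := congr1 (fun q : 'rV[R]_3 => q 0 2%:R) lE.
  rewrite /= !vecE !mxE /= in E0 E1 E2.
  have dM0 : 'd M 0 u = 0 by apply: row2P; rewrite ?E0 ?E1 mxE.
  have dpP : 'd (prj \o Phi) 0 u = 0.
    apply: (diffeo_germ_diff_inj fTi).
    exact: etrans (esym (diff0_comp u mpP mTi.1)) dM0.
  have prjE : prj ('d Phi 0 u) = 0.
    apply: (etrans _ dpP); apply/esym; apply: (etrans (diff0_comp u mPhi mprj.1)).
    exact: diff_linear.
  have third : 'd Phi 0 u 0 2%:R = 0.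
    apply: (etrans _ F30); apply: (etrans _ (diff0_coord 2%:R _ mPLi.1)).
    by apply: (congr1 (fun q : 'rV[R]_3 => q 0 2%:R)); exact: (esym (diff0_comp _ mLi mPhi.1)).
  have : 'd Phi 0 u = 0.
    by rewrite -(inc_prj third) prjE linear0.
  move=> /(diffeo_germ_diff_inj dPhi) u0.
  by move: E2; rewrite u0 mxE => /eqP; rewrite eq_sym oner_eq0.
have mLac : map_germ (La \o cuspidal_edge) by exact: map_germ_comp.
(* Replacing [t] by the new coordinate [t * rho] turns [t ^ 3] into its cube divided by
   [rho ^ 3]. *)
pose psih x : R^o := (rho x ^+ 3)^-1 * P (La (cuspidal_edge x)).
have rho30 : rho 0 ^+ 3 != 0 by rewrite rho0 expr1n oner_eq0.
have spsih : smooth_germ psih.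
  apply: smooth_germM; last exact: (smooth_germ_comp mLac sP).
  by apply: smooth_germ_inv => //; exact: smooth_germX.
have spsi : smooth_germ (psih \o si) by exact: smooth_germ_comp.
have [b [beta [sb sbeta psiE]]] := whitney_split 1 spsi.
pose p0 y : R^o := Phi (inc y) 0 2%:R.
have sp0 : smooth_germ p0 by exact: smooth_germ_coord 2%:R mPi.1.
(* The odd part [beta] comes with the fourth power of the new coordinate, a function of its square,
   and so joins [p]; being of second order in [y 0 1], it alters neither the values on the first
   axis nor the differential at 0. *)
pose p y : R^o := p0 y + y 0 1 * (y 0 1 * beta y).
have syb : smooth_germ (fun y : 'rV[R]_2 => y 0 1 * beta y : R^o) by exact: smooth_germM.
have syyb : smooth_germ (fun y : 'rV[R]_2 => y 0 1 * (y 0 1 * beta y) : R^o) by exact: smooth_germM.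
have sp : smooth_germ p by exact: smooth_germD.
have b0 : b 0 != 0.
  have := nbhs_singleton psiE; rewrite /= mxE expr0n /= upd0 mul0r addr0 => <-.
  rewrite msi.2 /psih mulf_neq0 ?invr_neq0//.
  by rewrite (_ : La _ = 0)//; exact: mLac.2.
have heightE : \forall x \near (0 : 'rV[R]_2),
    Phi (cuspidal_edge x) 0 2%:R = cuspidal_height p b (s x).
  have N1 := near_comp mLac PE.
  have N2 := near_comp mce LiK.
  have N3 : \forall x \near (0 : 'rV[R]_2), F3 (inc (fold2 (s x))) = p0 (fold2 (s x)).
    exact: (near_comp ms (near_comp (@map_germ_fold2 R) F3inc)).
  have N4 := near_comp ms psiE.
  near=> x.
  have H1 : F (La (cuspidal_edge x)) = La (cuspidal_edge x) 0 2%:R * P (La (cuspidal_edge x)) by near: x.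
  have H2 : Li (La (cuspidal_edge x)) = cuspidal_edge x by near: x.
  have H3 : F3 (inc (fold2 (s x))) = p0 (fold2 (s x)) by near: x.
  have H4 : psih (si (s x)) = b (fold2 (s x)) + s x 0 1 * beta (fold2 (s x)) by near: x.
  have H5 : si (s x) = x by near: x.
  have H6 : M (cuspidal_edge x) = fold2 (s x) by near: x.
  have H7 : 0 < w x by near: x.
  rewrite H5 in H4.
  have H8 : upd 2%:R 0 (La (cuspidal_edge x)) = inc (fold2 (s x)).
    by rewrite -inc_prj_upd -H6; congr inc; apply: row2P; rewrite !vecE.
  rewrite /F H8 H3 in H1.
  have -> : Phi (cuspidal_edge x) 0 2%:R = F3 (La (cuspidal_edge x)) by rewrite /F3 H2.
  have rx : rho x != 0 by rewrite gt_eqF// powR_gt0.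
  have H9 : P (La (cuspidal_edge x)) = rho x ^+ 3 * psih x.
    by rewrite /psih mulVKf// expf_neq0.
  have H10 : La (cuspidal_edge x) 0 2%:R = x 0 1 ^+ 3 by rewrite !vecE.
  have H11 : s x 0 1 = x 0 1 * rho x by rewrite vecE.
  move/eqP: H1; rewrite subr_eq H10 H9 H4 => /eqP ->.
  rewrite /cuspidal_height /p fold2_1 H11; ring.
exists s, p, b; split; split => //.
(* The fold keeps the first two components, so [Ti] can be applied to them in the target. *)
- pose T := lift_map (Ti \o prj).
  have mTp : map_germ (Ti \o prj) by exact: map_germ_comp.
  have fT : diffeo_germ T.
    apply: diffeo_germ_lift => // v v2 dv.
    have E : 'd Ti 0 (prj v) = 0.
      apply: (etrans _ dv); apply/esym; apply: (etrans (diff0_comp v mprj mTi.1)).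
      by congr ('d Ti 0 _); exact: diff_linear.
    have pv := diffeo_germ_diff_inj fTi E.
    by rewrite -(inc_prj v2) pv linear0.
  exists s, T; split => //.
  apply: filterS2 heightE ME => x E1 E2.
  have E3 : Ti (prj (fold_map (Phi (cuspidal_edge x)))) = fold2 (s x).
    by rewrite -E2 /M /=; congr Ti; apply: row2P; rewrite !vecE.
  have TE : T (fold_map (Phi (cuspidal_edge x))) =
      vec3 (fold2 (s x) 0 0) (fold2 (s x) 0 1) (Phi (cuspidal_edge x) 0 2%:R ^+ 2).
    by rewrite /T /lift_map /comp E3 vec3_2.
  by rewrite /= TE E1 fold2_0 fold2_1.
- by move=> v; rewrite /p updE eqxx mul0r addr0.
- move=> v; apply: (etrans (diff0D v sp0 syyb)).
  apply: (etrans (congr2 +%R (erefl _) (diff0_vanishing_mul v sx1 syb (mxE _ _ _ _)))).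
  rewrite mxE mul0r mul0r addr0; apply: (etrans (esym (diff0_coord 2%:R v mPi.1))).
  apply: (congr1 (fun q : 'rV[R]_3 => q 0 2%:R)).
  apply: (etrans (diff0_comp v minc mPhi.1)); congr ('d Phi 0 _).
  exact: diff_linear.
Unshelve. all: by end_near. Qed.

End NormalForm.

(** * From the squared height to the cuspidal S_j models *)

Section TargetNormalization.
Context {R : realType}.
Implicit Types (x : 'rV[R]_2) (p b alpha e m : 'rV[R]_2 -> R^o).

Lemma diff0_fold2 (v : 'rV[R]_2) : 'd (@fold2 R) 0 v = upd 1 0 v.
Proof.
have sx0 : smooth_germ (fun x : 'rV[R]_2 => x 0 0 : R^o) by exact: smooth_germ_proj.
have sx1 : smooth_germ (fun x : 'rV[R]_2 => x 0 1 : R^o) by exact: smooth_germ_proj.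
have -> : @fold2 R = fun x => vec2 (x 0 0) (x 0 1 * x 0 1).
  by apply/funext => x; apply: row2P; rewrite vecE ?fold2_0 ?fold2_1.
apply: (etrans (diff0_vec2 v sx0 (smooth_germM sx1 sx1))).
apply: row2P; rewrite vecE updE; first exact: diff_proj.
apply: (etrans (diff0_vanishing_mul v sx1 sx1 (mxE _ _ _ _))).
by rewrite mxE mul0r.
Qed.

Lemma diff0_first_axis alpha (v : 'rV[R]_2) : v 0 1 = 0 -> 'd alpha 0 v = v 0 0 * 'd alpha 0 (delta_mx 0 0).
Proof.
move=> v1; have E : v = v 0 0 *: delta_mx 0 0.
  by apply: row2P; rewrite !mxE ?v1 ?eqxx ?mulr1 ?mulr0.
by apply: (etrans (congr1 ('d alpha 0) E)); exact: linearZ.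
Qed.

(** The target change [(alpha, Y, (Z - e) * m)] of the variables [(X, Y, Z)] is matched by the
    source change [(alpha (x, t ^ 2), t)]; the conditions at 0 make both invertible. *)
Lemma target_normalization (z : 'rV[R]_2 -> R) alpha e m j (minus : bool) :
  smooth_germ alpha -> alpha 0 = 0 -> 'd alpha 0 (delta_mx 0 0) != 0 ->
  smooth_germ e -> e 0 = 0 -> smooth_germ m -> m 0 != 0 ->
  (\forall x \near (0 : 'rV[R]_2), (z x - e (fold2 x)) * m (fold2 x) =
     x 0 1 ^+ 3 * (alpha (fold2 x) ^+ j.+1 + (-1) ^+ minus * x 0 1 ^+ 2)) ->
  A_equiv (fun x => vec3 (x 0 0) (x 0 1 ^+ 2) (z x)) (cuspidal_S j minus).
Proof.
move=> salpha alpha0 dalpha se e0 sm m0 zE.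
have mprj := @map_germ_prj R.
have mf2 := @map_germ_fold2 R.
have sx1 : smooth_germ (fun x : 'rV[R]_2 => x 0 1 : R^o) by exact: smooth_germ_proj.
have sq1 : smooth_germ (fun q : 'rV[R]_3 => q 0 1 : R^o) by exact: smooth_germ_proj.
have sq2 : smooth_germ (fun q : 'rV[R]_3 => q 0 2%:R : R^o) by exact: smooth_germ_proj.
have sap : smooth_germ (alpha \o prj) by exact: smooth_germ_comp.
have sep : smooth_germ (e \o prj) by exact: smooth_germ_comp.
have smp : smooth_germ (m \o prj) by exact: smooth_germ_comp.
have sde : smooth_germ (fun q : 'rV[R]_3 => q 0 2%:R - (e \o prj) q : R^o) by exact: smooth_germB.
have sdm : smooth_germ (fun q : 'rV[R]_3 => (q 0 2%:R - (e \o prj) q) * (m \o prj) q : R^o) by exact: smooth_germM.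
pose T (q : 'rV[R]_3) : 'rV[R]_3 := vec3 ((alpha \o prj) q) (q 0 1) ((q 0 2%:R - (e \o prj) q) * (m \o prj) q).
have prj0 : prj 0 = 0 :> 'rV[R]_2 by exact: mprj.2.
have fT : diffeo_germ T.
  apply: inverse_function_germ.
    split; first exact: smooth_germ_vec3.
    by apply: row3P; rewrite /T vecE /= ?prj0 ?alpha0 ?e0 !mxE// subr0 mul0r.
  move=> v /(etrans (esym (diff0_vec3 v sap sq1 sdm))) E.
  have E0 : 'd (alpha \o prj) 0 v = 0 by have := congr1 (fun q : 'rV[R]_3 => q 0 0) E; rewrite vecE mxE.
  have E1 : v 0 1 = 0.
    by have := congr1 (fun q : 'rV[R]_3 => q 0 1) E; rewrite vecE mxE; apply: etrans; exact: esym (diff_proj _ _ _).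
  have E2 : 'd (fun q : 'rV[R]_3 => (q 0 2%:R - (e \o prj) q) * (m \o prj) q : R^o) 0 v = 0.
    by have := congr1 (fun q : 'rV[R]_3 => q 0 2%:R) E; rewrite vecE mxE.
  have {}E0 := etrans (esym (etrans (diff0_comp v mprj salpha) (congr1 ('d alpha 0) (diff_linear prj 0 v)))) E0.
  have pv1 : prj v 0 1 = 0 by rewrite vecE.
  have v0 : v 0 0 = 0.
    have := etrans (esym (diff0_first_axis alpha pv1)) E0; rewrite vecE => /eqP.
    by rewrite mulf_eq0 (negbTE dalpha) orbF => /eqP.
  have pv : prj v = 0 by apply: row2P; rewrite vecE mxE.
  have dep : 'd (e \o prj) 0 v = 0.
    apply: (etrans (diff0_comp v mprj se)).
    apply: (etrans (congr1 ('d e 0) (etrans (diff_linear prj 0 v) pv))); exact: linear0.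
  have z0 : (0 : 'rV[R]_3) 0 2%:R - (e \o prj) 0 = 0 by rewrite mxE /= prj0 e0 subr0.
  have := etrans (esym (diff0_vanishing_mul v sde smp z0)) E2.
  move/eqP; rewrite mulf_eq0 /= prj0 (negbTE m0) /= => /eqP.
  move/(etrans (esym (diff0D v sq2 (smooth_germN sep)))).
  move/(etrans (esym (congr2 +%R (diff_proj 2%:R 0 v) (etrans (diff0N v sep) (congr1 -%R dep))))).
  by rewrite oppr0 addr0 => v2; apply: row3P; rewrite mxE.
have saf : smooth_germ (alpha \o fold2) by exact: smooth_germ_comp.
pose s (x : 'rV[R]_2) : 'rV[R]_2 := vec2 ((alpha \o fold2) x) (x 0 1).
have fs : diffeo_germ s.
  apply: inverse_function_germ.
    split; first exact: smooth_germ_vec2.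
    by apply: row2P; rewrite /s vecE /= ?mf2.2 ?alpha0 !mxE.
  move=> v /(etrans (esym (diff0_vec2 v saf sx1))) E.
  have E0 : 'd (alpha \o fold2) 0 v = 0 by have := congr1 (fun q : 'rV[R]_2 => q 0 0) E; rewrite vecE mxE.
  have E1 : v 0 1 = 0.
    by have := congr1 (fun q : 'rV[R]_2 => q 0 1) E; rewrite vecE mxE; apply: etrans; exact: esym (diff_proj _ _ _).
  have {}E0 := etrans (esym (etrans (diff0_comp v mf2 salpha) (congr1 ('d alpha 0) (diff0_fold2 v)))) E0.
  have u1 : upd 1 0 v 0 1 = 0 by rewrite updE.
  have := etrans (esym (diff0_first_axis alpha u1)) E0; rewrite updE /= => /eqP.
  by rewrite mulf_eq0 (negbTE dalpha) orbF => /eqP v0; apply: row2P; rewrite mxE.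
exists s, T; split => //.
apply: filterS zE => x E.
have pE : prj (vec3 (x 0 0) (x 0 1 ^+ 2) (z x)) = fold2 x.
  by apply: row2P; rewrite !vecE ?fold2_0 ?fold2_1.
by rewrite /T /cuspidal_S /= pE !vecE E.
Qed.

Section Height.
Variables (p b : 'rV[R]_2 -> R^o).
Hypotheses (sp : smooth_germ p) (sb : smooth_germ b) (b0 : b 0 != 0) (p0 : p 0 = 0).

(** The part of the squared height that depends on [(x, t ^ 2)] only: [t ^ 6] is the cube of the
    second variable. *)
Let e (y : 'rV[R]_2) : R^o := p y ^+ 2 + y 0 1 ^+ 3 * b y ^+ 2.

Let se : smooth_germ e.
Proof.
apply: smooth_germD; first exact: smooth_germX.
apply: smooth_germM; last exact: smooth_germX.
by apply: smooth_germX; exact: smooth_germ_proj.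
Qed.

Let e0 : e 0 = 0.
Proof. by rewrite /e p0 mxE !expr0n mul0r addr0. Qed.

Lemma heightE x : cuspidal_height p b x ^+ 2 - e (fold2 x) =
  2 * (x 0 1 ^+ 3 * p (fold2 x) * b (fold2 x)).
Proof. by rewrite /cuspidal_height /e fold2_1; ring. Qed.

Lemma smooth_germ_inv2b : smooth_germ (fun y => (2 * b y)^-1 : R^o).
Proof.
apply: smooth_germ_inv; last by rewrite mulf_neq0.
by apply: smooth_germM => //; exact: smooth_germ_cst.
Qed.

Lemma near_fold2 (P : 'rV[R]_2 -> Prop) : (\forall y \near (0 : 'rV[R]_2), P y) ->
  \forall x \near (0 : 'rV[R]_2), P (fold2 x).
Proof. by move=> H; exact: (near_comp (@map_germ_fold2 R) H). Qed.

(** For [j = 0] the factor [alpha + t ^ 2] of the model equals [p (x, t ^ 2)] when [alpha] is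
    [p - y], whatever the derivative of [p] along the second axis. *)
Lemma cuspidal_S0_normalization : 'd p 0 (delta_mx 0 0) != 0 ->
  A_equiv (fun x => vec3 (x 0 0) (x 0 1 ^+ 2) (cuspidal_height p b x ^+ 2))
          (cuspidal_S 0 false).
Proof.
move=> dp.
have sy : smooth_germ (fun y : 'rV[R]_2 => y 0 1 : R^o) by exact: smooth_germ_proj.
apply: (@target_normalization _ (fun y => p y - y 0 1) e (fun y => (2 * b y)^-1)).
- exact: smooth_germB.
- by rewrite p0 mxE subr0.
- apply: contra dp => /eqP H; apply/eqP; apply: (etrans _ H); apply/esym.
  apply: (etrans (diff0D (delta_mx 0 0) sp (smooth_germN sy))).
  apply: (etrans (congr2 +%R (erefl _) (etrans (diff0N _ sy) (congr1 -%R (diff_proj 1 0 (delta_mx 0 0)))))).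
  by rewrite mxE oppr0 addr0.
- exact: se.
- exact: e0.
- exact: smooth_germ_inv2b.
- by rewrite invr_neq0// mulf_neq0.
- apply: filterS (near_fold2 (smooth_germ_neq0 sb b0)) => x bx.
  by rewrite heightE expr1 expr0 mul1r fold2_1 subrK; field.
Qed.

(** Dividing [p] by [eps * m] gives [c * x ^ k + eps * y], where [eps] is the sign for which [c 0]
    is positive; a [k]-th root of [c] then rescales [x]. *)
Lemma cuspidal_Sk_normalization (k : nat) (n m : 'rV[R]_2 -> R^o) : (0 < k)%N ->
  smooth_germ n -> smooth_germ m -> n 0 != 0 -> m 0 != 0 ->
  (\forall y \near (0 : 'rV[R]_2), p y = y 0 0 ^+ k * n y + y 0 1 * m y) ->
  A_equiv (fun x => vec3 (x 0 0) (x 0 1 ^+ 2) (cuspidal_height p b x ^+ 2))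
          (cuspidal_S k.-1 (n 0 * m 0 < 0)).
Proof.
move=> k0 sn sm n0 m0 pE.
set minus := n 0 * m 0 < 0; pose eps : R := (-1) ^+ minus.
have eps2 : eps * eps = 1 by rewrite -exprMn mulrNN mulr1 expr1n.
have eps0 : eps != 0 by rewrite signr_eq0.
pose c (y : 'rV[R]_2) : R^o := eps * n y * (m y)^-1.
have sinvm : smooth_germ (fun y => (m y)^-1 : R^o) by exact: smooth_germ_inv.
have sc : smooth_germ c.
  by apply: smooth_germM => //; apply: smooth_germM => //; exact: smooth_germ_cst.
have c0 : 0 < c 0.
  have : 0 < eps * (n 0 * m 0).
    rewrite /eps /minus; have [nm|nm] := ltP (n 0 * m 0) 0.
      by rewrite expr1 mulN1r oppr_gt0.
    by rewrite expr0 mul1r lt_neqAle eq_sym mulf_neq0.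
  have m2 : 0 < (m 0)^-1 ^+ 2 by rewrite exprn_even_gt0//= invr_neq0.
  move=> /mulr_gt0/(_ m2).
  by have -> : eps * (n 0 * m 0) * (m 0)^-1 ^+ 2 = c 0 by rewrite /c; field.
pose r (y : 'rV[R]_2) : R^o := c y `^ k%:R^-1.
have sr : smooth_germ r by exact: smooth_germ_powR.
have sx : smooth_germ (fun y : 'rV[R]_2 => y 0 0 : R^o) by exact: smooth_germ_proj.
apply: (@target_normalization _ (fun y => y 0 0 * r y) e (fun y => eps * (m y)^-1 * (2 * b y)^-1)).
- exact: smooth_germM.
- by rewrite mxE mul0r.
- have E : 'd (fun y : 'rV[R]_2 => y 0 0 * r y : R^o) 0 (delta_mx 0 0) = r 0 * (delta_mx 0 0 : 'rV[R]_2) 0 0.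
    apply: (etrans (diff0_vanishing_mul _ sx sr (mxE _ _ _ _))).
    by congr (_ * _); exact: diff_proj.
  apply/negP => /eqP /(etrans (esym E)); rewrite mxE !eqxx mulr1 => /eqP.
  by rewrite gt_eqF// powR_gt0.
- exact: se.
- exact: e0.
- apply: smooth_germM; last exact: smooth_germ_inv2b.
  by apply: smooth_germM => //; exact: smooth_germ_cst.
- by rewrite !mulf_neq0 ?invr_neq0// mulf_neq0.
- have N := near_fold2 pE.
  have N2 := near_fold2 (smooth_germ_neq0 sb b0).
  have N3 := near_fold2 (smooth_germ_neq0 sm m0).
  have N4 := near_fold2 (smooth_germ_gt0 sc c0).
  near=> x.
  have E : p (fold2 x) = fold2 x 0 0 ^+ k * n (fold2 x) + fold2 x 0 1 * m (fold2 x) by near: x.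
  have bx : b (fold2 x) != 0 by near: x.
  have mx : m (fold2 x) != 0 by near: x.
  have cx : 0 < c (fold2 x) by near: x.
  rewrite heightE prednK// -/eps exprMn.
  have -> : r (fold2 x) ^+ k = c (fold2 x).
    rewrite /r -powR_mulrn ?powR_ge0// -powRrM mulVf ?pnatr_eq0 -?lt0n// powRr1// ltW//.
  rewrite E fold2_1 /c; field; exact/andP.
Unshelve. all: by end_near. Qed.

End Height.

End TargetNormalization.

(** * Contact, singular sets and sides *)

Section OrderOfContact.
Context {R : realType}.
Implicit Types (tau w g : R^o -> R^o).

Lemma derive1_near (f g : R^o -> R^o) : smooth_germ f ->
  (\forall t \near (0 : R^o), g t = f t) ->
  \forall t \near (0 : R^o), g^`()%classic t = 'd f t 1.
Proof.
move=> sf fg; have fg' : \forall t \near (0 : R^o), f t = g t by apply: filterS fg => t ->.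
apply: filterS2 (near_join fg') (smooth_germ_differentiable sf) => t ft df.
have dg := differentiable_near ft df.
exact: (etrans (derive1E' dg) (congr1 (@^~ (1 : R^o)) (diff_near ft df))).
Qed.

Lemma is_diff_pow k (x : R^o) :
  is_diff x (fun y : R^o => y ^+ k.+1 : R^o) (fun v => v * (k.+1%:R * x ^+ k) : R^o).
Proof.
apply: is_diff_scalar; have D := is_deriveX k.+1 (is_derive_id (x : R^o) (1 : R^o)).
rewrite exprfctE in D; have [h1 h2] := D.
by apply: DeriveDef; [exact: h1|apply: (etrans h2); rewrite /GRing.scale /= mulr1].
Qed.

Lemma product_rule_pow j (a b c d : R) : a ^+ j.+1 * d + c * (b * (j.+1%:R * a ^+ j)) =
  a ^+ j * (j.+1%:R * b * c + a * d).
Proof. by rewrite exprS; ring. Qed.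

(** The derivative of [tau ^+ j.+1 * w] is [tau ^+ j] times a smooth function whose value at 0 is
    [j + 1] times [tau' w]; hence the induction on [j] with [w] arbitrary. *)
Lemma derive1n_pow_mul tau (j : nat) : smooth_germ tau -> tau 0 = 0 ->
  forall w g, smooth_germ w ->
  (\forall t \near (0 : R^o), g t = tau t ^+ j * w t) ->
  derive1n j g 0 = j`!%:R * 'd tau 0 1 ^+ j * w 0.
Proof.
move=> stau tau0; elim: j => [|j IH] w g sw gE.
  by rewrite derive1n0 (nbhs_singleton gE) !expr0 mulr1.
have sdt : smooth_germ (fun t => 'd tau t 1 : R^o) by exact: smooth_germ_diff.
have sdw : smooth_germ (fun t => 'd w t 1 : R^o) by exact: smooth_germ_diff.
pose w' t : R^o := j.+1%:R * 'd tau t 1 * w t + tau t * 'd w t 1.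
have sw' : smooth_germ w'.
  exact: (smooth_germD (smooth_germM (smooth_germM (smooth_germ_cst _ _) sdt) sw)
    (smooth_germM stau sdw)).
rewrite derive1Sn (IH w') //; last first.
  have sf : smooth_germ (fun t => tau t ^+ j.+1 * w t : R^o).
    by apply: smooth_germM => //; exact: smooth_germX.
  apply: filterS3 (derive1_near sf gE) (smooth_germ_differentiable stau)
    (smooth_germ_differentiable sw) => t -> dt dw.
  have dX : is_diff t (fun t => tau t ^+ j.+1 : R^o) (fun v => 'd tau t v * (j.+1%:R * tau t ^+ j) : R^o).
    apply: (@is_diff_scalar_comp _ _ (fun y : R^o => y ^+ j.+1 : R^o) tau t) => //.
    exact: is_diff_pow.
  have [d1 d2] := dX.
  have E1 : 'd (fun t => tau t ^+ j.+1 * w t : R^o) t (1 : R^o) =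
      tau t ^+ j.+1 * 'd w t (1 : R^o) + w t * 'd (fun t => tau t ^+ j.+1 : R^o) t (1 : R^o).
    exact: (congr1 (@^~ (1 : R^o)) (diffM d1 dw)).
  apply: (etrans E1); apply: (etrans (congr1 (fun z => _ + w t * z) (congr1 (@^~ (1 : R^o)) d2))).
  exact: product_rule_pow.
by rewrite /w' tau0 mul0r addr0 factS natrM exprS; ring.
Qed.

End OrderOfContact.

(** * Singular points and differentials of the two models *)

Section SingularPoints.
Context {R : realType}.

Lemma sing_setP m n (f : 'rV[R]_m -> 'rV[R]_n) p : (m <= n)%N ->
  sing_set f p <-> exists2 v, v != 0 & 'd f p v = 0.
Proof.
move=> mn; rewrite /sing_set /= (minn_idPl mn); split.
  move=> rk; have : kermx ('J f p) != 0.
    by rewrite -mxrank_eq0 mxrank_ker -lt0n subn_gt0.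
  move/rowV0Pn => [v /sub_kermxP vJ v0]; exists v => //.
  by rewrite diff_jacobian.
move=> [v v0 dv]; rewrite ltn_neqAle rank_leq_row andbT; apply/negP => rf.
have : v *m 'J f p = 0 by rewrite -diff_jacobian.
move: rf => /row_free_inj rf; rewrite -[RHS](mul0mx _ ('J f p)) => /rf /eqP.
by rewrite (negbTE v0).
Qed.

Lemma cancel_diff_near m n (d : 'rV[R]_n -> 'rV[R]_m) (e : 'rV[R]_m -> 'rV[R]_n) :
  map_germ d -> map_germ e -> (\forall x \near (0 : 'rV[R]_n), e (d x) = x) ->
  \forall x \near (0 : 'rV[R]_n), forall v, 'd e (d x) ('d d x v) = v.
Proof.
move=> md me ed.
have N1 := near_join ed.
have N2 := smooth_germ_differentiable md.1.
have N3 := near_comp md (smooth_germ_differentiable me.1).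
apply: filterS3 N1 N2 N3 => x Ex dd de v.
have Ex' : \forall y \near x, id y = (e \o d) y by apply: filterS Ex => y /= ->.
have [di vi] := is_diff_id x.
have E1 := congr1 (@^~ v) (diff_near Ex' di).
have E2 := congr1 (@^~ v) (diff_comp dd de).
apply: (etrans (esym E2)); apply: (etrans E1).
exact: (congr1 (@^~ v) vi).
Qed.

Lemma diff_near_comp m n p (f : 'rV[R]_m -> 'rV[R]_n) (g : 'rV[R]_n -> 'rV[R]_p) :
  map_germ f -> smooth_germ g ->
  \forall x \near (0 : 'rV[R]_m), forall v, 'd (g \o f) x v = 'd g (f x) ('d f x v).
Proof.
move=> mf sg; apply: filterS2 (smooth_germ_differentiable mf.1)
  (near_comp mf (smooth_germ_differentiable sg)) => x df dg v.
exact: (congr1 (@^~ v) (diff_comp df dg)).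
Qed.

Lemma diff_near_eq (V W : normedModType R) (f g : V -> W) : smooth_germ f ->
  (\forall x \near (0 : V), f x = g x) ->
  \forall x \near (0 : V), forall v, 'd f x v = 'd g x v.
Proof.
move=> sf fg; apply: filterS2 (near_join fg) (smooth_germ_differentiable sf) => x E df v.
exact: (esym (congr1 (@^~ v) (diff_near E df))).
Qed.

Lemma is_diff_projX n (j : 'I_n) k (y : 'rV[R]_n) :
  is_diff y (fun x : 'rV[R]_n => x 0 j ^+ k.+1 : R^o)
    (fun v => v 0 j * (k.+1%:R * y 0 j ^+ k) : R^o).
Proof.
have cl := @linear_rV_continuous _ _ _ (@coordl R n j).
have dj : differentiable (fun x : 'rV[R]_n => x 0 j : R^o) y.
  exact: (@linear_differentiable _ _ _ (coordl j)).
have D : is_diff (y 0 j) (fun x : R^o => x ^+ k.+1 : R^o) (fun s => s * (k.+1%:R * y 0 j ^+ k) : R^o).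
  exact: is_diff_pow.
have [d1 d2] := is_diff_scalar_comp D dj.
split; first exact: d1.
by rewrite [LHS]d2; apply/funext => v; congr (_ * _); exact: (diff_proj j y v).
Qed.

Lemma diff_coordE m n (f : 'rV[R]_m -> 'rV[R]_n) (y v : 'rV[R]_m) j (g : 'rV[R]_m -> R^o) :
  differentiable f y -> (forall x, f x 0 j = g x) -> 'd f y v 0 j = 'd g y v.
Proof.
move=> df /funext <-; have [_ d] := is_diff_coord j df.
exact: (esym (congr1 (@^~ v) d)).
Qed.

Lemma differentiable_cuspidal_edge (y : 'rV[R]_2) : differentiable cuspidal_edge y.
Proof.
suff D j : differentiable (fun x => cuspidal_edge x 0 j : R^o) y by have [] := is_diff_row D.
have P k j' : differentiable (fun x : 'rV[R]_2 => x 0 j' ^+ k.+1 : R^o) y.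
  by have [] := is_diff_projX j' k y.
case: j => -[|[|[|//]]] lt.
- have -> : (fun x => cuspidal_edge x 0 (Ordinal lt)) = (fun x : 'rV[R]_2 => x 0 0 ^+ 1 : R^o).
    by apply/funext => x; rewrite mxE (tnth_nth 0) expr1.
  exact: P.
- have -> : (fun x => cuspidal_edge x 0 (Ordinal lt)) = (fun x : 'rV[R]_2 => x 0 1 ^+ 2 : R^o).
    by apply/funext => x; rewrite mxE (tnth_nth 0).
  exact: P.
- have -> : (fun x => cuspidal_edge x 0 (Ordinal lt)) = (fun x : 'rV[R]_2 => x 0 1 ^+ 3 : R^o).
    by apply/funext => x; rewrite mxE (tnth_nth 0).
  exact: P.
Qed.

Lemma diff_cuspidal_edge (y v : 'rV[R]_2) : 'd cuspidal_edge y v =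
  vec3 (v 0 0) (2 * y 0 1 * v 0 1) (3 * y 0 1 ^+ 2 * v 0 1).
Proof.
have d := differentiable_cuspidal_edge y.
have P k : 'd (fun x : 'rV[R]_2 => x 0 1 ^+ k.+1 : R^o) y v = v 0 1 * (k.+1%:R * y 0 1 ^+ k).
  by have [_ E] := is_diff_projX 1 k y; exact: (congr1 (@^~ v) E).
apply: row3P; rewrite vecE.
- apply: (etrans (diff_coordE (j := 0) (g := fun x => x 0 0) v d _)); last exact: diff_proj.
  by move=> x; rewrite vecE.
- apply: (etrans (diff_coordE (j := 1) (g := fun x => x 0 1 ^+ 2) v d _)).
    by move=> x; rewrite vecE.
  by apply: (etrans (P 1%N)); rewrite expr1 mulrC.
- apply: (etrans (diff_coordE (j := 2%:R) (g := fun x => x 0 1 ^+ 3) v d _)).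
    by move=> x; rewrite vecE.
  by apply: (etrans (P 2%N)); rewrite mulrC.
Qed.

Lemma differentiable_fold_map (y : 'rV[R]_3) : differentiable fold_map y.
Proof.
suff D j : differentiable (fun x => fold_map x 0 j : R^o) y by have [] := is_diff_row D.
have P k j' : differentiable (fun x : 'rV[R]_3 => x 0 j' ^+ k.+1 : R^o) y.
  by have [] := is_diff_projX j' k y.
case: j => -[|[|[|//]]] lt.
- have -> : (fun x => fold_map x 0 (Ordinal lt)) = (fun x : 'rV[R]_3 => x 0 0 ^+ 1 : R^o).
    by apply/funext => x; rewrite mxE (tnth_nth 0) expr1.
  exact: P.
- have -> : (fun x => fold_map x 0 (Ordinal lt)) = (fun x : 'rV[R]_3 => x 0 1 ^+ 1 : R^o).
    by apply/funext => x; rewrite mxE (tnth_nth 0) expr1.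
  exact: P.
- have -> : (fun x => fold_map x 0 (Ordinal lt)) = (fun x : 'rV[R]_3 => x 0 2%:R ^+ 2 : R^o).
    by apply/funext => x; rewrite mxE (tnth_nth 0).
  exact: P.
Qed.

Lemma diff_fold_map (y v : 'rV[R]_3) : 'd fold_map y v =
  vec3 (v 0 0) (v 0 1) (2 * y 0 2%:R * v 0 2%:R).
Proof.
have d := differentiable_fold_map y.
apply: row3P; rewrite vecE.
- apply: (etrans (diff_coordE (j := 0) (g := fun x => x 0 0) v d _)); last exact: diff_proj.
  by move=> x; rewrite vecE.
- apply: (etrans (diff_coordE (j := 1) (g := fun x => x 0 1) v d _)); last exact: diff_proj.
  by move=> x; rewrite vecE.
- apply: (etrans (diff_coordE (j := 2%:R) (g := fun x => x 0 2%:R ^+ 2) v d _)).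
    by move=> x; rewrite vecE.
  have [_ E] := is_diff_projX 2%:R 1 y.
  by apply: (etrans (congr1 (@^~ v) E)); rewrite /= expr1 mulrC.
Qed.

Lemma smooth_germ_diff0_neq0 (V : normedModType R) (f : V -> R^o) v : 'd f 0 v != 0 ->
  ~ \forall x \near (0 : V), f x = 0.
Proof.
move=> + E; apply/negP/negPn/eqP.
have E' : \forall x \near (0 : V), (fun=> 0 : R^o) x = f x by apply: filterS E => x ->.
exact: etrans (diff0_near v (smooth_germ_cst _ 0) E') (diff0_cst _ _).
Qed.

End SingularPoints.

Lemma filterS4 (T : Type) (F : set_system T) : Filter F -> forall P Q S U V : set T,
  (forall x, P x -> Q x -> S x -> U x -> V x) -> F P -> F Q -> F S -> F U -> F V.
Proof.
move=> FF P Q S U V H FP FQ FS FU.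
by apply: filterS3 FP FQ (filterI FS FU) => x Px Qx [Sx Ux]; exact: H.
Qed.

Section CompositionGeometry.
Context {R : realType}.

Lemma dotDl n (u v w : 'rV[R]_n) : dot (u + v) w = dot u w + dot v w.
Proof. by rewrite /dot -big_split; apply: eq_bigr => i _; rewrite mxE mulrDl. Qed.

Lemma dotZl n a (u w : 'rV[R]_n) : dot (a *: u) w = a * dot u w.
Proof. by rewrite /dot mulr_sumr; apply: eq_bigr => i _; rewrite mxE mulrA. Qed.

Lemma smooth_germ_dot m n (u w : 'rV[R]_m -> 'rV[R]_n) : smooth_germ u -> smooth_germ w ->
  smooth_germ (fun x => dot (u x) (w x) : R^o).
Proof.
move=> su sw; apply: (smooth_germ_sum (f := fun i x => u x 0 i * w x 0 i : R^o)) => i _.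
by apply: smooth_germM; exact: smooth_germ_coord.
Qed.

Lemma dot_eq0 n (w : 'rV[R]_n) : (forall v, dot v w = 0) -> w = 0.
Proof.
move=> H; apply/rowP => i; rewrite mxE -(H (delta_mx 0 i)) /dot (bigD1 i)//= mxE !eqxx mul1r.
by rewrite big1 ?addr0// => j ji; rewrite mxE (negbTE ji) andbF mul0r.
Qed.

Section CuspidalSide.
Variables (f nu : 'rV[R]_2 -> 'rV[R]_3) (ds es : 'rV[R]_2 -> 'rV[R]_2) (dt et : 'rV[R]_3 -> 'rV[R]_3).
Hypotheses (mf : map_germ f) (mds : map_germ ds) (mes : map_germ es)
  (mdt : map_germ dt) (met : map_germ et).
Hypotheses (dsK : \forall x \near (0 : 'rV[R]_2), es (ds x) = x)
  (esK : \forall x \near (0 : 'rV[R]_2), ds (es x) = x)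
  (dtK : \forall x \near (0 : 'rV[R]_3), et (dt x) = x)
  (dtf : \forall x \near (0 : 'rV[R]_2), dt (f x) = cuspidal_edge (ds x)).

Lemma cuspidal_parametrization :
  \forall x \near (0 : 'rV[R]_2), f x = et (cuspidal_edge (ds x)).
Proof. by apply: filterS2 dtf (near_comp mf dtK) => x <-. Qed.

(* On [y 0 1 != 0] the image of [vec2 (y 0 1 * v 0 0) (v 0 1 / 2)] under the
   differential of the cuspidal edge, divided by [y 0 1], tends to [inc v]. *)
Lemma limiting_tangent_plane v : normal_field f nu -> dot ('d et 0 (inc v)) (nu 0) = 0.
Proof.
move=> [snu nuN].
have mce := @map_germ_cuspidal_edge R.
pose A (y : 'rV[R]_2) := 'd et (cuspidal_edge y) (inc v).
pose B (y : 'rV[R]_2) := 'd et (cuspidal_edge y) (delta_mx 0 2%:R).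
have sA : smooth_germ A by exact: (smooth_germ_compV mce (smooth_germ_diff (inc v) met.1)).
have sB : smooth_germ B by exact: (smooth_germ_compV mce (smooth_germ_diff (delta_mx 0 2%:R) met.1)).
have snue : smooth_germ (nu \o es) by exact: smooth_germ_compV.
have sy1 : smooth_germ (fun y : 'rV[R]_2 => y 0 1 : R^o) by exact: smooth_germ_proj.
pose H (y : 'rV[R]_2) : R^o := dot (A y) (nu (es y)) + y 0 1 * (3 / 2 * v 0 1) * dot (B y) (nu (es y)).
have sH : smooth_germ H.
  apply: smooth_germD; first exact: (smooth_germ_dot sA snue).
  apply: smooth_germM; last exact: (smooth_germ_dot sB snue).
  exact: (smooth_germM sy1 (smooth_germ_cst _ _)).
have mfes : map_germ (f \o es) by exact: map_germ_comp.
have fesE : \forall y \near (0 : 'rV[R]_2), (f \o es) y = (et \o cuspidal_edge) y.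
  by apply: filterS2 (near_comp mes cuspidal_parametrization) esK => y /= -> ->.
have N1 := diff_near_eq mfes.1 fesE.
have N2 := diff_near_comp mce met.1.
have N3 := diff_near_comp mes mf.1.
have N4 := near_comp mes nuN.
have HE : \forall y \near (0 : 'rV[R]_2), (fun=> 0 : R^o) (y : 'rV[R]_2) = (y : 'rV[R]_2) 0 1 * H y.
  apply: filterS4 N1 N2 N3 N4 => y E1 E2 E3 [_ E4].
  pose X : 'rV[R]_2 := vec2 (y 0 1 * v 0 0) (v 0 1 / 2).
  apply/esym; rewrite -[RHS](E4 ('d es y X)).
  have E5 := etrans (esym (E3 X)) (etrans (E1 X) (E2 X)).
  apply: (etrans _ (esym (congr1 (fun w => dot w (nu (es y))) E5))).
  have E6 : 'd cuspidal_edge y X = y 0 1 *: inc v + (y 0 1 ^+ 2 * (3 / 2 * v 0 1)) *: delta_mx 0 2%:R.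
    apply: (etrans (diff_cuspidal_edge y X)); apply: row3P; rewrite !vecE [RHS]mxE [X in _ = X + _]mxE [X in _ = _ + X]mxE vecE mxE /=.
    - by rewrite mulr0 addr0.
    - by rewrite mulr0 addr0; field.
    - by rewrite mulr0 add0r mulr1; field.
  have E7 : 'd et (cuspidal_edge y) ('d cuspidal_edge y X) = y 0 1 *: A y + (y 0 1 ^+ 2 * (3 / 2 * v 0 1)) *: B y.
    apply: (etrans (congr1 ('d et (cuspidal_edge y)) E6)).
    apply: (etrans (linearD _ _ _)); congr (_ + _); exact: linearZ.
  apply: (etrans _ (esym (congr1 (fun w => dot w (nu (es y))) E7))).
  by rewrite dotDl !dotZl /H expr2; ring.
have y10 : (0 : 'rV[R]_2) 0 1 = 0 by rewrite mxE.
have := etrans (esym (diff0_vanishing_mul (delta_mx 0 1) sy1 sH y10))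
  (etrans (diff0_near (delta_mx 0 1) (smooth_germ_cst _ (0 : R^o)) HE) (diff0_cst _ _)).
have /= D1 := diff_proj 1 0 (delta_mx 0 1 : 'rV[R]_2).
move/(etrans (esym (congr1 (fun z => H 0 * z) D1))).
by rewrite mxE !eqxx mulr1 /H mxE !mul0r addr0 /A mce.2 mes.2.
Qed.

(** ['d ds x] carries a kernel vector of ['d f x] to one of the cuspidal edge, which is an immersion
    off [t = 0]. *)
Lemma sing_set_cuspidal : \forall x \near (0 : 'rV[R]_2), sing_set f x -> ds x 0 1 = 0.
Proof.
have N1 := diff_near_comp mf mdt.1.
have N2 := diff_near_eq (map_germ_comp mf mdt).1 dtf.
have N3 : \forall x \near (0 : 'rV[R]_2), forall v, 'd (cuspidal_edge \o ds) x v = _ :=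
  diff_near_comp mds (@map_germ_cuspidal_edge R).1.
have N4 := cancel_diff_near mds mes dsK.
apply: filterS4 N1 N2 N3 N4 => x E1 E2 E3 E4 /(@sing_setP _ 2 3 f x isT) [v v0 dv].
apply/eqP; apply: contraNT v0 => y0.
have [w wE] : exists w : 'rV[R]_2, w = 'd ds x v by exact: (@ex_intro _ _ ('d ds x v) erefl).
have : 'd cuspidal_edge (ds x) w = 0.
  apply: (etrans (congr1 ('d cuspidal_edge (ds x)) wE)).
  apply: (etrans (esym (E3 v))); apply: (etrans (esym (E2 v))); apply: (etrans (E1 v)).
  by apply: (etrans (congr1 ('d dt (f x)) dv)); exact: linear0.
move/(etrans (esym (diff_cuspidal_edge (ds x) w))) => E.
have w0 := congr1 (fun w : 'rV[R]_3 => w 0 0) E.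
have w1 := congr1 (fun w : 'rV[R]_3 => w 0 1) E.
rewrite /= !vecE !mxE in w0 w1.
move/eqP: w1; rewrite !mulf_eq0 (negbTE y0) pnatr_eq0 /= => /eqP w1.
have w00 : w = 0 by apply: row2P; rewrite mxE.
apply/eqP; apply: (etrans (esym (E4 v))); apply: (etrans (congr1 ('d es (ds x)) (etrans (esym wE) w00))).
exact: linear0.
Qed.

End CuspidalSide.

Section FoldSide.
Variables (F Ds Es Dt Et : 'rV[R]_3 -> 'rV[R]_3) (h : 'rV[R]_3 -> R^o).
Hypotheses (mF : map_germ F) (mDs : map_germ Ds) (mEs : map_germ Es)
  (mDt : map_germ Dt) (mEt : map_germ Et).
Hypotheses (DsK : \forall x \near (0 : 'rV[R]_3), Es (Ds x) = x)
  (EsK : \forall x \near (0 : 'rV[R]_3), Ds (Es x) = x)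
  (DtK : \forall x \near (0 : 'rV[R]_3), Et (Dt x) = x)
  (DtF : \forall x \near (0 : 'rV[R]_3), Dt (F x) = fold_map (Ds x)).

(** At 0 the differential of the fold retains exactly the first two components. *)
Lemma fold_kernel w : 'd F 0 w = 0 -> prj ('d Ds 0 w) = 0.
Proof.
move=> Fw; have mfold := @map_germ_fold_map R.
have DtF' : \forall x \near (0 : 'rV[R]_3), (fold_map \o Ds) x = (Dt \o F) x.
  by apply: filterS DtF => x /= ->.
have E := etrans (esym (diff0_comp w mF mDt.1)) (etrans (diff0_near w
  (map_germ_comp mDs mfold).1 DtF') (diff0_comp w mDs mfold.1)).
have E0 : 'd Dt 0 ('d F 0 w) = 0 by apply: (etrans (congr1 ('d Dt 0) Fw)); exact: linear0.
have {E0}E := etrans (esym (diff_fold_map 0 _)) (etrans (esym E) E0).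
have w0 := congr1 (fun w : 'rV[R]_3 => w 0 0) E.
have w1 := congr1 (fun w : 'rV[R]_3 => w 0 1) E.
rewrite /= !vecE [RHS]mxE in w0; rewrite /= !vecE [RHS]mxE in w1.
by apply: row2P; rewrite vecE [RHS]mxE; [exact: w0|exact: w1].
Qed.

Lemma sing_set_fold : \forall q \near (0 : 'rV[R]_3), (q : 'rV[R]_3) 0 2%:R = 0 -> sing_set F (Es q).
Proof.
have mfold := @map_germ_fold_map R.
have FE : \forall q \near (0 : 'rV[R]_3), (F \o Es) q = (Et \o fold_map) q.
  apply: filterS3 (near_comp mEs DtF) EsK (near_comp (map_germ_comp mEs mF) DtK) => q /= E1 E2 <-.
  by rewrite E1 E2.
have N1 := diff_near_eq (map_germ_comp mEs mF).1 FE.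
have N2 := diff_near_comp mfold mEt.1.
have N3 := diff_near_comp mEs mF.1.
have N4 := cancel_diff_near mEs mDs EsK.
apply: filterS4 N1 N2 N3 N4 => q E1 E2 E3 E4 q2.
pose e2 : 'rV[R]_3 := delta_mx 0 2%:R.
apply/(@sing_setP _ 3 3 F (Es q) isT); exists ('d Es q e2).
  apply/negP => /eqP E; have := E4 e2.
  move/(etrans (esym (congr1 ('d Ds (Es q)) E)))/(etrans (esym (linear0 _))).
  move/(congr1 (fun w : 'rV[R]_3 => w 0 2%:R)); rewrite /e2 !mxE !eqxx => /eqP.
  by rewrite eq_sym oner_eq0.
apply: (etrans (esym (E3 e2))); apply: (etrans (E1 e2)); apply: (etrans (E2 e2)).
have E : 'd fold_map q e2 = 0.
  apply: (etrans (diff_fold_map q e2)).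
  by apply: row3P; rewrite vecE ?q2 !mxE// mulr0 mul0r.
by apply: (etrans (congr1 ('d Et (fold_map q)) E)); exact: linear0.
Qed.

(** In the coordinates [Ds] the function [h] vanishes where the third coordinate does, and
    Hadamard's lemma splits that coordinate off. The cofactor is a unit because ['d h 0] is
    nonzero. *)
Lemma fold_local_equation : local_equation (sing_set F) h ->
  exists2 U : 'rV[R]_3 -> R^o, smooth_germ U /\ U 0 != 0 &
    \forall q \near (0 : 'rV[R]_3), h q = Ds q 0 2%:R * U (Ds q).
Proof.
move=> [sh hS [w hw]].
have sH : smooth_germ (h \o Es) by exact: smooth_germ_comp.
have H0 : \forall q \near (0 : 'rV[R]_3), (h \o Es) (upd 2%:R 0 q) = 0.
  have N := @map_germ_upd0 R _ (2%:R : 'I_3).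
  apply: filterS2 (near_comp N sing_set_fold) (near_comp N (near_comp mEs hS)) => q E1 E2.
  by apply/E2/E1; rewrite updE eqxx.
have [U sU UE] := hadamard_germ sH H0.
exists U; last first.
  by apply: filterS2 DsK (near_comp mDs UE) => q E1 /= <-; rewrite E1.
split=> //; apply: contra hw => /eqP U0; apply/eqP.
have s2 : smooth_germ (fun q : 'rV[R]_3 => q 0 2%:R : R^o) by exact: smooth_germ_proj.
have E1 := cancel_diff0 w mDs mEs DsK.
apply: (etrans (esym (congr1 ('d h 0) E1))).
apply: (etrans (esym (diff0_comp _ mEs sh))).
have UE' : \forall q \near (0 : 'rV[R]_3), (q : 'rV[R]_3) 0 2%:R * U q = (h \o Es) q.
  by apply: filterS UE => q ->.
apply: (etrans (diff0_near _ (smooth_germM s2 sU) UE')).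
apply: (etrans (diff0_vanishing_mul _ s2 sU (mxE _ _ _ _))).
by rewrite U0 mul0r.
Qed.

End FoldSide.

End CompositionGeometry.

(** * Order of contact and the expansion of [p] along the singular curve *)

Section Contact.
Context {R : realType}.
Variables (p : 'rV[R]_2 -> R^o) (a : R^o -> 'rV[R]_2) (W g : R^o -> R^o).
Hypotheses (sp : smooth_germ p) (ma : map_germ a) (sW : smooth_germ W) (W0 : W 0 != 0).
Hypotheses (a1 : \forall t \near (0 : R^o), a t 0 1 = 0)
  (gE : \forall t \near (0 : R^o), g t = p (a t) * W t).

Let tau (t : R^o) : R^o := a t 0 0.

Lemma contact_pow j n : (\forall y \near (0 : 'rV[R]_2), p (upd 1 0 y) = (y : 'rV[R]_2) 0 0 ^+ j * n y) ->
  \forall t \near (0 : R^o), g t = tau t ^+ j * (n (a t) * W t).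
Proof.
move=> pE; apply: filterS3 gE a1 (near_comp ma pE) => t -> E.
by rewrite -{1}E upd_id => ->; rewrite mulrA.
Qed.

Lemma contact_derive j (n : 'rV[R]_2 -> R^o) : smooth_germ n ->
  (\forall y \near (0 : 'rV[R]_2), p (upd 1 0 y) = (y : 'rV[R]_2) 0 0 ^+ j * n y) ->
  derive1n j g 0 = j`!%:R * 'd tau 0 (1 : R^o) ^+ j * (n 0 * W 0).
Proof.
move=> sn pE.
have stau : smooth_germ tau by exact: smooth_germ_coord ma.1.
have tau0 : tau 0 = 0 by rewrite /tau ma.2 mxE.
have sw : smooth_germ (fun t => n (a t) * W t : R^o).
  exact: (smooth_germM (smooth_germ_comp ma sn) sW).
by rewrite (derive1n_pow_mul stau tau0 sw (contact_pow pE)) ma.2.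
Qed.

(** If [p] is [x ^ k * n] on the first axis, the derivative of order [k] of [g] at 0 is a nonzero
    multiple of [n 0]; when it vanishes, Hadamard's lemma extracts one more power of [x]. *)
Lemma contact_factorization k : 'd tau 0 (1 : R^o) != 0 ->
  (forall i, (i < k)%N -> derive1n i g 0 = 0) ->
  exists2 n : 'rV[R]_2 -> R^o, smooth_germ n &
    \forall y \near (0 : 'rV[R]_2), p (upd 1 0 y) = (y : 'rV[R]_2) 0 0 ^+ k * n y.
Proof.
move=> dtau; elim: k => [|k IH] gk.
  exists (p \o upd 1 0); first exact: (smooth_germ_comp (@map_germ_upd0 R _ _) sp).
  by apply: near_all => y; rewrite expr0 mul1r.
have [i ik|n sn nE] := IH; first by apply: gk; exact: ltnW.
have n0 : n 0 = 0.
  have /eqP := gk k (ltnSn k); rewrite (contact_derive sn nE).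
  rewrite !mulf_eq0 expf_eq0 (negbTE dtau) (negbTE W0) andbF !orbF.
  by rewrite pnatr_eq0 gtn_eqF ?fact_gt0//= => /eqP.
have mu := @map_germ_upd0 R _ (1 : 'I_2).
(* Freezing the second coordinate at 0 makes [n] vanish on the whole line [x = 0], as Hadamard's
   lemma requires, without changing it on the first axis. *)
have sn' : smooth_germ (n \o upd 1 0) by exact: smooth_germ_comp.
have n'0 : \forall y \near (0 : 'rV[R]_2), (n \o upd 1 0) (upd 0 0 y) = 0.
  apply: near_all => y /=; rewrite -[RHS]n0; congr n.
  by apply: row2P; rewrite !updE mxE.
have [n' sn'' n'E] := hadamard_germ sn' n'0.
exists n' => //; apply: filterS2 (near_comp mu nE) n'E => y.
by rewrite updK updE /= => -> ->; rewrite exprSr mulrA.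
Qed.

End Contact.

Section HeightSign.
Context {R : realType}.
Variables (p b n m V : 'rV[R]_2 -> R^o) (k : nat) (s : bool).
Hypotheses (sb : smooth_germ b) (sn : smooth_germ n) (sm : smooth_germ m) (sV : smooth_germ V).
Hypotheses (k0 : (0 < k)%N) (ek : ~~ odd k) (n0V : 0 < (-1) ^+ s * (n 0 * V 0)) (m0 : m 0 != 0).
Hypothesis pE : \forall y \near (0 : 'rV[R]_2), p y = (y : 'rV[R]_2) 0 0 ^+ k * n y + y 0 1 * m y.

(** The height is [x ^ k * n + t ^ 2 * (m + t * b)]. As [k] is even and the first term lies on the
    side [s], the sign of [m] relative to [n] at 0 decides. *)
Lemma height_sign :
  (\forall y \near (0 : 'rV[R]_2), 0 <= (-1) ^+ s * (cuspidal_height p b y * V y)) <->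
  ~~ (n 0 * m 0 < 0).
Proof.
have mf2 := @map_germ_fold2 R.
pose N (y : 'rV[R]_2) : R^o := (-1) ^+ s * (n (fold2 y) * V y).
pose M (y : 'rV[R]_2) : R^o := (-1) ^+ s * ((m (fold2 y) + y 0 1 * b (fold2 y)) * V y).
have sN : smooth_germ N.
  exact: (smooth_germM (smooth_germ_cst _ _) (smooth_germM (smooth_germ_comp mf2 sn) sV)).
have sM : smooth_germ M.
  apply: (smooth_germM (smooth_germ_cst _ _) (smooth_germM _ sV)).
  exact: (smooth_germD (smooth_germ_comp mf2 sm)
    (smooth_germM (smooth_germ_proj _) (smooth_germ_comp mf2 sb))).
have N0 : 0 < N 0 by rewrite /N mf2.2.
have ME : M 0 = (-1) ^+ s * (m 0 * V 0) by rewrite /M mf2.2 mxE mul0r addr0.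
have KE : \forall y \near (0 : 'rV[R]_2), (-1) ^+ s * (cuspidal_height p b y * V y) =
    y 0 0 ^+ k * N y + y 0 1 ^+ 2 * M y.
  apply: filterS (near_comp mf2 pE) => y E.
  by rewrite /cuspidal_height E fold2_0 fold2_1 /N /M; ring.
have V0 : V 0 != 0 by apply: contraTneq n0V => ->; rewrite !mulr0 ltxx.
have sgnE : (n 0 * m 0 < 0) = (M 0 < 0).
  have A : 0 < (N 0 * V 0 ^- 2) by rewrite mulr_gt0// invr_gt0 exprn_even_gt0.
  have : M 0 * (N 0 * V 0 ^- 2) = n 0 * m 0.
    have e2 : (-1) ^+ s * (-1) ^+ s = 1 :> R by rewrite -exprMn mulrNN mulr1 expr1n.
    rewrite -[RHS]mul1r -e2 ME /N mf2.2.
    by move: ((-1) ^+ s) (m 0) (n 0) (V 0) V0 => e x y z z0; field.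
  by move=> <-; rewrite pmulr_llt0.
rewrite sgnE; split=> [H|]; last first.
  rewrite -leNgt le_eqVlt => /orP[|M0].
    rewrite ME eq_sym !mulf_eq0 signr_eq0 (negbTE m0) (negbTE V0) //.
  apply: filterS3 KE (smooth_germ_gt0 sN N0) (smooth_germ_gt0 sM M0) => y -> Ny My.
  by rewrite addr_ge0// mulr_ge0 ?(ltW Ny) ?(ltW My)// exprn_even_ge0.
(* On the axis [x = 0] only [t ^ 2 * M] remains, negative for small [t != 0]; nonnegativity would
   force the coordinate [t] to vanish identically near 0. *)
apply/negP => M0; have mu := @map_germ_upd0 R _ (0 : 'I_2).
have M0' : 0 < - M 0 by rewrite oppr_gt0.
apply: (@smooth_germ_diff0_neq0 _ _ (fun y : 'rV[R]_2 => y 0 1 : R^o) (delta_mx 0 1)).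
  have D : 'd (fun y : 'rV[R]_2 => y 0 1 : R^o) 0 (delta_mx 0 1) = 1.
    by apply: (etrans (diff_proj 1 0 (delta_mx 0 1))); rewrite mxE !eqxx.
  by apply/negP => /eqP /(etrans (esym D)) /eqP; rewrite oner_eq0.
apply: filterS3 (near_comp mu KE) (near_comp mu H)
  (near_comp mu (smooth_germ_gt0 (smooth_germN sM) M0')) => y -> E1 E2.
apply/eqP; apply: contraLR E1 => y1; rewrite -ltNge !updE /= expr0n gtn_eqF// mul0r add0r.
by rewrite pmulr_rlt0 -?oppr_gt0// exprn_even_gt0.
Qed.

End HeightSign.

(** * Use of the three conditions *)

Lemma prj_eq0 (R : realType) (u : 'rV[R]_3) : prj u = 0 -> u 0 0 = 0 /\ u 0 1 = 0.
Proof.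
move=> E; have E0 := congr1 (fun w : 'rV[R]_2 => w 0 0) E.
have E1 := congr1 (fun w : 'rV[R]_2 => w 0 1) E.
by move: E0 E1; rewrite !vecE !mxE.
Qed.

Lemma prj_eq0_collinear (R : realType) (u w : 'rV[R]_3) : prj u = 0 -> prj w = 0 ->
  w 0 2%:R != 0 -> u = (u 0 2%:R / w 0 2%:R) *: w.
Proof.
move=> /prj_eq0[u0 u1] /prj_eq0[w0 w1] w2.
by apply: row3P; rewrite mxE ?u0 ?u1 ?w0 ?w1 ?mulr0// divfK.
Qed.

Theorem theorem4p3 (R : realType) (k : nat) (hk : (1 <= k)%N)
  (f : 'rV[R]_2 -> 'rV[R]_3) (F : 'rV[R]_3 -> 'rV[R]_3)
  (hf : map_germ f) (hfE : A_equiv f cuspidal_edge)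
  (hF : map_germ F) (hFE : A_equiv F fold_map)
  (nu : 'rV[R]_2 -> 'rV[R]_3) (hnu : normal_field f nu)
  (gamma : R^o -> 'rV[R]_2) (hgamma : regular_param (sing_set f) gamma)
  (h : 'rV[R]_3 -> R^o) (hh : local_equation (sing_set F) h)
  (hA : ~ (kernel_d F 0 `<=` tangent_plane nu 0))
  (hB : transverse (tangent_plane nu 0) (tangent_space h))
  (hC : point_contact k (f \o gamma) h) :
  (exists minus : bool, A_equiv (F \o f) (cuspidal_S k.-1 minus)) /\
  (~~ odd k ->
     (exists s : bool, locally_in (f \o gamma) (half_space h s)) /\
     (forall s : bool, locally_in (f \o gamma) (half_space h s) ->
        (locally_in f (half_space h s) ->
           A_equiv (F \o f) (cuspidal_S k.-1 false)) /\
        (~ locally_in f (half_space h s) ->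
           A_equiv (F \o f) (cuspidal_S k.-1 true)))).
Proof.
(* From here on the order of contact is [k.+1], so [k] is the index of the singularity. *)
case: k hk hC => // k _ hC.
have [ds [dt [dds ddt dtf]]] := hfE.
have [mds [es [mes dsK esK]]] := dds; have [mdt [et [met dtK etK]]] := ddt.
have [Ds [Dt [dDs dDt DtF]]] := hFE.
have [mDs [Es [mEs DsK EsK]]] := dDs; have [mDt [Et [mEt DtK EtK]]] := dDt.
have mce := @map_germ_cuspidal_edge R.
have fE := cuspidal_parametrization hf dtK dtf.
have tan0 v := limiting_tangent_plane hf mes met esK dtK dtf v hnu.
have det_ : diffeo_germ et by split=> //; exists dt.
pose Phi := Ds \o et.
have dPhi : diffeo_germ Phi := diffeo_germ_comp det_ dDs.
have mPhi := dPhi.1.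
have dPhiE v : 'd Phi 0 v = 'd Ds 0 ('d et 0 v) := diff0_comp v met mDs.1.
have etdt w : 'd et 0 ('d dt 0 w) = w := cancel_diff0 w mdt met dtK.
pose e2 : 'rV[R]_3 := delta_mx 0 2%:R.
(* Pulled back by ['d et 0], the limiting tangent plane is the plane of [inc]: the normal vector
   sees the third coordinate only. *)
have tanE (a : 'rV[R]_3) : dot ('d et 0 a) (nu 0) = a 0 2%:R * dot ('d et 0 e2) (nu 0).
  have E : a = inc (prj a) + a 0 2%:R *: e2.
    by apply: row3P; rewrite [RHS]mxE !vecE !mxE /= ?mulr0 ?addr0 ?mulr1 ?add0r.
  have E' : 'd et 0 a = 'd et 0 (inc (prj a)) + a 0 2%:R *: 'd et 0 e2.
    apply: (etrans (congr1 ('d et 0) E)); apply: (etrans (linearD _ _ _)).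
    congr (_ + _); exact: linearZ.
  by apply: (etrans (congr1 (fun w => dot w (nu 0)) E')); rewrite dotDl dotZl tan0 add0r.
(* By (A) some kernel vector [w] of ['d F 0] lies outside the limiting tangent plane. Its pull-back
   [a0] spans the kernel of [prj] after ['d Phi 0], and no nonzero [inc v] is a multiple of it. *)
have tr v : prj ('d Phi 0 (inc v)) = 0 -> v = 0.
  have [w Fw dw] : exists2 w, 'd F 0 w = 0 & dot w (nu 0) != 0.
    apply: contrapT => H; apply: hA => w Fw; apply/eqP; apply: contrapT => /negP nw.
    by apply: H; exists w.
  pose a0 := 'd dt 0 w.
  have aE : 'd et 0 a0 = w := etdt w.
  have a02 : a0 0 2%:R != 0.
    apply: contra dw => /eqP E; apply/eqP.
    apply: (etrans (esym (congr1 (fun w => dot w (nu 0)) aE))).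
    by apply: (etrans (tanE a0)); rewrite E mul0r.
  have pa : prj ('d Phi 0 a0) = 0.
    apply: (etrans (congr1 prj (etrans (dPhiE a0) (congr1 ('d Ds 0) aE)))).
    exact: (fold_kernel hF mDs mDt DtF Fw).
  have b2 : 'd Phi 0 a0 0 2%:R != 0.
    apply: contra a02 => /eqP E; have [E0 E1] := prj_eq0 pa.
    have A : 'd Phi 0 a0 = 0 by apply: row3P; rewrite [RHS]mxE.
    by have := diffeo_germ_diff_inj dPhi A => ->; rewrite mxE.
  move=> /prj_eq0_collinear/(_ pa b2); set c := (_ / _) => E.
  have A : 'd Phi 0 (inc v - c *: a0) = 0.
    apply: (etrans (linearB _ _ _)); apply/eqP; rewrite subr_eq0; apply/eqP.
    apply: (etrans E); apply/esym; exact: linearZ.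
  have /eqP := diffeo_germ_diff_inj dPhi A; rewrite subr_eq0 => /eqP {}E.
  have c0 : c = 0.
    have /eqP := congr1 (fun w : 'rV[R]_3 => w 0 2%:R) E.
    by rewrite vecE mxE eq_sym mulf_eq0 (negbTE a02) orbF => /eqP.
  by rewrite -(incK v) E c0 scale0r linear0.
have [s [p [b [[dsb sp sb b0] [G1E hE pax dp]]]]] := cuspidal_normal_form dPhi tr.
pose G1 (x : 'rV[R]_2) : 'rV[R]_3 := vec3 (x 0 0) (x 0 1 ^+ 2) (cuspidal_height p b x ^+ 2).
have AG : A_equiv (F \o f) G1.
  apply: (A_equiv_trans (map_germ_comp hf hF) _ G1E); exists ds, Dt; split=> //.
  by apply: filterS2 fE (near_comp hf DtF) => x /= E ->; rewrite E.
have [U [sU U0] UE] := fold_local_equation hF mDs mEs mEt DsK EsK DtK DtF hh.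
(* By (B) a vector on which ['d h 0] is nonzero has a component in the limiting tangent plane with
   the same property; ['d h 0] is a multiple of the differential of the third component of [Ds]. *)
have [v dpv] : exists v, 'd p 0 v != 0.
  have [sh hS [w0 hw0]] := hh; have [x [y [Px Qy wE]]] := hB w0.
  have hx : 'd h 0 x != 0.
    apply: contra hw0 => /eqP E; apply/eqP.
    apply: (etrans (congr1 ('d h 0) wE)); apply: (etrans (linearD _ _ _)).
    by apply: (etrans (congr2 +%R E Qy)); rewrite addr0.
  have D2 : 'd Ds 0 x 0 2%:R != 0.
    apply: contra hx => /eqP E; apply/eqP.
    have sD := smooth_germ_coord 2%:R mDs.1.
    have sUD := smooth_germ_comp mDs sU.
    have UE' : \forall q \near (0 : 'rV[R]_3), Ds q 0 2%:R * (U \o Ds) q = h q.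
      by apply: filterS UE => q ->.
    apply: (etrans (diff0_near x (smooth_germM sD sUD) UE')).
    have D0 : Ds 0 0 2%:R = 0 by rewrite mDs.2 mxE.
    apply: (etrans (diff0_vanishing_mul x sD sUD D0)).
    by rewrite -(diff0_coord 2%:R x mDs.1) E mulr0.
  pose a := 'd dt 0 x; have aE : 'd et 0 a = x := etdt x.
  (* Otherwise [tanE] would make the normal vector orthogonal to the whole space. *)
  have a2 : a 0 2%:R = 0.
    apply/eqP; apply: contraT => a2; have [+ _] := nbhs_singleton hnu.2.
    rewrite (_ : nu 0 = 0) ?eqxx//; apply: dot_eq0 => w.
    have : a 0 2%:R * dot ('d et 0 e2) (nu 0) = 0.
      apply: (etrans (esym (tanE a))).
      exact: (etrans (congr1 (fun w => dot w (nu 0)) aE) Px).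
    move/eqP; rewrite mulf_eq0 (negbTE a2) /= => /eqP e20.
    apply: (etrans (esym (congr1 (fun w => dot w (nu 0)) (etdt w)))).
    by apply: (etrans (tanE _)); rewrite e20 mulr0.
  exists (prj a); apply: contra D2 => /eqP E; apply/eqP.
  apply: (etrans (esym (congr1 (fun w => 'd Ds 0 w 0 2%:R) aE))).
  apply: (etrans (esym (congr1 (fun w : 'rV[R]_3 => w 0 2%:R) (dPhiE a)))).
  apply: (etrans _ E); apply: (etrans _ (esym (dp (prj a)))).
  by rewrite inc_prj.
have [mg /nbhs_singleton dg gS _] := hgamma.
pose a := ds \o gamma.
have ma : map_germ a := map_germ_comp mg mds.

have a1 : \forall t \near (0 : R^o), a t 0 1 = 0.
  by apply: filterS2 gS (near_comp mg (sing_set_cuspidal hf mds mes mdt dsK dtf)) => t gt; exact.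
pose tau (t : R^o) : R^o := a t 0 0.
have stau : smooth_germ tau := smooth_germ_coord 0 ma.1.
(* The curve [a] is regular and stays on the first axis, so its velocity is carried by the first
   coordinate. *)
have dtau : 'd tau 0 (1 : R^o) != 0.
  apply: contra dg => /eqP E; apply/eqP.
  apply: (etrans (deriveE _ (smooth_germ_differentiable0 mg.1))).
  have da : 'd a 0 (1 : R^o) = 'd ds 0 ('d gamma 0 (1 : R^o)) := diff0_comp _ mg mds.1.
  apply: (diffeo_germ_diff_inj dds); apply: (etrans (esym da)); apply: row2P; rewrite [RHS]mxE.
    exact: (etrans (diff0_coord 0 _ ma.1) E).
  apply: (etrans (diff0_coord 1 _ ma.1)).
  have a1' : \forall t \near (0 : R^o), (fun=> 0 : R^o) t = a t 0 1 by apply: filterS a1 => t ->.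
  exact: (etrans (diff0_near _ (smooth_germ_cst _ _) a1') (diff0_cst _ _)).
have sUPc : smooth_germ (U \o (Phi \o cuspidal_edge)) := smooth_germ_comp (map_germ_comp mce mPhi) sU.
pose W (t : R^o) : R^o := (U \o (Phi \o cuspidal_edge)) (a t).
have sW : smooth_germ W := smooth_germ_comp ma sUPc.
have W0 : W 0 = U 0 by rewrite /W /= ma.2 mce.2 mPhi.2.
have W0' : W 0 != 0 by rewrite W0.
(* On the singular curve the cuspidal edge lies in the plane of [inc], and [pax] reads [p] at [a t]
   itself, without passing through [s]. *)
have gE : \forall t \near (0 : R^o), (h \o (f \o gamma)) t = p (a t) * W t.
  apply: filterS3 (near_comp mg (near_comp hf UE)) (near_comp mg fE) a1 => t /= -> -> at1.
  have ax : cuspidal_edge (a t) = inc (upd 1 0 (a t)).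
    by apply: row3P; rewrite !vecE ?updE //= at1 expr0n.
  have ut : upd 1 0 (a t) = a t by have := upd_id 1 (a t); rewrite at1.
  congr (_ * _); apply: (etrans (congr1 (fun y => Phi y 0 2%:R) ax)).
  by rewrite -pax ut.
have [n sn nE] := contact_factorization sp ma sW W0' a1 gE dtau hC.1.
have n0 : n 0 != 0.
  have := hC.2; rewrite (contact_derive ma sW a1 gE sn nE) => H.
  by apply: contra H => /eqP ->; rewrite mul0r mulr0.
have mu := @map_germ_upd0 R _ (1 : 'I_2).
have [m sm mE] : exists2 m : 'rV[R]_2 -> R^o, smooth_germ m &
    \forall y \near (0 : 'rV[R]_2), p y - p (upd 1 0 y) = (y : 'rV[R]_2) 0 1 * m y.
  apply: hadamard_germ; first exact: (smooth_germB sp (smooth_germ_comp mu sp)).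
  by apply: near_all => y; rewrite updK subrr.
have pE : \forall y \near (0 : 'rV[R]_2), p y = (y : 'rV[R]_2) 0 0 ^+ k.+1 * n y + y 0 1 * m y.
  by apply: filterS2 nE mE => y <- <-; rewrite addrC subrK.
have p0 : p 0 = 0 by rewrite (nbhs_singleton pE) !mxE exprS !mul0r addr0.
(* [0 ^+ k] is 1 for [k = 0]: the first term survives exactly when the contact is of order one.
   Otherwise [dpv] forces [m 0 != 0]. *)
have dpE w : 'd p 0 w = 0 ^+ k * n 0 * w 0 0 + m 0 * w 0 1.
  have sx0 : smooth_germ (fun x : 'rV[R]_2 => x 0 0 : R^o) by exact: smooth_germ_proj.
  have sx1 : smooth_germ (fun x : 'rV[R]_2 => x 0 1 : R^o) by exact: smooth_germ_proj.
  have sxn : smooth_germ (fun x : 'rV[R]_2 => x 0 0 ^+ k * n x : R^o).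
    exact: (smooth_germM (smooth_germX k sx0) sn).
  have pE' : \forall y \near (0 : 'rV[R]_2),
      (y : 'rV[R]_2) 0 0 * (y 0 0 ^+ k * n y) + y 0 1 * m y = p y.
    by apply: filterS pE => y ->; rewrite exprS mulrA.
  apply: (etrans (diff0_near w (smooth_germD (smooth_germM sx0 sxn) (smooth_germM sx1 sm)) pE')).
  apply: (etrans (diff0D w (smooth_germM sx0 sxn) (smooth_germM sx1 sm))); congr (_ + _).
    apply: (etrans (diff0_vanishing_mul w sx0 sxn (mxE _ _ _ _))); rewrite mxE.
    by congr (_ * _); exact: diff_proj.
  apply: (etrans (diff0_vanishing_mul w sx1 sm (mxE _ _ _ _))).
  by congr (_ * _); exact: diff_proj.
have AG0 : k = 0%N -> A_equiv (F \o f) (cuspidal_S 0 false).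
  move=> k0; apply: (A_equiv_trans (map_germ_comp hf hF) AG).
  apply: (cuspidal_S0_normalization sp sb b0 p0).
  by apply: contra n0; move/eqP/(etrans (esym (dpE _))); rewrite k0 !mxE !eqxx /= expr0 mul1r mulr1 mulr0 addr0 => ->.
have m0 : (0 < k)%N -> m 0 != 0.
  move=> k0; apply: contra dpv => /eqP E; apply/eqP; apply: (etrans (dpE v)).
  by rewrite E expr0n gtn_eqF// !mul0r addr0.
have AGk : (0 < k)%N -> A_equiv (F \o f) (cuspidal_S k (n 0 * m 0 < 0)).
  move=> k0; apply: (A_equiv_trans (map_germ_comp hf hF) AG).
  exact: (cuspidal_Sk_normalization sp sb b0 p0 (ltn0Sn k) sn sm n0 (m0 k0) pE).
split.
  have [k0|k0] := posnP k; last by exists (n 0 * m 0 < 0); exact: AGk.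
  by exists false; move: (AG0 k0); rewrite k0.
move=> ek; have k0 : (0 < k)%N by case: (k) ek.
pose q (t : R^o) : R^o := n (a t) * W t.
have sq : smooth_germ q := smooth_germM (smooth_germ_comp ma sn) sW.
have q0 : q 0 = n 0 * U 0 by rewrite /q ma.2 W0.
have hq : \forall t \near (0 : R^o), h (f (gamma t)) = tau t ^+ k.+1 * q t.
  exact: (contact_pow ma a1 gE nE).
have taupos t : 0 <= tau t ^+ k.+1 by rewrite exprn_even_ge0.
split.
  (* Along the curve [h] is an even power of [tau] times a function whose sign at 0 is that of
     [n 0 * U 0]. *)
  exists (n 0 * U 0 < 0).
  pose r (t : R^o) : R^o := (-1) ^+ (n 0 * U 0 < 0)%R * q t.
  have sr : smooth_germ r := smooth_germM (smooth_germ_cst _ _) sq.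
  have r0 : 0 < r 0.
    rewrite /r q0; have [nU|nU] := ltP (n 0 * U 0) 0; first by rewrite expr1 mulN1r oppr_gt0.
    by rewrite expr0 mul1r lt_neqAle eq_sym mulf_neq0.
  apply: filterS2 hq (smooth_germ_gt0 sr r0) => t E rt.
  by rewrite /half_space /= E mulrCA mulr_ge0// ltW.
move=> sg Hg.
(* With the opposite sign, staying in the half space would force [tau] to vanish near 0. *)
have n0U : 0 < (-1) ^+ sg * (n 0 * U 0).
  rewrite ltNge le_eqVlt mulf_eq0 signr_eq0 mulf_eq0 (negbTE n0) (negbTE U0) /=.
  apply/negP => H; apply: (smooth_germ_diff0_neq0 dtau).
  pose r (t : R^o) : R^o := - ((-1) ^+ sg * q t).
  have sr : smooth_germ r := smooth_germN (smooth_germM (smooth_germ_cst _ _) sq).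
  have r0 : 0 < r 0 by rewrite /r q0 oppr_gt0.
  apply: filterS3 hq (smooth_germ_gt0 sr r0) Hg => t E rt; rewrite /half_space /= E mulrCA.
  rewrite /r oppr_gt0 in rt; rewrite nmulr_lge0// => tk.
  have /eqP : tau t ^+ k.+1 = 0 by apply/eqP; rewrite eq_le tk taupos.
  by rewrite expf_eq0 => /andP[_ /eqP].
have dchi : diffeo_germ (s \o ds) := diffeo_germ_comp dds dsb.
have [mchi [e [me chiK eK]]] := dchi.
(* The unit relating [h] to the height, expressed in the variable [s (ds x)] at which the height is
   evaluated. *)
pose V := (U \o (Phi \o cuspidal_edge)) \o (ds \o e).
have sV : smooth_germ V := smooth_germ_comp (map_germ_comp me mds) sUPc.
have V0 : V 0 = U 0 by rewrite /V /= me.2 mds.2 mce.2 mPhi.2.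
have n0V : 0 < (-1) ^+ sg * (n 0 * V 0) by rewrite V0.
have hfE2 : \forall x \near (0 : 'rV[R]_2), h (f x) = cuspidal_height p b (s (ds x)) * V (s (ds x)).
  have hEd := near_comp mds hE.
  apply: filterS4 (near_comp hf UE) fE hEd chiK => x /= -> -> E2 E3.
  by rewrite /V /= E3 -E2.
have side : locally_in f (half_space h sg) <-> ~~ (n 0 * m 0 < 0).
  apply: (iff_trans _ (height_sign sb sn sm sV (ltn0Sn k) ek n0V (m0 k0) pE)); split=> H.
    by apply: filterS3 (near_comp me H) (near_comp me hfE2) eK => y H1 E1 /= E2; move: H1; rewrite /half_space /= E1 E2.
  by apply: filterS2 (near_comp mchi H) hfE2 => x /= H1 E1; rewrite /half_space /= E1.
split=> [/side|] H.
  by have := AGk k0; rewrite (negbTE H).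
by have := AGk k0; case: (n 0 * m 0 < 0) side => // -[_ side]; case: H; exact: side.
Qed.
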